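(* Let $q\in(1,\infty]$ and $r,s\in(1,\infty)$ with $q^{-1}+r^{-1}+s^{-1}=1$. Let $a:(0,T)\times\mathbb R^d\to\mathrm{Sym}_+(\mathbb R^d)$ be Borel with $a\in L^1_t(W^{2,q}_x)$, let $u\in L^\infty_t(L^r_x)$ and $f\in L^\infty_t(W^{2,s}_x)$. Then, for every $\alpha\in(0,1)$, $$\int_0^T\left|\int u_t\,[\mathsf P^\alpha,a_t:\nabla^2]f_t\,d\mathscr L^d-\alpha\int u_t\,[\Delta,a_t:\nabla^2]\,\mathsf P^\alpha f_t\,d\mathscr L^d\right|dt\le c\,\|\nabla^2a\|_{L^1_tL^q_x}\,\|u\|_{L^\infty_tL^r_x}\,\|f\|_{L^\infty_tL^s_x},$$ where $c$ is some constant depending on $d$ only. Moreover, for $u\in L^\infty_t(L^r_x\cap L^s_x)$, it holds $$\left|\int u_t\,[\mathsf P^\alpha,a_t:\nabla^2](\mathsf P^\alpha u_t)\,d\mathscr L^d\right|\to0\quad\text{in }L^1(0,T),\text{ as }\alpha\downarrow0.$$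
   Context: Fix $d\ge1$ and $T\in[0,\infty)$. $\mathscr L^d$ is Lebesgue measure on $\mathbb R^d$; $\mathrm{Sym}_+(\mathbb R^d)$ is the set of symmetric non-negative definite $d\times d$ matrices. $a_t:\nabla^2f=\sum_{i,j}a_t^{i,j}\partial_{i,j}f$. $(\mathsf P^\alpha)_{\alpha\ge0}$ is the standard heat semigroup on $\mathbb R^d$ (with generator the Laplacian $\Delta$), acting on the variable $x$ at fixed $t$. For operators $A,B$, $[A,B]=AB-BA$; thus $[\mathsf P^\alpha,a_t:\nabla^2]f=\mathsf P^\alpha(a_t:\nabla^2f)-a_t:\nabla^2(\mathsf P^\alpha f)$, and $[\Delta,a_t:\nabla^2]h=\sum_{i,j}\big(2\nabla a_t^{i,j}\cdot\nabla\partial_{i,j}h+(\Delta a_t^{i,j})\,\partial_{i,j}h\big)$. $L^p_t(E)$ (or $L^p_tE$), for $E$ a space of functions of $x\in\mathbb R^d$ (e.g. $L^q_x=L^q(\mathbb R^d,\mathscr L^d)$), is the space of functions on $(0,T)\times\mathbb R^d$ with norm $\big\|\,\|f_t\|_E\,\big\|_{L^p(0,T)}<\infty$; $W^{2,p}_x=\{f\in L^p_x:\nabla f\in L^p_x,\ \nabla^2f\in L^p_x\}$. *)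

(* Defs.v *)
From HB Require Import structures.
From mathcomp Require Import all_boot all_order all_algebra.
From mathcomp Require Import all_classical all_reals all_analysis.

Set Implicit Arguments.
Unset Strict Implicit.
Unset Printing Implicit Defensive.

Import Order.TTheory GRing.Theory Num.Theory.
Import numFieldNormedType.Exports.

Local Open Scope classical_set_scope.
Local Open Scope ring_scope.

(* The Borel sigma-algebra of R^n ('rV[R]_n), generated by the coordinate maps
   (as the library does for n.-tuple T). *)
Section measurable_rV.
Context (R : realType) (n : nat).

Definition coord_rV (i : 'I_n) (x : 'rV[R]_n) : measurableTypeR R := x ord0 i.

Let rV_set0 : g_sigma_preimage coord_rV set0.
Proof. exact: sigma_algebra0. Qed.

Let rV_setC A : g_sigma_preimage coord_rV A -> g_sigma_preimage coord_rV (~` A).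
Proof. exact: sigma_algebraC. Qed.

Let rV_bigcup (F : (set 'rV[R]_n)^nat) :
  (forall i, g_sigma_preimage coord_rV (F i)) ->
  g_sigma_preimage coord_rV (\bigcup_i (F i)).
Proof. exact: sigma_algebra_bigcup. Qed.

HB.instance Definition _ := @isMeasurable.Build default_measure_display
  'rV[R]_n (g_sigma_preimage coord_rV) rV_set0 rV_setC rV_bigcup.

Lemma measurable_coord_rV (i : 'I_n) :
  measurable_fun [set: 'rV[R]_n] (coord_rV i).
Proof.
move=> _ Y mY; apply: sub_sigma_algebra => /=.
by rewrite -bigcup_seq/=; exists i => /=; [rewrite mem_index_enum|exists Y].
Qed.

Lemma measurable_fun_rV d (T : measurableType d) (f : T -> 'rV[R]_n) :
  (forall i, measurable_fun [set: T] (coord_rV i \o f)) ->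
  measurable_fun [set: T] f.
Proof.
move=> mf _ A mA.
have : preimage_set_system setT f (g_sigma_preimage coord_rV) `<=` measurable.
  rewrite -g_sigma_preimage_comp.
  apply: smallest_sub; first exact: sigma_algebra_measurable.
  rewrite -bigcup_seq; apply: bigcup_sub => i _ B [C mC <-]; exact: mf.
by apply; exists A.
Qed.

End measurable_rV.

(* Lebesgue measure on R^n, by recursion: dirac mass on R^0 and, on R^(n+1),
   the image of the product of the two Lebesgue measures under
   (x, v) |-> (x, v_0, ..., v_(n-1)). *)
Section lebesgue_rV.
Context {R : realType}.

Definition cons_rV n (z : measurableTypeR R * 'rV[R]_n) : 'rV[R]_n.+1 :=
  row_mx (const_mx z.1 : 'rV[R]_1) z.2.

Definition uncons_rV n (x : 'rV[R]_n.+1) : measurableTypeR R * 'rV[R]_n :=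
  (x ord0 ord0, rsubmx (x : 'rV[R]_(1 + n))).

Lemma cons_rVK n : cancel (@cons_rV n) (@uncons_rV n).
Proof.
move=> [x v]; rewrite /uncons_rV /cons_rV row_mxKr; congr pair.
by rewrite mxE; case: splitP => // i _; rewrite mxE.
Qed.

Lemma measurable_cons_rV n :
  measurable_fun [set: measurableTypeR R * 'rV[R]_n] (@cons_rV n).
Proof.
apply: measurable_fun_rV => i; rewrite /cons_rV.
rewrite /coord_rV /comp /=; under eq_fun do rewrite mxE.
case: fintype.split => j; first by under eq_fun do rewrite mxE; exact: measurable_fst.
exact: (measurableT_comp (measurable_coord_rV j)).
Qed.

Lemma measurable_uncons_rV n :
  measurable_fun [set: 'rV[R]_n.+1] (@uncons_rV n).
Proof.
apply/measurable_fun_pairP; split.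
  exact: measurable_coord_rV.
apply: measurable_fun_rV => i.
rewrite (_ : _ \o _ = coord_rV (rshift 1 i)); first exact: measurable_coord_rV.
by apply/funext => x /=; rewrite /coord_rV /= mxE.
Qed.

Section step.
Context (n : nat) (mu : {sigma_finite_measure set 'rV[R]_n -> \bar R}).

Definition lebesgue_rV_step : set 'rV[R]_n.+1 -> \bar R :=
  pushforward (@lebesgue_measure R \x mu)%E (@cons_rV n).

Let img : {measure set 'rV[R]_n.+1 -> \bar R} :=
  measure_function_pushforward__canonical__measure_function_Measure
    (@lebesgue_measure R \x mu)%E (@measurable_cons_rV n).

Let step0 : lebesgue_rV_step set0 = 0%E.
Proof. exact: (measure0 img). Qed.

Let step_ge0 A : (0 <= lebesgue_rV_step A)%E.
Proof. exact: (measure_ge0 img). Qed.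

Let step_sigma_additive : semi_sigma_additive lebesgue_rV_step.
Proof. exact: (@measure_semi_sigma_additive _ _ _ img). Qed.

HB.instance Definition _ := isMeasure.Build _ _ _ lebesgue_rV_step
  step0 step_ge0 step_sigma_additive.

Let step_sigma_finite : sigma_finite setT lebesgue_rV_step.
Proof.
have /sigma_finiteP[F [FT ndF mF]] := sigma_finiteT (@lebesgue_measure R).
have /sigma_finiteP[G [GT ndG mG]] := sigma_finiteT mu.
have consK k : @cons_rV n @^-1` (@uncons_rV n @^-1` (F k `*` G k)) = F k `*` G k.
  rewrite -comp_preimage (_ : _ \o _ = id) ?preimage_id//.
  by apply/funext => z /=; rewrite cons_rVK.
exists (fun k => @uncons_rV n @^-1` (F k `*` G k)).
  rewrite -preimage_bigcup (_ : \bigcup_k _ = setT) ?preimage_setT//.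
  rewrite -subTset => -[x y] _.
  have : (\bigcup_k F k) x by rewrite -FT.
  have : (\bigcup_k G k) y by rewrite -GT.
  move=> [j _ Gjy] [i _ Fix]; exists (maxn i j) => //; split => /=.
  - by move: x Fix; apply/subsetPset/ndF/leq_maxl.
  - by move: y Gjy; apply/subsetPset/ndG/leq_maxr.
move=> k; have [mFk Fk] := mF k; have [mGk Gk] := mG k; split.
  rewrite -[X in measurable X]setTI; apply: measurable_uncons_rV => //.
  exact: measurableX.
rewrite /lebesgue_rV_step /pushforward consK product_measure1E//.
by rewrite lte_mul_pinfty// ge0_fin_numE.
Qed.

HB.instance Definition _ := Measure_isSigmaFinite.Build _ _ _
  lebesgue_rV_step step_sigma_finite.

End step.

Fixpoint lebesgue_rV (n : nat) : {sigma_finite_measure set 'rV[R]_n -> \bar R} :=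
  match n with
  | 0 => [the {sigma_finite_measure set _ -> \bar R} of dirac (0 : 'rV[R]_0)]
  | m.+1 => [the {sigma_finite_measure set _ -> \bar R} of
              lebesgue_rV_step (lebesgue_rV m)]
  end.

End lebesgue_rV.

Section weak_derivatives.
Context {R : realType} {d : nat}.
Implicit Types (f g phi : 'rV[R]_d -> R) (s : seq 'I_d).

(* Classical partial derivatives; cpartials [:: i; j] f is d_i (d_j f). *)
Definition cpartial (i : 'I_d) f : 'rV[R]_d -> R :=
  fun x => 'D_(delta_mx ord0 i) f x.

Definition cpartials s f := foldr cpartial f s.

Definition smooth f := forall s,
  continuous (cpartials s f) /\
  forall (i : 'I_d) x, derivable (cpartials s f) x (delta_mx ord0 i).

Definition test_function phi :=
  smooth phi /\ compact (closure [set x | phi x != 0]).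

Definition locally_integrable_rV f :=
  measurable_fun [set: 'rV[R]_d] f /\
  forall K : set 'rV[R]_d, compact K ->
    (\int[lebesgue_rV d]_(x in K) `|f x|%:E < +oo)%E.

Definition is_weak_partial (i : 'I_d) f g :=
  [/\ locally_integrable_rV f, locally_integrable_rV g &
      forall phi, test_function phi ->
        \int[lebesgue_rV d]_x (f x * cpartial i phi x) =
        - \int[lebesgue_rV d]_x (g x * phi x)].

Definition weakly_differentiable (i : 'I_d) f := exists g, is_weak_partial i f g.

(* A representative of the weak partial derivative (which is only determined
   almost everywhere), and the zero function if there is none. *)
Definition weak_partial (i : 'I_d) f : 'rV[R]_d -> R :=
  xget (cst 0) (is_weak_partial i f).

(* weak_partials [:: i; j] f is d_i (d_j f). *)
Definition weak_partials s f := foldr weak_partial f s.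

End weak_derivatives.

Section function_spaces.
Context {R : realType} {d : nat}.
Implicit Types (f : 'rV[R]_d -> R) (p : \bar R).

Definition Lx p : set ('rV[R]_d -> R) := [set f | f \in Lfun (lebesgue_rV d) p].

Definition Lx_norm p f : \bar R := Lnorm (lebesgue_rV d) p (EFin \o f).

Definition W2x p : set ('rV[R]_d -> R) := [set f |
  [/\ Lx p f,
      forall i, weakly_differentiable i f /\ Lx p (weak_partial i f) &
      forall i j, weakly_differentiable i (weak_partial j f) /\
                  Lx p (weak_partials [:: i; j] f)]].

Definition W2x_norm p f : \bar R :=
  (Lx_norm p f + \sum_(i < d) Lx_norm p (weak_partial i f)
   + \sum_(i < d) \sum_(j < d) Lx_norm p (weak_partials [:: i; j] f))%E.

End function_spaces.

Section time_dependent.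
Context {R : realType} (T : R).

Definition lebesgue_0T : {measure set (measurableTypeR R) -> \bar R} :=
  mrestr (@lebesgue_measure R)
    (measurable_itv `]0, T[ : measurable (`]0, T[%classic : set (measurableTypeR R))).

(* The norm of L^p_t(E); functions on (0,T) x R^d are represented by functions
   on R x R^d whose values outside (0,T) x R^d are irrelevant. *)
Definition Lpt_norm d (p : \bar R) (normE : ('rV[R]_d -> R) -> \bar R)
    (f : R -> 'rV[R]_d -> R) : \bar R :=
  Lnorm lebesgue_0T p (fun t => normE (f t)).

Definition borel_0T d (f : R -> 'rV[R]_d -> R) :=
  measurable_fun (`]0, T[%classic `*` [set: 'rV[R]_d]
                   : set (measurableTypeR R * 'rV[R]_d)) (fun z => f z.1 z.2).

Definition Lpt d (p : \bar R) (E : set ('rV[R]_d -> R))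
    (normE : ('rV[R]_d -> R) -> \bar R) : set (R -> 'rV[R]_d -> R) :=
  [set f | [/\ borel_0T f, \forall t \ae lebesgue_0T, E (f t) &
               (Lpt_norm p normE f < +oo)%E]].

End time_dependent.

Section operators.
Context {R : realType} {d : nat}.
Implicit Types (f g h u : 'rV[R]_d -> R) (a : 'rV[R]_d -> 'M[R]_d).

Definition sym_nonneg (M : 'M[R]_d) :=
  M^T = M /\ forall v : 'rV[R]_d, 0 <= (v *m M *m v^T) ord0 ord0.

Definition heat_kernel (alpha : R) (x : 'rV[R]_d) : R :=
  (4 * pi * alpha) `^ (- (d%:R / 2)) *
  expR (- (\sum_(i < d) (x ord0 i) ^+ 2) / (4 * alpha)).

(* The heat semigroup with generator Delta (not Delta / 2). *)
Definition heat (alpha : R) f : 'rV[R]_d -> R :=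
  if alpha == 0 then f
  else fun x => \int[lebesgue_rV d]_y (heat_kernel alpha (x - y) * f y).

(* a : nabla^2 f *)
Definition contract_hessian a f : 'rV[R]_d -> R := fun x =>
  \sum_(i < d) \sum_(j < d) a x i j * weak_partials [:: i; j] f x.

Definition commutator (A B : ('rV[R]_d -> R) -> 'rV[R]_d -> R) f :
    'rV[R]_d -> R := fun x => A (B f) x - B (A f) x.

(* [Delta, a : nabla^2] h, in expanded form:
   sum_ij 2 nabla a^ij . nabla d_ij h + (Delta a^ij) d_ij h *)
Definition laplacian_commutator a h : 'rV[R]_d -> R := fun x =>
  \sum_(i < d) \sum_(j < d)
    (2 * (\sum_(k < d) weak_partial k (fun y => a y i j) x *
                       weak_partials [:: k; i; j] h x)
     + (\sum_(k < d) weak_partials [:: k; k] (fun y => a y i j) x) *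
       weak_partials [:: i; j] h x).

(* Pointwise Euclidean norm of the 4-tensor nabla^2 a. *)
Definition hessian_norm a : 'rV[R]_d -> R := fun x =>
  Num.sqrt (\sum_(i < d) \sum_(j < d) \sum_(k < d) \sum_(l < d)
              (weak_partials [:: k; l] (fun y => a y i j) x) ^+ 2).

Definition pairing u h : R := \int[lebesgue_rV d]_x (u x * h x).

End operators.

(* Main.v *)
Require Import Defs.
From HB Require Import structures.
From mathcomp Require Import all_boot all_order all_algebra.
From mathcomp Require Import all_classical all_reals all_analysis.
From mathcomp Require Import measurable_realfun ess_sup_inf ring lra.
Set Implicit Arguments.
Unset Strict Implicit.
Unset Printing Implicit Defensive.
Import Order.TTheory GRing.Theory Num.Theory.
Import numFieldNormedType.Exports.
Local Open Scope classical_set_scope.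
Local Open Scope ring_scope.
Import HBNNSimple.

(** Both assertions reduce to estimates at a fixed time on the trilinear
    integral [Phi u a v w1 w2], the integral of u (x) a (x - w1) v (x - w2).
    Hoelder's inequality for three functions bounds it by the product of the
    three norms whatever w1 and w2 are; it is uniformly continuous in (w1, w2),
    because after a change of variables the increments fall on u and v, whose
    exponents are finite; and a weak derivative of a or of v becomes a classical
    derivative in w1 or w2 ([Phi_UD1], [Phi_UD2]). This last point allows
    integration by parts against Gaussian kernels and Taylor expansion in w1
    without ever regularising a.

    First assertion. Write p for the heat kernel at time alpha. By Fubini's
    theorem the pairing of u with the commutator is, summed over (i, j), the
    integral of p (z) Phi u a_ij (d_ij f) z z - d_ij p (z) Phi u a_ij f 0 z. The
    two derivatives of f are moved onto p and onto a, and those of P^alpha f in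
    the pairing with [Delta, a : nabla^2] onto p. The identity
    2 alpha d_k d_ij p = - (z_k d_ij p + delta_ki d_j p + delta_kj d_i p)
    then turns the expression to be estimated into the integral of
      p Phi (d_ij a) z z - d_j p [Phi (d_i a) z z - Phi (d_i a) 0 z]
      - d_i p [Phi (d_j a) z z - Phi (d_j a) 0 z]
      + d_ij p [Phi a z z - Phi a 0 z + sum_k z_k Phi (d_k a) 0 z]
      - alpha sum_k d_ij p Phi (d_kk a) 0 z,
    where u and f are omitted. The brackets are Taylor remainders of orders 1
    and 2 of a, bounded by |z| and |z|^2 times the norm of nabla^2 a, and p,
    |z| |d_i p|, |z|^2 |d_ij p| and alpha |d_ij p| are all at most a dimensional
    constant times the kernel at time 2 alpha ([commutator_remainder]).

    Second assertion. With f = P^alpha u the pairing is a double integral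
    against p (y) d_ij p (z) of Phi a y (y + z) - Phi a 0 (y + z). Since both
    functions paired with a are u, exchanging them and reflecting y and z
    replaces the integrand by a multiple of the second difference of a in the
    directions y and z ([commutator_symmetrised]). Averaging over y and - y
    makes the difference between u u (. - y - z) and u (. - y) u (. - z) appear,
    so the integrand is at most |y| |z| times the norm of nabla^2 a times the
    L^r and L^s moduli of continuity of u at y. The factor |y| |z| compensates
    the singularity 1 / alpha of d_ij p, which gives a bound uniform in alpha,
    and the moduli of continuity make the limit 0, since the kernels concentrate
    at 0 ([commutator_term_bound], [commutator_term_vanishes]).

    Time is then integrated. The functions of t in the statement need not be
    measurable, and their integral is a supremum over simple functions below
    them, which is still monotone ([ae_le_lower_integral]); this is all that the
    first assertion requires. In the second one the pairing is, for almost every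
    t, a finite sum of terms that are measurable in t, to each of which the
    dominated convergence theorem applies. *)

(** * Lebesgue measure on R^n *)

Section measurable_maps.
Context {R : realType} {n : nat}.

Lemma measurable_coord d (T : measurableType d) (f : T -> 'rV[R]_n) (i : 'I_n) :
  measurable_fun [set: T] f -> measurable_fun [set: T] (fun x => f x ord0 i).
Proof. move=> mf; exact: (measurableT_comp (measurable_coord_rV i) mf). Qed.

Lemma measurable_to_rV d (T : measurableType d) (f : T -> 'rV[R]_n) :
  (forall i, measurable_fun [set: T] (fun x => f x ord0 i : R)) ->
  measurable_fun [set: T] f.
Proof. by move=> mf; apply: measurable_fun_rV => i; exact: mf. Qed.

Lemma measurable_addrV d (T : measurableType d) (f g : T -> 'rV[R]_n) :
  measurable_fun [set: T] f -> measurable_fun [set: T] g ->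
  measurable_fun [set: T] (fun x => f x + g x).
Proof.
move=> mf mg; apply: measurable_to_rV => i.
under eq_fun do rewrite mxE.
by apply: measurable_funD; exact: measurable_coord.
Qed.

Lemma measurable_opprV d (T : measurableType d) (f : T -> 'rV[R]_n) :
  measurable_fun [set: T] f -> measurable_fun [set: T] (fun x => - f x).
Proof.
move=> mf; apply: measurable_to_rV => i.
under eq_fun do rewrite mxE.
by apply: measurable_funN; exact: measurable_coord.
Qed.

Lemma measurable_subrV d (T : measurableType d) (f g : T -> 'rV[R]_n) :
  measurable_fun [set: T] f -> measurable_fun [set: T] g ->
  measurable_fun [set: T] (fun x => f x - g x).
Proof.
by move=> mf mg; apply: measurable_addrV => //; exact: measurable_opprV.
Qed.

End measurable_maps.

Section invariance1.
Context {R : realType}.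
Local Notation mu := (@lebesgue_measure R).
Local Open Scope ereal_scope.

Lemma measurable_affine (e a : R) :
  measurable_fun [set: measurableTypeR R]
    (fun x : measurableTypeR R => (e * x + a)%R : measurableTypeR R).
Proof.
apply: measurable_funD => //; exact: measurable_funM.
Qed.

(** The image measure under x |-> e x + a, e = 1 or -1, agrees with Lebesgue
    measure on half-open intervals, hence everywhere. Translations and
    reflections are treated together here and in dimension n, where the
    induction is on the coordinates. *)
Lemma lebesgue_affine (e a : R) A : (e = 1 \/ e = -1)%R -> measurable A ->
  mu ((fun x : R => (e * x + a)%R) @^-1` A) = mu A.
Proof.
move=> e1 mA; apply/esym.
pose m := measure_function_pushforward__canonical__measure_function_Measure mu
  (measurable_affine e a).
apply: (@lebesgue_measure_unique R m) => //.
move=> X [[x y] _ <-] /=; rewrite /pushforward.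
have -> : (fun x0 : R => (e * x0 + a)%R) @^-1` `]x, y] =
  if e == 1%R then `](x - a)%R, (y - a)%R]%classic else `[(a - y)%R, (a - x)%R[%classic.
  case: e1 => ->.
    rewrite eqxx; apply/seteqP; split => z /=; rewrite !in_itv/= => /andP[? ?]; apply/andP; split; lra.
  have -> : (-1 == 1 :> R)%R = false by apply/negbTE/eqP; lra.
  apply/seteqP; split => z /=; rewrite !in_itv/= => /andP[? ?]; apply/andP; split; lra.
case: ifP => _; rewrite !lebesgue_measure_itv/= !lte_fin.
  have -> : (x - a < y - a)%R = (x < y)%R by apply/idP/idP; lra.
  case: ifP => // _; rewrite -!EFinB; congr EFin; ring.
have -> : (a - y < a - x)%R = (x < y)%R by apply/idP/idP; lra.
case: ifP => // _; rewrite -!EFinB; congr EFin; ring.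
Qed.

Lemma integral_affine (e a : R) (f : R -> \bar R) : (e = 1 \/ e = -1)%R ->
  measurable_fun [set: measurableTypeR R] f -> (forall x, 0 <= f x) ->
  \int[mu]_x f (e * x + a)%R = \int[mu]_x f x.
Proof.
move=> e1 mf f0.
pose m := measure_function_pushforward__canonical__measure_function_Measure mu
  (measurable_affine e a).
transitivity (\int[m]_x f x).
  by rewrite ge0_integral_pushforward//; exact: measurable_affine.
by apply: eq_measure_integral => A mA _; rewrite /= /pushforward lebesgue_affine.
Qed.
End invariance1.

Section lebesgue_rV_theory.
Context {R : realType}.
Local Notation mu := (@lebesgue_measure R).
Local Open Scope ereal_scope.

(** Lebesgue measure on R^(n+1) is the image of a product measure: Tonelli's
    theorem peels off the first coordinate, and this is the only form in which
    the recursive definition is used. *)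
Lemma integral_rVS n (f : 'rV[R]_n.+1 -> \bar R) :
  measurable_fun [set: 'rV[R]_n.+1] f -> (forall x, 0 <= f x) ->
  \int[lebesgue_rV n.+1]_x f x =
  \int[mu]_x \int[lebesgue_rV n]_v f (cons_rV (x, v)).
Proof.
move=> mf f0.
transitivity (\int[(mu \x lebesgue_rV n)]_z f (cons_rV z)).
  by rewrite /= ge0_integral_pushforward//; exact: measurable_cons_rV.
rewrite fubini_tonelli1//; exact: (measurableT_comp mf (@measurable_cons_rV R n)).
Qed.

Lemma integral_rV0 (f : 'rV[R]_0 -> \bar R) :
  measurable_fun [set: 'rV[R]_0] f ->
  \int[lebesgue_rV 0]_x f x = f 0%R.
Proof. by move=> mf; rewrite /= integral_dirac// diracT mul1e. Qed.

Lemma cons_rV0 n (x : R) (v : 'rV[R]_n) : cons_rV (x, v) ord0 ord0 = x.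
Proof. by rewrite /cons_rV mxE; case: splitP => // i _; rewrite mxE. Qed.

Lemma cons_rV_lift n (x : R) (v : 'rV[R]_n) i :
  cons_rV (x, v) ord0 (lift ord0 i) = v ord0 i.
Proof.
rewrite /cons_rV mxE; case: splitP => j /= ij.
  by exfalso; move: ij (ltn_ord j); rewrite /bump /= add1n => <-.
by congr (v _ _); apply/val_inj => /=; move: ij; rewrite /= /bump /= !add1n => -[].
Qed.

Lemma cons_rV_affine n (e : R) (x : R) (v : 'rV[R]_n) (a : 'rV[R]_n.+1) :
  (e *: cons_rV (x, v) + a =
  cons_rV ((e * x + a ord0 ord0)%R, e *: v + \row_i a ord0 (lift ord0 i)))%R.
Proof.
apply/rowP => i; rewrite [LHS]mxE [X in (X + _)%R]mxE.
case: (unliftP ord0 i) => [j|] ->.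
  by rewrite !cons_rV_lift !mxE.
by rewrite !cons_rV0.
Qed.

Lemma measurable_affine_rV n (e : R) (a : 'rV[R]_n) :
  measurable_fun [set: 'rV[R]_n] (fun x : 'rV[R]_n => (e *: x + a)%R).
Proof.
apply: measurable_addrV => //; apply: measurable_to_rV => i.
under eq_fun do rewrite mxE.
by apply: measurable_funM => //; exact: measurable_coord.
Qed.

Lemma integral_affine_rV n (e : R) (a : 'rV[R]_n) (f : 'rV[R]_n -> \bar R) :
  (e = 1 \/ e = -1)%R ->
  measurable_fun [set: 'rV[R]_n] f -> (forall x, 0 <= f x) ->
  \int[lebesgue_rV n]_x f (e *: x + a)%R = \int[lebesgue_rV n]_x f x.
Proof.
move=> e1; elim: n a f => [|n IH] a f mf f0.
  rewrite !integral_rV0//; first by congr f; apply/rowP => -[].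
  exact: (measurableT_comp mf (@measurable_affine_rV 0 e a)).
rewrite [RHS]integral_rVS//.
apply: etrans.
  apply: (@integral_rVS n (fun x => f (e *: x + a)%R)) => //.
  exact: (measurableT_comp mf (@measurable_affine_rV n.+1 e a)).
have mc : measurable_fun setT (f \o @cons_rV R n).
  exact: (measurableT_comp mf (@measurable_cons_rV R n)).
pose g x := \int[lebesgue_rV n]_v f (cons_rV (x, v)).
transitivity (\int[mu]_x g (e * x + a ord0 ord0)%R).
  apply: eq_integral => x _; rewrite /g.
  under eq_integral do rewrite cons_rV_affine.
  rewrite (IH _ (fun v => f (cons_rV ((e * x + a ord0 ord0)%R, v))))//.
  exact: (measurableT_comp mc (measurable_pair1 _)).
apply: integral_affine => //; last by move=> x; exact: integral_ge0.
exact: (measurable_fun_fubini_tonelli_F _ mc (fun z => f0 _)).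
Qed.

(** Computes volumes of boxes and integrals of Gaussians, both being products
    of functions of one coordinate. *)
Lemma integral_prod_rV n (g : 'I_n -> R -> R) (c : 'I_n -> R) :
  (forall i, measurable_fun [set: R] (g i)) -> (forall i x, (0 <= g i x)%R) ->
  (forall i, \int[mu]_x (g i x)%:E = (c i)%:E) ->
  \int[lebesgue_rV n]_x (\prod_(i < n) g i (x ord0 i))%:E =
  (\prod_(i < n) c i)%:E.
Proof.
elim: n g c => [|n IH] g c mg g0 gc.
  rewrite integral_rV0 ?big_ord0//.
  by under [X in measurable_fun _ X]eq_fun do rewrite big_ord0; exact: measurable_cst.
have mp m (h : 'I_m -> R -> R) : (forall i, measurable_fun [set: R] (h i)) ->
    measurable_fun setT (fun x : 'rV[R]_m => (\prod_(i < m) h i (x ord0 i))%:E).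
  move=> mh; apply/measurable_EFinP; apply: measurable_prod => i _.
  by apply: (measurableT_comp (mh i)); exact: measurable_coord.
apply: etrans.
  apply: (@integral_rVS n (fun x => (\prod_(i < n.+1) g i (x ord0 i))%:E)).
    exact: mp.
  by move=> x; rewrite lee_fin prodr_ge0.
rewrite big_ord_recl.
transitivity (\int[mu]_x ((g ord0 x)%:E * (\prod_(i < n) c (lift ord0 i))%:E)).
  apply: eq_integral => x _.
  under eq_integral do rewrite big_ord_recl cons_rV0 EFinM.
  rewrite ge0_integralZl_EFin//; last 2 first.
  - by move=> v _; rewrite lee_fin prodr_ge0.
  - under eq_fun do under eq_bigr do rewrite cons_rV_lift.
    exact: (mp _ (fun i => g (lift ord0 i))).
  rewrite -(IH (fun i => g (lift ord0 i)))//.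
  by congr (_ * _); apply: eq_integral => v _; under eq_bigr do rewrite cons_rV_lift.
rewrite ge0_integralZr//.
- by rewrite gc -EFinM.
- by apply/measurable_EFinP; exact: (mg ord0).
- by move=> *; rewrite lee_fin.
- rewrite lee_fin prodr_ge0// => i _; rewrite -lee_fin -gc.
  by apply: integral_ge0 => x _; rewrite lee_fin.
Qed.

End lebesgue_rV_theory.

Section rV_lebesgue.
Context {R : realType} {d : nat}.
Local Notation lam := (@lebesgue_rV R d).
Local Notation V := 'rV[R]_d.

Lemma integral_affineT (e : R) (a : V) (f : V -> \bar R) :
  (e = 1 \/ e = -1) -> measurable_fun [set: V] f ->
  (\int[lam]_x f (e *: x + a)%R = \int[lam]_x f x)%E.
Proof.
move=> e1 mf.
rewrite integralE [RHS]integralE; congr (_ - _)%E.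
  rewrite (_ : (fun x => f (e *: x + a)) = f \o (fun x : V => e *: x + a))// [in LHS]funepos_comp.
  apply: (@integral_affine_rV _ _ e a f^\+%E) => //; exact: measurable_funepos.
rewrite (_ : (fun x => f (e *: x + a)) = f \o (fun x : V => e *: x + a))// [in LHS]funeneg_comp.
apply: (@integral_affine_rV _ _ e a f^\-%E) => //; exact: measurable_funeneg.
Qed.

Lemma integral_shift (a : V) (f : V -> \bar R) : measurable_fun [set: V] f ->
  (\int[lam]_x f (x + a)%R = \int[lam]_x f x)%E.
Proof.
move=> mf; rewrite -[RHS](integral_affineT a (or_introl erefl) mf).
by under [RHS]eq_integral do rewrite scale1r.
Qed.

Lemma integral_reflect (a : V) (f : V -> \bar R) : measurable_fun [set: V] f ->
  (\int[lam]_x f (a - x)%R = \int[lam]_x f x)%E.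
Proof.
move=> mf; rewrite -[RHS](integral_affineT a (or_intror erefl) mf).
by under [RHS]eq_integral do rewrite scaleN1r addrC.
Qed.

(** The closed ball of radius M of the sup norm. Boxes serve both as
    neighbourhoods of 0 and as an exhaustion of R^n; their volume is a
    product. *)
Definition box (M : R) : set V := [set x | forall i, `|x ord0 i| <= M].

Lemma measurable_coord_id i : measurable_fun [set: V] (fun x : V => x ord0 i).
Proof. exact: measurable_coord_rV. Qed.

Lemma boxE M : box M = \bigcap_(i in [set: 'I_d]) (fun x : V => x ord0 i) @^-1` `[- M, M].
Proof.
apply/seteqP; split => x /= h i.
  by move=> _; rewrite /= in_itv /= -ler_norml h.
by have := h i I; rewrite /= in_itv /= -ler_norml.
Qed.

Lemma measurable_box M : measurable (box M).
Proof.
rewrite boxE; apply: fin_bigcap_measurable => // i _.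
rewrite -[X in measurable X]setTI.
exact: (measurable_coord_id i).
Qed.

Lemma indic_box M (x : V) :
  \1_(box M) x = \prod_(i < d) \1_(`[- M, M]%classic) (x ord0 i) :> R.
Proof.
rewrite indicE; have [|] := boolP (x \in box M).
  rewrite inE => bx; rewrite big1// => i _; rewrite indicE mem_set//=.
  by rewrite in_itv /= -ler_norml bx.
rewrite notin_setE => /existsNP [i xi]; rewrite (bigD1 i)//= indicE memNset ?mul0r//=.
by rewrite in_itv /= -ler_norml.
Qed.

Lemma lebesgue_box (M : R) : 0 <= M -> (lam (box M) = ((2 * M) ^+ d)%:E)%E.
Proof.
move=> M0; rewrite -[LHS]mul1e -integral_cst; last exact: measurable_box.
rewrite integral_mkcond.
transitivity (\int[lam]_x (\prod_(i < d) \1_(`[- M, M]%classic) (x ord0 i))%:E)%E.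
  apply: eq_integral => x _; rewrite -indic_box patchE indicE.
  by case: ifPn.
rewrite (@integral_prod_rV R d (fun _ => \1_(`[- M, M]%classic)) (fun _ => 2 * M)).
- by rewrite prodr_const card_ord.
- by move=> i; exact: measurable_indic.
- by [].
move=> i; rewrite integral_indic// setIT; have := @lebesgue_measure_itv R `[- M, M]; rewrite /= => ->; rewrite lte_fin.
case: ltP => h; rewrite -?EFinB; congr EFin; lra.
Qed.

Lemma box_lty M : (lam (box M) < +oo)%E.
Proof.
have [M0|M0] := leP 0 M; first by rewrite lebesgue_box ?ltry.
apply: (@le_lt_trans _ _ (lam (box 0)))%E; last by rewrite lebesgue_box ?ltry.
apply: le_measure; rewrite ?inE; try exact: measurable_box.
by move=> x bx i; exact: (le_trans (bx i) (ltW M0)).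
Qed.

Lemma ball_rV (x : V) (e : R) y : 0 < e ->
  ball x e y <-> forall i, `|x ord0 i - y ord0 i| < e.
Proof.
move=> e0; split => [[_ h] i|h]; first exact: h.
by split => // i j; rewrite (ord1 i); exact: h.
Qed.

Lemma measurable_ball_rV (x : V) (e : R) : measurable (ball x e : set V).
Proof.
have [e0|e0] := ltP 0 e; last first.
  rewrite (_ : ball _ _ = set0)//; apply/seteqP; split => // y [/=].
  by rewrite ltNge e0.
rewrite (_ : ball _ _ = \bigcap_(i in [set: 'I_d])
    (fun y : V => x ord0 i - y ord0 i) @^-1` `]- e, e[%classic).
  apply: fin_bigcap_measurable => // i _.
  rewrite -[X in measurable X]setTI.
  have : measurable_fun setT (fun y : V => x ord0 i - y ord0 i).
    by apply: measurable_funB => //; exact: measurable_coord.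
  by apply.
apply/seteqP; split => y.
  by move=> /(ball_rV _ _ e0) h i _ /=; rewrite in_itv /= -ltr_norml h.
move=> h; apply/(ball_rV _ _ e0) => i; have /= := h i I.
by rewrite in_itv /= -ltr_norml.
Qed.

(** The sigma-algebra is generated by the coordinates; an open set is the
    union of the balls with rational centre and radius 1 / (m + 1) that it
    contains. *)
Lemma open_measurable_rV (U : set V) : open U -> measurable U.
Proof.
move=> oU.
pose B (p : 'rV[rat]_d * nat) : set V := ball (\row_i ratr (p.1 ord0 i) : V) (p.2.+1%:R^-1).
rewrite (_ : U = \bigcup_(p in [set p | B p `<=` U]) B p).
  rewrite bigcup_mkcond; apply: countable_bigcupT_measurable.
    exact: countableP.
  by move=> p; case: ifP => // _; exact: measurable_ball_rV.
apply/seteqP; split => x; last by move=> [p /= + Bp]; exact.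
move=> Ux; have : nbhs x U by exact: open_nbhs_nbhs.
move=> /nbhs_ballP [e /= e0 eU].
have [n ne] : exists n : nat, n.+1%:R^-1 < e / 2.
  have e2 : 0 < e / 2 by lra.
  exists (Num.trunc (e / 2)^-1).
  rewrite invf_plt ?posrE//; exact: truncnS_gt.
have [k kE] : exists k : R, k = n.+1%:R^-1 by exists n.+1%:R^-1.
have k0 : 0 < k by rewrite kE invr_gt0 ltr0n.
rewrite -kE in ne.
have /choice [q qP] : forall i : 'I_d, exists r : rat, `|x ord0 i - ratr r| < k.
  move=> i.
  have h : x ord0 i - k < x ord0 i + k by lra.
  have [r] := rat_in_itvoo h; rewrite in_itv/= => /andP[r1 r2].
  by exists r; rewrite ltr_norml; apply/andP; split; lra.
exists (\row_i q i, n) => /=; last first.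
  apply/ball_rV; first by rewrite -kE.
  by move=> i; rewrite !mxE/= -kE distrC.
move=> y; rewrite /B/= -kE => /(ball_rV _ _ k0) yB.
apply: eU; apply/ball_rV => // i.
have := yB i; rewrite !mxE/= => h.
have := ler_distD (ratr (q i)) (x ord0 i) (y ord0 i).
have := qP i; lra.
Qed.

Lemma continuous_measurable_rV (f : V -> R) : continuous f -> measurable_fun [set: V] f.
Proof.
move=> cf; apply: (measurability _ (RGenOpens.measurableE R)).
move=> _ [_ [a [b ->] <-]]; rewrite setTI.
by apply: open_measurable_rV; apply: open_comp.
Qed.

Lemma compact_box (K : set V) : compact K -> exists M : R, K `<=` box M.
Proof.
move=> cK.
suff h i : exists M : R, forall x : V, K x -> `|x ord0 i| <= M.
  have /choice [M MP] := h.
  exists (\sum_i `|M i|) => x Kx i.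
  rewrite (le_trans (MP i _ Kx))// (le_trans (ler_norm _))//.
  by rewrite (bigD1 i)//= lerDl sumr_ge0.
have : compact ((fun x : V => x ord0 i) @` K).
  apply: continuous_compact => //; apply: continuous_subspaceT => x.
  exact: coord_continuous.
move=> /compact_bounded [M [_ h]].
exists (M + 1) => x Kx; apply: (h (M + 1)); first by rewrite ltrDl.
by exists x.
Qed.

End rV_lebesgue.

(** * Real-valued integrals, Fubini and convolution *)

Section integral_toolkit.
Context {d0} {T : measurableType d0} {R : realType}.
Variable mu : {measure set T -> \bar R}.
Implicit Types f g : T -> R.

(** Integrability of a real-valued function; the lemmas whose names begin with
    I compute or bound its integral, as a real number. *)
Definition L1 f := mu.-integrable [set: T] (EFin \o f).

Lemma L1_measurable f : L1 f -> measurable_fun [set: T] f.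
Proof. by move=> /integrableP[/measurable_EFinP]. Qed.

Lemma L1_lty f : measurable_fun [set: T] f ->
  (\int[mu]_x `|f x|%:E < +oo)%E -> L1 f.
Proof. by move=> mf h; apply/integrableP; split => //; exact/measurable_EFinP. Qed.

Lemma L1_abs_lty f : L1 f -> (\int[mu]_x `|f x|%:E < +oo)%E.
Proof. by move=> /integrableP[_]. Qed.

Lemma L1_le f g : measurable_fun [set: T] f -> L1 g ->
  (forall x, `|f x| <= g x) -> L1 f.
Proof.
move=> mf lg fg; apply: (le_integrable measurableT _ _ lg).
  exact/measurable_EFinP.
by move=> x _; rewrite lee_fin (le_trans (fg x))// ler_norm.
Qed.

Lemma L1_norm f : L1 f -> L1 (fun x => `|f x|).
Proof. by move=> /integrable_abse. Qed.

Lemma L1D f g : L1 f -> L1 g -> L1 (fun x => f x + g x).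
Proof. by move=> lf lg; rewrite /L1; exact: (integrableD measurableT lf lg). Qed.

Lemma L1B f g : L1 f -> L1 g -> L1 (fun x => f x - g x).
Proof. by move=> lf lg; rewrite /L1; exact: (integrableB measurableT lf lg). Qed.

Lemma L1Z c f : L1 f -> L1 (fun x => c * f x).
Proof. by move=> lf; exact: (integrableZl measurableT c lf). Qed.

Lemma L1N f : L1 f -> L1 (fun x => - f x).
Proof. by move=> /(L1Z (-1)); under [X in L1 X -> _]eq_fun do rewrite mulN1r. Qed.

Lemma L1_0 : L1 (fun=> 0).
Proof. exact: integrable0. Qed.

Lemma L1_sum (I : Type) (s : seq I) (F : I -> T -> R) :
  (forall i, L1 (F i)) -> L1 (fun x => \sum_(i <- s) F i x).
Proof.
move=> h; elim: s => [|i s IH].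
  by under eq_fun do rewrite big_nil; exact: L1_0.
by under eq_fun do rewrite big_cons; exact: L1D.
Qed.

Lemma L1_ext f g : f =1 g -> L1 f -> L1 g.
Proof. by move=> /funext ->. Qed.

Lemma ID f g : L1 f -> L1 g ->
  \int[mu]_x (f x + g x) = \int[mu]_x f x + \int[mu]_x g x.
Proof. exact: RintegralD. Qed.

Lemma IB f g : L1 f -> L1 g ->
  \int[mu]_x (f x - g x) = \int[mu]_x f x - \int[mu]_x g x.
Proof. exact: RintegralB. Qed.

Lemma IZ c f : L1 f -> \int[mu]_x (c * f x) = c * \int[mu]_x f x.
Proof. exact: RintegralZl. Qed.

Lemma IN f : L1 f -> \int[mu]_x (- f x) = - \int[mu]_x f x.
Proof.
by move=> lf; rewrite -mulN1r -IZ//; under [RHS]eq_Rintegral do rewrite mulN1r.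
Qed.

Lemma I0 : \int[mu]_x (0 : R) = 0.
Proof. by rewrite /Rintegral integral0. Qed.

Lemma I_sum (I : Type) (s : seq I) (F : I -> T -> R) :
  (forall i, L1 (F i)) ->
  \int[mu]_x (\sum_(i <- s) F i x) = \sum_(i <- s) \int[mu]_x F i x.
Proof.
move=> h; elim: s => [|i s IH].
  by under eq_Rintegral do rewrite big_nil; rewrite big_nil I0.
under eq_Rintegral do rewrite big_cons.
by rewrite big_cons ID ?IH//; exact: L1_sum.
Qed.

Lemma I_ext f g : f =1 g -> \int[mu]_x f x = \int[mu]_x g x.
Proof. by move=> h; apply: eq_Rintegral => x _; exact: h. Qed.

Lemma I_ae f g : measurable_fun [set: T] f -> measurable_fun [set: T] g ->
  (\forall x \ae mu, f x = g x) -> \int[mu]_x f x = \int[mu]_x g x.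
Proof.
move=> mf mg fg; rewrite /Rintegral; congr fine.
apply: ae_eq_integral => //; try exact/measurable_EFinP.
by apply: filterS fg => x -> _.
Qed.

Lemma L1_ae f (F : T -> \bar R) : measurable_fun [set: T] f ->
  mu.-integrable setT F -> (\forall x \ae mu, (f x)%:E = F x) -> L1 f.
Proof.
move=> mf /integrableP[mF Fy] fF; apply: L1_lty => //.
rewrite (ae_eq_integral (fun x => `|F x|)%E) //.
- by apply/measurable_EFinP; exact: measurableT_comp.
- exact: measurableT_comp.
- by apply: filterS fF => x /= <- _.
Qed.

Lemma I_le f g : L1 f -> L1 g -> (forall x, f x <= g x) ->
  \int[mu]_x f x <= \int[mu]_x g x.
Proof. by move=> lf lg fg; apply: le_Rintegral => // x _. Qed.

Lemma I_norm_le f g : L1 f -> L1 g -> (forall x, `|f x| <= g x) ->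
  `|\int[mu]_x f x| <= \int[mu]_x g x.
Proof.
move=> lf lg fg; apply: (le_trans (le_normr_Rintegral measurableT lf)).
by apply: I_le => //; exact: L1_norm.
Qed.

Lemma I_ge0 f : (forall x, 0 <= f x) -> 0 <= \int[mu]_x f x.
Proof. by move=> h; apply: Rintegral_ge0 => x _. Qed.

Lemma I_EFin f : L1 f -> ((\int[mu]_x f x)%:E = \int[mu]_x (f x)%:E)%E.
Proof. by move=> lf; rewrite /Rintegral fineK//; exact: integrable_fin_num. Qed.

Lemma I_abs_EFin f : L1 f ->
  ((\int[mu]_x `|f x|)%:E = \int[mu]_x `|f x|%:E)%E.
Proof. by move=> lf; apply: I_EFin; exact: L1_norm. Qed.

Lemma measurable_fine_EFin f : measurable_fun [set: T] f ->
  measurable_fun [set: T] (EFin \o f).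
Proof. by move/measurable_EFinP. Qed.

(** Bounded measurable functions, the class against which integrable kernels
    are integrated. *)
Definition BM f := measurable_fun [set: T] f /\ exists C, forall x, `|f x| <= C.

Lemma L1_BM K f : L1 K -> BM f -> L1 (fun x => K x * f x).
Proof.
move=> lK [mf [C fC]].
apply: (@L1_le _ (fun x => C * `|K x|)).
- by apply: measurable_funM => //; exact: L1_measurable.
- by apply: L1Z; exact: L1_norm.
- by move=> x; rewrite normrM mulrC ler_wpM2r.
Qed.

Lemma BM_D f g : BM f -> BM g -> BM (fun x => f x + g x).
Proof.
move=> [mf [C fC]] [mg [D gD]]; split; first exact: measurable_funD.
by exists (C + D) => x; rewrite (le_trans (ler_normD _ _))// lerD.
Qed.

Lemma BM_N f : BM f -> BM (fun x => - f x).
Proof.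
move=> [mf [C fC]]; split; first exact: measurable_funN.
by exists C => x; rewrite normrN.
Qed.

Lemma BM_B f g : BM f -> BM g -> BM (fun x => f x - g x).
Proof. by move=> bf bg; apply: BM_D => //; exact: BM_N. Qed.

End integral_toolkit.

Section parametric.
Context {d1 d2} {T1 : measurableType d1} {T2 : measurableType d2} {R : realType}.
Variable m2 : {sigma_finite_measure set T2 -> \bar R}.

(** Holds without integrability: the real-valued integral is the finite part
    of a difference of two measurable functions with values in [0, +oo]. *)
Lemma measurable_param (f : T1 * T2 -> R) : measurable_fun [set: T1 * T2] f ->
  measurable_fun [set: T1] (fun x => \int[m2]_y f (x, y)).
Proof.
move=> mf; have mf' : measurable_fun setT (EFin \o f) by exact/measurable_EFinP.
rewrite (_ : (fun x => _) = fine \o (fun x =>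
   (\int[m2]_y ((EFin \o f)^\+ (x, y)) - \int[m2]_y ((EFin \o f)^\- (x, y))))%E); last first.
  apply/funext => x /=; rewrite /Rintegral integralE; congr (fine (_ - _)%E).
    by apply: eq_integral => y _; rewrite unlock.
  by apply: eq_integral => y _; rewrite unlock.
apply: measurableT_comp => //; apply: emeasurable_funB.
  apply: (measurable_fun_fubini_tonelli_F (m2 := m2) (EFin \o f)^\+%E) => //.
  exact: measurable_funepos.
apply: (measurable_fun_fubini_tonelli_F (m2 := m2) (EFin \o f)^\-%E) => //.
exact: measurable_funeneg.
Qed.

End parametric.

Section fubini_swap.
Context {d1 d2} {T1 : measurableType d1} {T2 : measurableType d2} {R : realType}.
Variable m1 : {sigma_finite_measure set T1 -> \bar R}.
Variable m2 : {sigma_finite_measure set T2 -> \bar R}.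

(** Fubini's theorem for real-valued integrals. A section that is not
    integrable has integral 0 by convention; the hypothesis makes such
    sections negligible, so both sides are genuine iterated integrals. *)
Lemma Fubini_R (f : T1 * T2 -> R) : measurable_fun [set: T1 * T2] f ->
  (\int[m2]_y \int[m1]_x `|f (x, y)|%:E < +oo)%E ->
  [/\ L1 m1 (fun x => \int[m2]_y f (x, y)),
      L1 m2 (fun y => \int[m1]_x f (x, y)),
      \int[m1]_x \int[m2]_y f (x, y) = \int[m2]_y \int[m1]_x f (x, y) &
      \forall x \ae m1, L1 m2 (fun y => f (x, y))].
Proof.
move=> mf hf.
have mf' : measurable_fun setT (EFin \o f) by exact/measurable_EFinP.
have If : (m1 \x m2)%E.-integrable setT (EFin \o f) by exact/integrable21ltyP.
have ae1 : \forall x \ae m1, ((\int[m2]_y f (x, y))%:E = \int[m2]_y (f (x, y))%:E)%E.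
  have := ae_integrable1 If; apply: filterS => x Ix.
  by rewrite I_EFin.
have ae2 : \forall y \ae m2, ((\int[m1]_x f (x, y))%:E = \int[m1]_x (f (x, y))%:E)%E.
  have := ae_integrable2 If; apply: filterS => x Ix.
  by rewrite I_EFin.
have m_1 : measurable_fun setT (fun x => \int[m2]_y f (x, y)) by exact: measurable_param.
have m_2 : measurable_fun setT (fun y => \int[m1]_x f (x, y)).
  apply: (measurable_param m1 (f := fun z => f (z.2, z.1))).
  by apply: (measurableT_comp mf); exact: measurable_swap.
have i1 := integrable_fubini_F If.
have i2 : m2.-integrable setT (fun y => (\int[m1]_x (f (x, y))%:E)%E).
  apply/integrableP; split; first exact: (measurable_fubini_G If).
  apply: le_lt_trans hf; apply: ge0_le_integral => //.
  - apply: measurableT_comp => //; exact: (measurable_fubini_G If).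
  - apply: (measurable_fun_fubini_tonelli_G (m1 := m1) (fun z => `|f z|%:E)) => //.
    by apply/measurable_EFinP; exact: measurableT_comp.
  - move=> y _; apply: (le_abse_integral m1 measurableT).
    by apply/measurable_EFinP; exact: (measurableT_comp mf (measurable_pair2 y)).
have l1 : L1 m1 (fun x => \int[m2]_y f (x, y)).
  exact: (L1_ae m_1 i1).
have l2 : L1 m2 (fun y => \int[m1]_x f (x, y)).
  exact: (L1_ae m_2 i2).
split => //; last exact: (ae_integrable1 If).
apply: EFin_inj; rewrite !I_EFin//.
transitivity (\int[m1]_x \int[m2]_y (f (x, y))%:E)%E.
  apply: ae_eq_integral => //; first exact/measurable_EFinP.
    exact: (measurable_int _ i1).
  by apply: filterS ae1 => x /= -> _.
transitivity (\int[m2]_y \int[m1]_x (f (x, y))%:E)%E.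
  exact: (Fubini If).
apply: ae_eq_integral => //; last first.
  by apply: filterS ae2 => x /= -> _.
- exact/measurable_EFinP.
- exact: (measurable_int _ i2).
Qed.

End fubini_swap.

Section convolution.
Context {R : realType} {d : nat}.
Local Notation lam := (@lebesgue_rV R d).
Local Notation V := 'rV[R]_d.
Implicit Types f g w K : V -> R.

Lemma measurable_shift g a : measurable_fun [set: V] g ->
  measurable_fun [set: V] (fun x => g (x - a)).
Proof. by move=> mg; apply: (measurableT_comp mg); exact: measurable_subrV. Qed.

Lemma measurable_shiftD g a : measurable_fun [set: V] g ->
  measurable_fun [set: V] (fun x => g (x + a)).
Proof. by move=> mg; apply: (measurableT_comp mg); exact: measurable_addrV. Qed.

Lemma measurable_reflect g a : measurable_fun [set: V] g ->
  measurable_fun [set: V] (fun x => g (a - x)).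
Proof. by move=> mg; apply: (measurableT_comp mg); exact: measurable_subrV. Qed.

Lemma I_shiftD g a : measurable_fun [set: V] g ->
  \int[lam]_x g (x + a) = \int[lam]_x g x.
Proof.
move=> mg; rewrite /Rintegral; congr fine.
by apply: (integral_shift a (f := EFin \o g)); exact/measurable_EFinP.
Qed.

Lemma I_shift g a : measurable_fun [set: V] g ->
  \int[lam]_x g (x - a) = \int[lam]_x g x.
Proof. exact: I_shiftD. Qed.

Lemma I_reflect g a : measurable_fun [set: V] g ->
  \int[lam]_x g (a - x) = \int[lam]_x g x.
Proof.
move=> mg; rewrite /Rintegral; congr fine.
by apply: (integral_reflect a (f := EFin \o g)); exact/measurable_EFinP.
Qed.

Lemma L1_shiftD g a : L1 lam g -> L1 lam (fun x => g (x + a)).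
Proof.
move=> lg; have mg := L1_measurable lg.
apply: L1_lty; first exact: measurable_shiftD.
rewrite (integral_shift a (f := fun x => `|g x|%:E)); first exact: L1_abs_lty.
by apply/measurable_EFinP; exact: measurableT_comp.
Qed.

Lemma L1_shift g a : L1 lam g -> L1 lam (fun x => g (x - a)).
Proof. exact: L1_shiftD. Qed.

Lemma ae_shift (P : V -> Prop) a : (\forall x \ae lam, P x) ->
  \forall x \ae lam, P (x - a).
Proof.
move=> [N [mN N0 PN]]; exists ((fun x => x - a) @^-1` N); split.
- by rewrite -[X in measurable X]setTI; exact: measurable_subrV.
- rewrite -[LHS]mul1e -integral_cst//; last first.
    by rewrite -[X in measurable X]setTI; exact: measurable_subrV.
  rewrite integral_mkcond.
  transitivity (\int[lam]_x ((cst 1%E \_ N) (x - a)%R))%E.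
    by apply: eq_integral => x _; rewrite !patchE.
  rewrite (integral_shift (- a) (f := cst 1%E \_ N)).
    by rewrite -integral_mkcond integral_cst// mul1e.
  by apply/(measurable_restrictT _ mN).
- by move=> x /= nP; exact: PN.
Qed.

Definition convol K g (x : V) : R := \int[lam]_z (K z * g (x - z)).

Lemma measurable_convol K g : measurable_fun [set: V] K -> measurable_fun [set: V] g ->
  measurable_fun [set: V] (convol K g).
Proof.
move=> mK mg.
have mF : measurable_fun [set: V * V] (fun p : V * V => K p.2 * g (p.1 - p.2)).
  apply: measurable_funM; first exact: (measurableT_comp mK).
  by apply: (measurableT_comp mg); exact: measurable_subrV.
exact: (measurable_param lam mF).
Qed.

(** Fubini's theorem for the pairing of w with the convolution of K and g. The
    uniform bound on the pairings of w with the translates of g makes the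
    double integral finite, K being integrable. *)
Lemma convol_swap K w g (C : R) : L1 lam K ->
  measurable_fun [set: V] w -> measurable_fun [set: V] g ->
  (forall z, \int[lam]_x `|w x * g (x - z)|%:E <= C%:E)%E ->
  [/\ L1 lam (fun x => w x * convol K g x),
      L1 lam (fun z => K z * \int[lam]_x (w x * g (x - z))) &
      \int[lam]_x (w x * convol K g x) =
      \int[lam]_z (K z * \int[lam]_x (w x * g (x - z)))].
Proof.
move=> lK mw mg wgC; have mK := L1_measurable lK.
pose F (p : V * V) := w p.1 * (K p.2 * g (p.1 - p.2)).
have mwg : measurable_fun [set: V * V] (fun p : V * V => w p.1 * g (p.1 - p.2)).
  apply: measurable_funM; first exact: (measurableT_comp mw).
  by apply: (measurableT_comp mg); exact: measurable_subrV.
have mF : measurable_fun [set: V * V] F.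
  rewrite /F; under eq_fun do rewrite mulrCA.
  by apply: measurable_funM => //; exact: (measurableT_comp mK).
have lz z : L1 lam (fun x => w x * g (x - z)).
  apply: L1_lty; last exact: (le_lt_trans (wgC z) (ltry _)).
  exact: (measurableT_comp mwg (measurable_pair2 z)).
have Fz z : \int[lam]_x F (x, z) = K z * \int[lam]_x (w x * g (x - z)).
  by rewrite -IZ//; apply: I_ext => x; rewrite /F/= mulrCA.
have hF : (\int[lam]_z \int[lam]_x `|F (x, z)|%:E < +oo)%E.
  apply: (@le_lt_trans _ _ (\int[lam]_z (`|K z|%:E * C%:E))%E); last first.
    have C0 : 0 <= C.
      by rewrite -lee_fin (le_trans _ (wgC 0))//; apply: integral_ge0.
    rewrite ge0_integralZr//; last first.
      by apply/measurable_EFinP; exact: measurableT_comp.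
    rewrite lte_mul_pinfty ?ltry//; first exact: integral_ge0.
    by rewrite ge0_fin_numE; [exact: L1_abs_lty|exact: integral_ge0].
  apply: ge0_le_integral => //.
  - by move=> z _; apply: integral_ge0.
  - apply: (measurable_fun_fubini_tonelli_G (m1 := lam) (fun p => `|F p|%:E)) => //.
    by apply/measurable_EFinP; exact: measurableT_comp.
  - apply/measurable_EFinP; apply: measurable_funM => //.
    exact: measurableT_comp.
  - move=> z _; under eq_integral do rewrite /F/= mulrCA normrM EFinM.
    rewrite ge0_integralZl//; first by apply: lee_wpmul2l => //; rewrite lee_fin.
    apply/measurable_EFinP; apply: measurableT_comp => //.
    exact: (measurableT_comp mwg (measurable_pair2 z)).
have [l1 l2 e12 aeF] := Fubini_R mF hF.
have mc := measurable_convol mK mg.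
have mwc : measurable_fun [set: V] (fun x => w x * convol K g x).
  exact: (measurable_funM mw mc).
have Fx : \forall x \ae lam, \int[lam]_z F (x, z) = w x * convol K g x.
  apply: filterS aeF => x lx; have [w0|w0] := eqVneq (w x) 0.
    rewrite w0 mul0r -[RHS](@I0 _ _ R lam); apply: I_ext => z.
    by rewrite /F /= w0 mul0r.
  apply: (IZ (w x)).
  apply: (L1_ext _ (L1Z (w x)^-1 lx)) => z.
  by rewrite /F /= mulKf.
split.
- by apply: (L1_ae mwc l1); apply: filterS Fx => x /= ->.
- exact: (L1_ext Fz l2).
- rewrite -(I_ae (L1_measurable l1) mwc Fx) e12; exact: I_ext.
Qed.

End convolution.

(** * Norms of L^p and Hoelder's inequality *)

Lemma I_dct {d0} {T : measurableType d0} {R : realType}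
    (mu : {measure set T -> \bar R}) (F : nat -> T -> R) (f G : T -> R) :
  (forall n, measurable_fun [set: T] (F n)) -> measurable_fun [set: T] f ->
  L1 mu G -> (forall n x, `|F n x| <= G x) ->
  (forall x, F n x @[n --> \oo] --> f x) ->
  (\int[mu]_x F n x) @[n --> \oo] --> \int[mu]_x f x.
Proof.
move=> mF mf lG FG Ff.
have Ff' x : (F n x)%:E @[n --> \oo] --> (f x)%:E.
  by apply: cvg_EFin; [exact: nearW|exact: Ff].
have [i1 _ i2] := @dominated_convergence _ T R mu setT measurableT
  (fun n => EFin \o F n) (EFin \o f) (EFin \o G)
  (fun n => (measurable_EFinP setT (F n)).2 (mF n))
  ((measurable_EFinP setT f).2 mf)
  (aeW _ (fun x _ => Ff' x)) lG
  (aeW _ (fun x n _ => FG n x)).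
rewrite /Rintegral.
have lf : L1 mu f := i1.
apply: fine_cvg; rewrite fineK; last exact: integrable_fin_num.
exact: i2.
Qed.

Section Lp.
Context {R : realType} {d : nat}.
Local Notation lam := (@lebesgue_rV R d).
Local Notation V := 'rV[R]_d.
Implicit Types (f g u v w : V -> R) (p : \bar R).

(** The norm as a real number; it is 0 when the norm is infinite, so it is
    used for functions of [Lx p] only. *)
Definition nrm p f : R := fine (Lx_norm p f).

Lemma LxP p f : Lx p f <-> measurable_fun [set: V] f /\ (Lx_norm p f < +oo)%E.
Proof.
rewrite /Lx /= inE /=; split => [/andP[]|[? ?]]; rewrite ?inE //.
by apply/andP; rewrite !inE.
Qed.

Lemma Lx_meas p f : Lx p f -> measurable_fun [set: V] f.
Proof. by move=> /LxP[]. Qed.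

Lemma nrm_ge0 p f : 0 <= nrm p f.
Proof. by rewrite /nrm fine_ge0// Lnorm_ge0. Qed.

Lemma nrm_EFin p f : Lx p f -> ((nrm p f)%:E = Lx_norm p f)%E.
Proof.
by move=> /LxP[_ fy]; rewrite /nrm fineK// ge0_fin_numE// Lnorm_ge0.
Qed.

Lemma Lx_norm_real (t : R) f :
  Lx_norm t%:E f = ((\int[lam]_x (`|(f x)%:E| `^ t)) `^ t^-1)%E.
Proof. by rewrite /Lx_norm unlock. Qed.

Lemma Lx_norm_oo f : Lx_norm +oo%E f =
  (if (0 < lam [set: V])%E then ess_sup lam (fun x => `|(f x)%:E|) else 0)%E.
Proof. by rewrite /Lx_norm unlock. Qed.

Lemma measurable_abs_poweR (t : R) f : measurable_fun [set: V] f ->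
  measurable_fun [set: V] (fun x => `|(f x)%:E| `^ t)%E.
Proof.
move=> mf; apply: (measurableT_comp (measurable_poweR t)).
by apply: measurableT_comp => //; exact/measurable_EFinP.
Qed.

(** The essential supremum has to be treated apart from the finite exponents
    since q = +oo is allowed. *)
Lemma Lx_norm_shift p f a : measurable_fun [set: V] f -> (0 <= p)%E ->
  Lx_norm p (fun x => f (x - a)) = Lx_norm p f.
Proof.
move=> mf; case: p => [p p0|_|p0]; last by rewrite leNgt ltNyr in p0.
  rewrite !Lx_norm_real; apply: (congr1 (fun x => x `^ p^-1)%E).
  apply: (integral_shift (- a) (f := fun x => (`|(f x)%:E| `^ p)%E)).
  exact: measurable_abs_poweR.
rewrite !Lx_norm_oo; case: ifPn => [l0|_]; last by [].
apply/eqP; rewrite eq_le; apply/andP; split.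
  apply/ess_supP; apply: (ae_shift (P := fun x => (`|(f x)%:E| <= _)%E)).
  exact: ess_sup_ge.
apply/ess_supP.
have := ess_sup_ge lam (fun x => `|(f (x - a))%:E|)%E.
move=> /(ae_shift (- a)); apply: filterS => x /=.
by rewrite opprK addrK.
Qed.

Lemma Lx_shift p f a : (0 <= p)%E -> Lx p f -> Lx p (fun x => f (x - a)).
Proof.
move=> p0 /LxP[mf fy]; apply/LxP; split; first exact: measurable_shift.
by rewrite Lx_norm_shift.
Qed.

Lemma nrm_shift p f a : (0 <= p)%E -> Lx p f -> nrm p (fun x => f (x - a)) = nrm p f.
Proof. by move=> p0 /Lx_meas mf; rewrite /nrm Lx_norm_shift. Qed.

Lemma Lx_norm_le p f g : (0 <= p)%E ->
  measurable_fun [set: V] f -> measurable_fun [set: V] g ->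
  (forall x, `|f x| <= `|g x|) -> (Lx_norm p f <= Lx_norm p g)%E.
Proof.
case: p => [p| |] p0 mf mg fg; last by rewrite leNgt ltNyr in p0.
  rewrite !Lx_norm_real.
  have pos h : (0 <= \int[lam]_x (`|(h x)%:E| `^ p))%E.
    by apply: integral_ge0 => x _; exact: poweR_ge0.
  apply: gt0_ler_poweR.
  - by rewrite invr_ge0 -lee_fin.
  - by rewrite in_itv; apply/andP; split; [exact: (pos f)|exact: leey].
  - by rewrite in_itv; apply/andP; split; [exact: (pos g)|exact: leey].
  apply: ge0_le_integral.
  - exact: measurableT.
  - by move=> *; exact: poweR_ge0.
  - exact: measurable_abs_poweR.
  - exact: measurable_abs_poweR.
  - move=> x _; rewrite /= !lee_fin; apply: ge0_ler_powR.
    + by rewrite -lee_fin.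
    + exact: normr_ge0.
    + exact: normr_ge0.
    + exact: fg.
rewrite !Lx_norm_oo; case: ifPn => [l0|_]; last by [].
by apply: le_ess_sup; apply: nearW => x; rewrite /= lee_fin.
Qed.

Lemma LxN p f : (0 <= p)%E -> Lx p f -> Lx p (fun x => - f x).
Proof.
move=> p0 /LxP[mf fy]; have mN : measurable_fun [set: V] (fun x => - f x) by exact: measurable_funN.
apply/LxP; split => //; apply: le_lt_trans fy.
by apply: Lx_norm_le => // x; rewrite normrN.
Qed.

Lemma nrmN p f : (0 <= p)%E -> Lx p f -> nrm p (fun x => - f x) = nrm p f.
Proof.
move=> p0 /LxP[mf fy]; rewrite /nrm; congr fine.
have mN : measurable_fun [set: V] (fun x => - f x) by exact: measurable_funN.
by apply/eqP; rewrite eq_le !Lx_norm_le//= => x; rewrite normrN.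
Qed.

Lemma Lx_normD p f g : (1 <= p)%E -> Lx p f -> Lx p g ->
  (Lx_norm p (fun x => f x + g x)%R <= Lx_norm p f + Lx_norm p g)%E.
Proof.
move=> p1 /LxP[mf _] /LxP[mg _].
exact: (eminkowski lam mf mg p1).
Qed.

Lemma LxD p f g : (1 <= p)%E -> Lx p f -> Lx p g -> Lx p (fun x => f x + g x).
Proof.
move=> p1 lf lg; have [mf fy] := (LxP p f).1 lf; have [mg gy] := (LxP p g).1 lg.
apply/LxP; split; first exact: measurable_funD.
by apply: (le_lt_trans (Lx_normD p1 lf lg)); rewrite lte_add_pinfty.
Qed.

Lemma nrmD p f g : (1 <= p)%E -> Lx p f -> Lx p g ->
  nrm p (fun x => f x + g x) <= nrm p f + nrm p g.
Proof.
move=> p1 lf lg; rewrite -lee_fin EFinD !nrm_EFin//; last exact: LxD.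
exact: Lx_normD.
Qed.

Let ge01 p : (1 <= p)%E -> (0 <= p)%E. Proof. by apply: le_trans; rewrite lee_fin. Qed.

Lemma LxB p f g : (1 <= p)%E -> Lx p f -> Lx p g -> Lx p (fun x => f x - g x).
Proof. by move=> p1 lf lg; apply: LxD => //; apply: LxN => //; exact: ge01. Qed.

Lemma nrmB p f g : (1 <= p)%E -> Lx p f -> Lx p g ->
  nrm p (fun x => f x - g x) <= nrm p f + nrm p g.
Proof.
move=> p1 lf lg; rewrite -(nrmN (ge01 p1) lg); apply: nrmD => //.
by apply: LxN => //; exact: ge01.
Qed.

Lemma Lx_poweR (p : R) f : 0 < p ->
  Lx p%:E f <-> measurable_fun [set: V] f /\ L1 lam (fun x => `|f x| `^ p).
Proof.
move=> p0; split.
  move=> /LxP[mf fy]; split => //; apply: L1_lty.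
    apply: (measurableT_comp (measurable_powR p)).
    exact: measurableT_comp.
  have : ((Lx_norm p%:E f) `^ p < +oo)%E by rewrite poweR_lty.
  rewrite /Lx_norm poweR_Lnorm ?gt_eqF//; apply: le_lt_trans.
  rewrite le_eqVlt; apply/predU1l.
  by apply: eq_integral => x _; rewrite ger0_norm ?powR_ge0.
move=> [mf lf]; apply/LxP; split => //.
rewrite /Lx_norm unlock; apply: poweR_lty.
have := L1_abs_lty lf; apply: le_lt_trans.
rewrite le_eqVlt; apply/predU1l.
by apply: eq_integral => x _; rewrite ger0_norm ?powR_ge0.
Qed.

Lemma nrm_powR (p : R) f : 0 < p -> Lx p%:E f ->
  (nrm p%:E f) `^ p = \int[lam]_x (`|f x| `^ p).
Proof.
move=> p0 lf; rewrite /nrm -fine_poweR /Lx_norm poweR_Lnorm ?gt_eqF//.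
Qed.

Lemma nrm_le (p : R) f e : 0 < p -> 0 <= e -> Lx p%:E f ->
  \int[lam]_x (`|f x| `^ p) <= e `^ p -> nrm p%:E f <= e.
Proof.
move=> p0 e0 lf; rewrite -nrm_powR//; apply: contraTT; rewrite -!ltNge => h.
by apply: gt0_ltr_powR => //; rewrite nnegrE ?nrm_ge0.
Qed.

Section hoelder3.
Variables (q : \bar R) (r s : R).
Hypotheses (hq : (1 < q)%E) (hr : 1 < r) (hs : 1 < s).
Hypothesis hqrs : (q^-1 + (r%:E)^-1 + (s%:E)^-1 = 1)%E.

(** Hoelder's inequality for the pair of functions |u|^t and |v|^t with the
    exponents r / t and s / t, which are conjugate. *)
Lemma hoelder_pair (t : R) u v : 0 < t -> t^-1 = r^-1 + s^-1 ->
  measurable_fun [set: V] u -> measurable_fun [set: V] v ->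
  (Lx_norm t%:E (fun x => u x * v x)%R <= Lx_norm r%:E u * Lx_norm s%:E v)%E.
Proof.
move=> t0 tE mu mv.
have r0 : 0 < r := lt_trans ltr01 hr.
have s0 : 0 < s := lt_trans ltr01 hs.
have N0 p f : (0 <= Lx_norm p f)%E by exact: Lnorm_ge0.
have mp f (p : R) : measurable_fun [set: V] f -> measurable_fun [set: V] (fun x => `|f x| `^ p).
  by move=> mf; apply: (measurableT_comp (measurable_powR p)); exact: measurableT_comp.
have E (p : R) f : 0 < p ->
    (Lx_norm (p / t)%:E (fun x => `|f x| `^ t)%R = (Lx_norm p%:E f) `^ t)%E.
  move=> p0; rewrite !Lx_norm_real -poweRrM invf_div [t / p]mulrC.
  apply: (congr1 (fun x => x `^ (p^-1 * t))%E).
  apply: eq_integral => x _; rewrite !abse_EFin !poweR_EFin; congr EFin.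
  rewrite ger0_norm; last exact: powR_ge0.
  by rewrite -powRrM mulrCA divff ?mulr1// gt_eqF.
have h : (Lx_norm t%:E (fun x => u x * v x)%R `^ t <= (Lx_norm r%:E u * Lx_norm s%:E v) `^ t)%E.
  rewrite (poweRM t (N0 _ u) (N0 _ v)) -(E r u r0) -(E s v s0).
  have t0' : t != 0 by rewrite gt_eqF.
  rewrite [leLHS](poweR_Lnorm lam (EFin \o (fun x => u x * v x)) t0').
  have := @hoelder _ _ R lam (fun x => `|u x| `^ t) (fun x => `|v x| `^ t) (r / t) (s / t).
  rewrite Lnorm1 => /(_ (mp _ _ mu) (mp _ _ mv)) H.
  have {}H := H (divr_gt0 r0 t0) (divr_gt0 s0 t0).
  apply: le_trans (H _); last first.
    by rewrite !invf_div -mulrDr -tE divff ?gt_eqF.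
  rewrite le_eqVlt; apply/predU1l; apply: eq_integral => x _ /=.
  have P : 0 <= `|u x| `^ t * `|v x| `^ t by rewrite mulr_ge0 ?powR_ge0.
  by rewrite (ger0_norm P) normrM powRM ?normr_ge0.
have := @gt0_ler_poweR R t^-1; rewrite invr_ge0 (ltW t0) => /(_ isT) H.
have {}H := H _ _ _ _ h; move: H; rewrite -!poweRrM divff ?gt_eqF// !poweRe1//.
  by apply; rewrite in_itv/= leey poweR_ge0.
by rewrite mule_ge0.
Qed.

(** For q finite, Hoelder's inequality for u v and g, the exponent of u v
    being the conjugate of q. For q infinite r and s are conjugate; if the
    supremum of g is infinite too, the right-hand side is +oo unless u v
    vanishes almost everywhere. *)
Lemma hoelder3_le u v g :
  measurable_fun [set: V] u -> measurable_fun [set: V] v -> measurable_fun [set: V] g ->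
  (\int[lam]_x `|u x * v x * g x|%:E <=
   Lx_norm r%:E u * Lx_norm s%:E v * Lx_norm q g)%E.
Proof.
move=> mu mv mg.
have muv : measurable_fun [set: V] (fun x => u x * v x) by exact: measurable_funM.
have r0 : 0 < r := lt_trans ltr01 hr.
have s0 : 0 < s := lt_trans ltr01 hs.
case: q hq hqrs => [q'| |] // hq' hqrs'.
  rewrite lte_fin in hq'.
  have q0 : 0 < q' := lt_trans ltr01 hq'.
  have e : q'^-1 + r^-1 + s^-1 = 1.
    by move: hqrs'; rewrite !inver !gt_eqF// -!EFinD => -[].
  pose t := q' / (q' - 1).
  have t0 : 0 < t by rewrite divr_gt0// subr_gt0.
  have tE : t^-1 = 1 - q'^-1.
    by rewrite /t invf_div mulrBl divff ?gt_eqF// mul1r.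
  have H := @hoelder _ _ R lam (fun x => u x * v x) g t q' muv mg t0 q0.
  rewrite Lnorm1 in H.
  apply: (le_trans (H _)); first by rewrite tE; ring.
  apply: lee_wpmul2r; first exact: Lnorm_ge0.
  by apply: hoelder_pair => //; rewrite tE; lra.
have e : r^-1 + s^-1 = 1.
  by move: hqrs'; rewrite invey add0e !inver !gt_eqF// -!EFinD => -[].
have H := @hoelder _ _ R lam u v r s mu mv r0 s0 e.
rewrite Lnorm1 in H.
have [gy|gy] := eqVneq (Lx_norm +oo%E g) +oo%E.
  have [z|z] := eqVneq (Lx_norm r%:E u * Lx_norm s%:E v)%E 0%E.
    rewrite z mul0e.
    rewrite z in H.
    have uv0 : (\int[lam]_x `|u x * v x|%:E = 0)%E.
      by apply/eqP; rewrite eq_le H integral_ge0.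
    have := ae_eq_integral_abs lam measurableT ((measurable_EFinP _ _).2 muv).
    move=> /iffLR /(_ uv0) ae0.
    rewrite (ae_eq_integral (cst 0%E))// ?integral0//.
      by apply/measurable_EFinP; apply: measurableT_comp => //; exact: measurable_funM.
    by apply: filterS ae0 => x /(_ I) /= [->] _; rewrite mul0r normr0.
  rewrite gy gt0_muley ?leey// lt0e z mule_ge0//; exact: Lnorm_ge0.
have gM : \forall x \ae lam, (`|g x|%:E <= Lx_norm +oo%E g)%E.
  rewrite Lx_norm_oo; case: ifPn => l0; first exact: ess_sup_ge.
  have z : lam setT = 0%E by apply/eqP; rewrite eq_le measure_ge0 andbT leNgt.
  by exists setT; split.
pose M := fine (Lx_norm +oo%E g).
have ME : Lx_norm +oo%E g = M%:E.
  by rewrite /M fineK// ge0_fin_numE ?Lnorm_ge0// ltey.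
rewrite ME in gM *.
have M0 : 0 <= M by rewrite /M fine_ge0// Lnorm_ge0.
apply: (@le_trans _ _ (\int[lam]_x (`|u x * v x|%:E * M%:E))%E).
  apply: ae_ge0_le_integral => //.
  - by apply/measurable_EFinP; apply: measurableT_comp => //; exact: measurable_funM.
  - by move=> x _; rewrite mule_ge0 ?lee_fin.
  - by apply/measurable_EFinP; apply: measurable_funM => //; exact: measurableT_comp.
  apply: filterS gM => x; rewrite lee_fin => gx _.
  by rewrite lee_fin normrM ler_wpM2l.
rewrite ge0_integralZr//; last by apply/measurable_EFinP; exact: measurableT_comp.
exact: lee_wpmul2r.
Qed.

Lemma hoelder3 u v g : Lx r%:E u -> Lx s%:E v -> Lx q g ->
  L1 lam (fun x => u x * v x * g x) /\
  (\int[lam]_x `|u x * v x * g x| <= nrm r%:E u * nrm s%:E v * nrm q g).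
Proof.
move=> lu lv lg.
have h := hoelder3_le (Lx_meas lu) (Lx_meas lv) (Lx_meas lg).
rewrite -!nrm_EFin// -!EFinM in h.
have l : L1 lam (fun x => u x * v x * g x).
  apply: L1_lty; last exact: (le_lt_trans h (ltry _)).
  by apply: measurable_funM; [apply: measurable_funM|]; apply: Lx_meas; eassumption.
by split => //; rewrite -lee_fin I_abs_EFin.
Qed.

End hoelder3.

End Lp.

(** * Continuity of translations in L^p *)

Section vanish.
Context {R : realType} {d : nat}.
Local Notation V := 'rV[R]_d.
Implicit Types w : V -> R.

(** Limit 0 at the origin, for a function with values in [0, +oo): only upper
    bounds are required. *)
Definition vanish w := forall e : R, 0 < e ->
  exists2 delta, 0 < delta & forall h, box delta h -> w h <= e.

Lemma box_le (a b : R) (h : V) : a <= b -> box a h -> box b h.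
Proof. by move=> ab ah i; exact: le_trans (ah i) ab. Qed.

Lemma vanish_le w w' : (forall h, w' h <= w h) -> vanish w -> vanish w'.
Proof.
move=> ww vw e e0; have [delta d0 H] := vw e e0.
by exists delta => // h /H; exact: le_trans.
Qed.

Lemma vanishD w w' : vanish w -> vanish w' -> vanish (fun h => w h + w' h).
Proof.
move=> vw vw' e e0.
have e2 : 0 < e / 2 by rewrite divr_gt0.
have [a a0 Ha] := vw _ e2; have [b b0 Hb] := vw' _ e2.
exists (Num.min a b); first by rewrite lt_min a0.
move=> h hab; rewrite [leRHS]splitr; apply: lerD.
  by apply: Ha; apply: box_le hab; rewrite ge_min lexx.
by apply: Hb; apply: box_le hab; rewrite ge_min lexx orbT.
Qed.

(** Limits 0 pass to uniform limits. *)
Lemma vanish_closed w :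
  (forall e : R, 0 < e -> exists2 w', vanish w' & forall h, w h <= w' h + e) -> vanish w.
Proof.
move=> H e e0.
have e2 : 0 < e / 2 by rewrite divr_gt0.
have [w' vw' ww'] := H _ e2; have [a a0 Ha] := vw' _ e2.
exists a => // h /Ha h'; apply: (le_trans (ww' h)).
by rewrite [leRHS]splitr lerD2r.
Qed.

Lemma invSn_lt (e : R) : 0 < e -> exists N, forall n, (N <= n)%N -> n.+1%:R^-1 < e.
Proof.
move=> e0; exists (Num.trunc e^-1) => n Nn.
rewrite invf_plt ?posrE ?ltr0n//; apply: (lt_le_trans (truncnS_gt _)).
by rewrite ler_nat.
Qed.

(** Turns the sequential statements given by dominated convergence into
    statements about neighbourhoods of 0. *)
Lemma vanish_seq w :
  (forall h_ : nat -> V, (forall n, box n.+1%:R^-1 (h_ n)) ->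
    w (h_ n) @[n --> \oo] --> 0) -> vanish w.
Proof.
move=> H e e0; apply: contrapT => nH.
have /choice [h_ hP] : forall n : nat, exists h, box n.+1%:R^-1 h /\ e < w h.
  move=> n; apply: contrapT => nh; apply: nH.
  exists n.+1%:R^-1; first by rewrite invr_gt0 ltr0n.
  by move=> h bh; rewrite leNgt; apply/negP => ew; apply: nh; exists h.
have /cvgrPdist_lt /(_ _ e0) [N _ /(_ N (leqnn N))] := H h_ (fun n => (hP n).1).
rewrite sub0r normrN => wN; have := (hP N).2.
by rewrite ltNge (le_trans (ler_norm _) (ltW wN)).
Qed.

End vanish.

Section translation_continuity.
Context {R : realType} {d : nat}.
Local Notation lam := (@lebesgue_rV R d).
Local Notation V := 'rV[R]_d.
Implicit Types (f g : V -> R).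

Lemma L1_indic (A : set V) : measurable A -> (lam A < +oo)%E -> L1 lam \1_A.
Proof.
move=> mA Ay; apply: L1_lty; first exact: measurable_indic.
rewrite (eq_integral (fun x => (\1_A x)%:E)).
  by rewrite integral_indic// setIT.
by move=> x _; rewrite ger0_norm.
Qed.

Definition L1_modulus f (h : V) : R := \int[lam]_x `|f x - f (x - h)|.

Lemma L1_L1_modulus f h : L1 lam f -> L1 lam (fun x => `|f x - f (x - h)|).
Proof. by move=> lf; exact: (L1_norm (L1B lf (L1_shift h lf))). Qed.

Lemma L1_modulus_le f g h : L1 lam f -> L1 lam g ->
  L1_modulus f h <= L1_modulus g h + 2 * \int[lam]_x `|f x - g x|.
Proof.
move=> lf lg.
have lfg := L1_norm (L1B lf lg).
have sfg := L1_shift h lfg.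
have lgh := L1_L1_modulus h lg.
have -> : 2 * \int[lam]_x `|f x - g x| =
  \int[lam]_x `|f x - g x| + \int[lam]_x `|f (x - h) - g (x - h)|.
  by rewrite (I_shift h (L1_measurable lfg)) mulr_natl mulr2n.
rewrite -(ID lfg sfg) -(ID lgh (L1D lfg sfg)).
apply: (I_le (L1_L1_modulus h lf) (L1D lgh (L1D lfg sfg))) => x.
have -> : f x - f (x - h) = (g x - g (x - h)) + ((f x - g x) - (f (x - h) - g (x - h))).
  by ring.
by rewrite (le_trans (ler_normD _ _))// lerD2l ler_normB.
Qed.

Lemma vanish_L1_modulus_closed f : L1 lam f ->
  (forall e : R, 0 < e -> exists g, [/\ L1 lam g, vanish (L1_modulus g) & \int[lam]_x `|f x - g x| <= e]) ->
  vanish (L1_modulus f).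
Proof.
move=> lf H; apply: vanish_closed => e e0.
have e2 : 0 < e / 2 by rewrite divr_gt0.
have [g [lg vg fg]] := H (e / 2) e2.
exists (L1_modulus g) => // h; apply: (le_trans (L1_modulus_le h lf lg)).
rewrite lerD2l -ler_pdivlMl// mulrC; exact: fg.
Qed.

(** Translation preserves measure, so |1_U - 1_U (. - h)| has the same
    integral as 2 1_U (1 - 1_U (. - h)), which tends to 0 pointwise because U
    is open, and is dominated by 2 1_U. *)
Lemma vanish_L1_modulus_open (U : set V) : open U -> (lam U < +oo)%E -> vanish (L1_modulus \1_U).
Proof.
move=> oU Uy; have mU := open_measurable_rV oU; have lU := L1_indic mU Uy.
have mh h : measurable_fun [set: V] (fun x => \1_U x * (1 - \1_U (x - h)) : R).
  apply: measurable_funM; first exact: (L1_measurable lU).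
  by apply: measurable_funB => //; exact: (measurable_shift h (L1_measurable lU)).
have ind01 (x : V) : (\1_U x : R) = 0 \/ (\1_U x : R) = 1.
  by rewrite indicE; case: (x \in U); [right|left].
have lh h : L1 lam (fun x => \1_U x * (1 - \1_U (x - h))).
  apply: (L1_le (mh h) lU) => x.
  by case: (ind01 x) (ind01 (x - h)) => -> [] ->; rewrite ?subr0 ?subrr ?mulr0 ?mulr1 ?normr0 ?normr1.
have E h : L1_modulus \1_U h = 2 * \int[lam]_x (\1_U x * (1 - \1_U (x - h))).
  rewrite -(IZ 2 (lh h)).
  have -> : L1_modulus \1_U h = \int[lam]_x (2 * (\1_U x * (1 - \1_U (x - h))) - (\1_U x - \1_U (x - h))).
    apply: I_ext => x.
    by case: (ind01 x) (ind01 (x - h)) => -> [] ->;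
      rewrite ?(subr0, subrr, sub0r, mulr0, mulr1, mul0r, normr0, normr1, normrN, opprK)//; lra.
  rewrite (IB (L1Z 2 (lh h)) (L1B lU (L1_shift h lU))).
  by rewrite (IB lU (L1_shift h lU)) (I_shift h (L1_measurable lU)) subrr subr0.
apply: vanish_seq => h_ bh.
have cvg0 : (\int[lam]_x (\1_U x * (1 - \1_U (x - h_ n)))) @[n --> \oo] --> \int[lam]_x (0 : R).
  apply: (I_dct (fun n => mh (h_ n)) _ lU).
  - exact: measurable_cst.
  - move=> n x.
    by case: (ind01 x) (ind01 (x - h_ n)) => -> [] ->; rewrite ?subr0 ?subrr ?mulr0 ?mulr1 ?normr0 ?normr1.
  move=> x; have [xU|xU] := pselect (U x); last first.
    rewrite (_ : (fun _ => _) = fun=> 0); first exact: cvg_cst.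
    by apply/funext => n; rewrite indicE memNset// mul0r.
  have /nbhs_ballP [e /= e0 eU] : nbhs x U by exact: open_nbhs_nbhs.
  have [N HN] := invSn_lt e0.
  apply/cvgrPdist_lt => e' e'0; exists N => // n /= Nn.
  rewrite sub0r normrN indicE mem_set//= mul1r indicE mem_set ?subrr ?normr0//.
  apply: eU; apply/ball_rV => // i; rewrite !mxE opprB addrC subrK.
  exact: (le_lt_trans (bh n i) (HN n Nn)).
rewrite I0 in cvg0.
rewrite (_ : (fun n => _) = (fun n => 2 * \int[lam]_x (\1_U x * (1 - \1_U (x - h_ n))))); last first.
  by apply/funext => n; rewrite E.
by rewrite -[X in _ --> X](mulr0 (2 : R)); exact: cvgM (cvg_cst _) cvg0.
Qed.

Lemma measurable_g_open : @measurable _ V `<=` <<s (@open V) >>.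
Proof.
apply: smallest_sub; first exact: smallest_sigma_algebra.
rewrite -bigcup_seq; apply: bigcup_sub => i _ B [C mC <-]; rewrite setTI.
pose S := [set C : set R | <<s (@open V) >> ((fun x : V => x ord0 i) @^-1` C)].
suff : @measurable _ (measurableTypeR R) `<=` S by apply.
rewrite (RGenOpens.measurableE R); apply: smallest_sub.
  have [s0 sC sU] := smallest_sigma_algebra setT (@open V).
  split; rewrite /S /=.
  - by rewrite preimage_set0.
  - by move=> A SA; rewrite setTD preimage_setC -setTD; exact: sC.
  - by move=> F SF; rewrite preimage_bigcup; exact: sU.
move=> _ [a [b ->]]; apply: sub_sigma_algebra.
by apply: open_comp => // x _; exact: coord_continuous.
Qed.

Definition B0 (M : R) : set V := ball (0 : V) M.

Lemma B0_box M : B0 M `<=` box M.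
Proof.
move=> x [_ h] i; have := h ord0 i; rewrite mxE => /ltW.
by rewrite /ball_ /= sub0r normrN.
Qed.

Lemma open_B0 M : open (B0 M).
Proof.
rewrite openE => x Bx; have M0 : 0 < M by case: Bx.
have h : forall i : 'I_d, \forall y \near x, `|(y : V) ord0 i| < M.
  move=> i; have /(ball_rV _ _ M0) /(_ i) := Bx.
  rewrite mxE sub0r normrN => xi.
  have cx : (fun y : V => `|y ord0 i|) y @[y --> x] --> `|x ord0 i|.
    exact: (cvg_norm (@coord_continuous R 1 d ord0 i x)).
  exact: (cvgr_lt _ cx M xi).
have : \forall y \near x, forall i, `|(y : V) ord0 i| < M by apply: (filter_forall _ h).
apply: filterS => y hy; apply/(ball_rV _ _ M0) => i.
by rewrite mxE sub0r normrN.
Qed.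

Lemma box_B0 M : 0 < M -> forall x : V, box M x -> B0 (M + 1) x.
Proof.
move=> M0 x bx; apply/ball_rV; first by rewrite ltr_wpDl// ltW.
move=> i; rewrite mxE sub0r normrN; apply: (le_lt_trans (bx i)).
by rewrite ltrDl.
Qed.

Lemma B0_lty M : (lam (B0 M) < +oo)%E.
Proof.
apply: le_lt_trans (box_lty M); apply: le_measure; rewrite ?inE.
- exact: measurable_ball_rV.
- exact: measurable_box.
- exact: B0_box.
Qed.

Lemma lebesgueI_lty (A B : set V) : measurable A -> measurable B ->
  (lam B < +oo)%E -> (lam (A `&` B) < +oo)%E.
Proof.
move=> mA mB; apply: le_lt_trans; apply: le_measure; rewrite ?inE//.
exact: measurableI.
Qed.

(** The sets whose trace on a fixed ball has an indicator with continuous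
    translations form a lambda-system containing the open sets, hence the
    Borel sets. *)
Lemma vanish_L1_modulus_bounded (A : set V) M : measurable A -> vanish (L1_modulus \1_(A `&` B0 M)).
Proof.
move=> mA; have mB : measurable (B0 M) by exact: measurable_ball_rV.
pose H := [set A : set V | measurable A /\ vanish (L1_modulus \1_(A `&` B0 M))].
suff : <<s (@open V) >> `<=` H.
  by move=> /(_ A (measurable_g_open mA)) [].
have lI C : measurable C -> L1 lam \1_(C `&` B0 M).
  move=> mC; apply: L1_indic; first exact: measurableI.
  exact: lebesgueI_lty (B0_lty M).
apply: (@lambda_system_subset _ (@open V)) => //.
- by move=> C D oC oD; exact: openI.
- split => //.
  + split; first exact: measurableT.
    rewrite setTI; apply: vanish_L1_modulus_open (B0_lty M).
    exact: open_B0.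
  + move=> C D DC [mC vC] [mD vD]; split; first exact: measurableD.
    apply: vanish_le (vanishD vC vD) => h.
    rewrite /L1_modulus -ID; [|exact: L1_L1_modulus (lI _ mC)|exact: L1_L1_modulus (lI _ mD)].
    apply: I_le; first exact: L1_L1_modulus (lI _ (measurableD mC mD)).
      exact: (L1D (L1_L1_modulus h (lI _ mC)) (L1_L1_modulus h (lI _ mD))).
    have E x : \1_((C `\` D) `&` B0 M) x = \1_(C `&` B0 M) x - \1_(D `&` B0 M) x :> R.
      have : x \in D -> x \in C by rewrite !inE; exact: DC.
      rewrite !indicE.
      have -> : (x \in (C `\` D) `&` B0 M) = [&& x \in C, x \notin D & x \in B0 M].
        by apply/idP/and3P; rewrite !inE notin_setE; [move=> [[]]|move=> []].
      rewrite !in_setI.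
      case: (x \in D) => [->//=|_]; first (by rewrite subrr); case: (x \in C); case: (x \in B0 M);
      by rewrite /= ?subrr ?subr0.
    move=> x; rewrite !E.
    set a := \1_(C `&` _) x; set b := \1_(D `&` _) x.
    set a' := \1_(C `&` _) (x - h); set b' := \1_(D `&` _) (x - h).
    by rewrite (_ : a - b - (a' - b') = (a - a') - (b - b')) ?ler_normB//; ring.
  + move=> F ndF HF.
    have mU : measurable (\bigcup_n F n) by apply: bigcupT_measurable => n; have [] := HF n.
    split => //.
    apply: vanish_L1_modulus_closed; first exact: lI.
    move=> e e0.
    have mF n := (HF n).1.
    have ind n x : `|\1_(\bigcup_n F n `&` B0 M) x - \1_(F n `&` B0 M) x| <= \1_(B0 M) x :> R.
      rewrite !indicE; have [xB|xB] := pselect (B0 M x).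
        rewrite (mem_set xB); case: (x \in _); case: (x \in _);
        by rewrite ?subrr ?subr0 ?sub0r ?normrN ?normr1 ?normr0.
      by rewrite !(@memNset _ _ x) ?subrr ?normr0// => -[].
    have lB : L1 lam \1_(B0 M) by apply: L1_indic => //; exact: B0_lty.
    have cv : (\int[lam]_x `|\1_(\bigcup_n F n `&` B0 M) x - \1_(F n `&` B0 M) x|)
        @[n --> \oo] --> \int[lam]_x (0 : R).
      apply: (I_dct _ _ lB).
      - by move=> n; exact: (L1_measurable (L1_norm (L1B (lI _ mU) (lI _ (mF n))))).
      - exact: measurable_cst.
      - by move=> n x; rewrite normr_id; exact: ind.
      move=> x; have [[N _ xN]|xn] := pselect ((\bigcup_n F n) x).
        apply/cvgrPdist_lt => e' e'0; exists N => // n /= Nn.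
        have xFn : F n x by move/subsetPset : (ndF _ _ Nn); exact.
        have -> : \1_(\bigcup_n F n `&` B0 M) x = \1_(F n `&` B0 M) x :> R.
          rewrite !indicE; congr (_%:R); apply: congr1; apply/idP/idP; rewrite !inE => -[_ xB]; split => //.
          by exists n.
        by rewrite subrr normr0 subrr normr0.
      rewrite (_ : (fun _ => _) = fun=> 0); first exact: cvg_cst.
      apply/funext => n; rewrite !indicE !(@memNset _ _ x) ?subrr ?normr0//.
        by move=> [xF _]; apply: xn; exists n.
      by move=> [].
    rewrite I0 in cv.
    have /cvgrPdist_le /(_ _ e0) [N _ /(_ N (leqnn N))] := cv.
    rewrite sub0r normrN => HN.
    exists \1_(F N `&` B0 M); split; [exact: lI|by have [] := HF N|].
    exact: (le_trans (ler_norm _) HN).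
- move=> U oU; have mU := open_measurable_rV oU; split => //.
  apply: vanish_L1_modulus_open; last exact: lebesgueI_lty (B0_lty M).
  by apply: openI => //; exact: open_B0.
Qed.

Lemma vanish_L1_modulus_indic (A : set V) : measurable A -> (lam A < +oo)%E -> vanish (L1_modulus \1_A).
Proof.
move=> mA Ay; have lA := L1_indic mA Ay.
apply: vanish_L1_modulus_closed => // e e0.
have lI n : L1 lam \1_(A `&` B0 n%:R).
  apply: L1_indic; first by apply: measurableI => //; exact: measurable_ball_rV.
  by apply: lebesgueI_lty => //; [exact: measurable_ball_rV|exact: B0_lty].
have cv : (\int[lam]_x `|\1_A x - \1_(A `&` B0 n%:R) x|) @[n --> \oo] --> \int[lam]_x (0 : R).
  apply: (I_dct _ _ lA).
  - by move=> n; exact: (L1_measurable (L1_norm (L1B lA (lI n)))).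
  - exact: measurable_cst.
  - move=> n x; rewrite normr_id !indicE.
    have [xA|xA] := pselect (A x).
      rewrite (mem_set xA); case: (x \in _);
      by rewrite ?subrr ?subr0 ?normr1 ?normr0.
    by rewrite !(@memNset _ _ x) ?subrr ?normr0// => -[].
  move=> x; have [M xM] : exists M, B0 M x.
    have [M HM] := compact_box (@compact_set1 V x).
    exists (Num.max M 1 + 1); apply: box_B0; first by rewrite lt_max ltr01 orbT.
    by apply: box_le (HM x erefl); rewrite le_max lexx.
  apply/cvgrPdist_lt => e' e'0; exists (Num.trunc M).+1 => // n /= Mn.
  have xn : B0 n%:R x.
    apply: le_ball xM; apply: ltW; apply: (lt_le_trans (truncnS_gt M)).
    by rewrite ler_nat.
  have -> : \1_(A `&` B0 n%:R) x = \1_A x :> R.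
    rewrite !indicE; congr (_%:R); apply: congr1; apply/idP/idP; rewrite !inE; first by case.
    by move=> xA; split.
  by rewrite subrr normr0 subrr normr0.
rewrite I0 in cv.
have /cvgrPdist_le /(_ _ e0) [N _ /(_ N (leqnn N))] := cv.
rewrite sub0r normrN => HN.
exists \1_(A `&` B0 N%:R); split; [exact: lI|exact: vanish_L1_modulus_bounded|].
exact: (le_trans (ler_norm _) HN).
Qed.

Section Lp_translation.
Variable p : R.
Hypothesis p1 : 1 <= p.
Let p0 : 0 < p. Proof. exact: lt_le_trans ltr01 p1. Qed.
Let p1E : (1 <= p%:E)%E. Proof. by rewrite lee_fin. Qed.
Let p0E : (0 <= p%:E)%E. Proof. by rewrite lee_fin ltW. Qed.

(** Modulus of continuity of the translations in L^p. *)
Definition omega f (h : V) : R := nrm p%:E (fun x => f x - f (x - h)).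

Lemma omega_ge0 f h : 0 <= omega f h. Proof. exact: nrm_ge0. Qed.

Lemma Lx_diff f h : Lx p%:E f -> Lx p%:E (fun x => f x - f (x - h)).
Proof. by move=> lf; apply: (LxB p1E lf); exact: Lx_shift. Qed.

Lemma omega_le f g h : Lx p%:E f -> Lx p%:E g ->
  omega f h <= omega g h + 2 * nrm p%:E (fun x => f x - g x).
Proof.
move=> lf lg; have lfg := LxB p1E lf lg.
have sfg := Lx_shift h p0E lfg.
rewrite /omega (_ : (fun x => f x - f (x - h)) = (fun x => (g x - g (x - h)) +
   ((f x - g x) - (f (x - h) - g (x - h))))); last by apply/funext => x; ring.
apply: (le_trans (nrmD p1E (Lx_diff h lg) (LxB p1E lfg sfg))).
rewrite lerD2l; apply: (le_trans (nrmB p1E lfg sfg)).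
by rewrite (nrm_shift h p0E lfg) mulr_natl mulr2n.
Qed.

Lemma vanish_omega_closed f : Lx p%:E f ->
  (forall e : R, 0 < e -> exists g, [/\ Lx p%:E g, vanish (omega g) &
     nrm p%:E (fun x => f x - g x) <= e]) ->
  vanish (omega f).
Proof.
move=> lf H; apply: vanish_closed => e e0.
have e2 : 0 < e / 2 by rewrite divr_gt0.
have [g [lg vg fg]] := H (e / 2) e2.
exists (omega g) => // h; apply: (le_trans (omega_le h lf lg)).
rewrite lerD2l -ler_pdivlMl// mulrC; exact: fg.
Qed.

Lemma vanish_omegaD f g : Lx p%:E f -> Lx p%:E g ->
  vanish (omega f) -> vanish (omega g) -> vanish (omega (fun x => f x + g x)).
Proof.
move=> lf lg vf vg; apply: vanish_le (vanishD vf vg) => h.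
rewrite /omega (_ : (fun x => f x + g x - _) =
  (fun x => (f x - f (x - h)) + (g x - g (x - h)))); last by apply/funext => x; ring.
exact: (nrmD p1E (Lx_diff h lf) (Lx_diff h lg)).
Qed.

Lemma vanish_omegaN f : Lx p%:E f -> vanish (omega f) -> vanish (omega (fun x => - f x)).
Proof.
move=> lf vf; apply: vanish_le vf => h.
rewrite /omega (_ : (fun x => - f x - _) = (fun x => - (f x - f (x - h)))); last by apply/funext => x; ring.
by rewrite (nrmN p0E (Lx_diff h lf)).
Qed.

Lemma Lx_cindic c (A : set V) : measurable A -> (lam A < +oo)%E ->
  Lx p%:E (fun x => c * \1_A x).
Proof.
move=> mA Ay; apply/(Lx_poweR _ p0).
have m : measurable_fun [set: V] (fun x => c * \1_A x).
  by apply: measurable_funM => //; exact: measurable_indic.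
split; first exact: m.
apply: (L1_ext _ (L1Z (`|c| `^ p) (L1_indic mA Ay))) => x.
rewrite indicE; case: (x \in A); first by rewrite !mulr1.
by rewrite !mulr0 normr0 powR0 ?gt_eqF.
Qed.

(** An indicator takes the values 0 and 1 only, so the p-th power of its L^p
    modulus is its L^1 modulus. *)
Lemma vanish_omega_indic c (A : set V) : measurable A -> (lam A < +oo)%E ->
  vanish (omega (fun x => c * \1_A x)).
Proof.
move=> mA Ay e e0.
have lc := Lx_cindic c mA Ay; have lA := L1_indic mA Ay.
have cp : 0 < (`|c| `^ p) + 1 by rewrite ltr_wpDl ?powR_ge0.
have ep : 0 < e `^ p / ((`|c| `^ p) + 1) by rewrite divr_gt0// powR_gt0.
have [delta d0 H] := vanish_L1_modulus_indic mA Ay ep.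
exists delta => // h /H dh.
apply: (nrm_le p0 (ltW e0) (Lx_diff h lc)).
rewrite (_ : \int[lam]_x _ = \int[lam]_x (`|c| `^ p * `|\1_A x - \1_A (x - h)|)); last first.
  apply: I_ext => x; rewrite -mulrBr normrM powRM ?normr_ge0//; congr (_ * _).
  rewrite !indicE; case: (x \in A); case: (_ \in A);
  by rewrite ?subrr ?subr0 ?sub0r ?normrN ?normr0 ?normr1 ?powR1 ?powR0 ?gt_eqF.
rewrite (IZ _ (L1_L1_modulus h lA)).
apply: (@le_trans _ _ ((`|c| `^ p) * (e `^ p / ((`|c| `^ p) + 1)))).
  by apply: ler_wpM2l => //; exact: powR_ge0.
by rewrite mulrA ler_pdivrMr// mulrC ler_wpM2l ?powR_ge0// lerDl.
Qed.

Import HBNNSimple.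

(** The level sets of a simple function below f, except that of 0, have finite
    measure since f is in L^p. *)
Lemma vanish_omega_sfun (f : V -> R) (g : {nnsfun V >-> R}) :
  Lx p%:E f -> (forall x, g x <= f x) -> Lx p%:E g /\ vanish (omega g).
Proof.
move=> lf gf.
have fin y : y != 0 -> (lam (g @^-1` [set y]) < +oo)%E.
  move=> y0; have [yneg|ypos] := ltP y 0.
    rewrite (_ : g @^-1` [set y] = set0) ?measure0//.
    apply/seteqP; split => // x /= gxy.
    have : 0 <= y by rewrite -gxy; exact: fun_ge0.
    by rewrite leNgt yneg.
  have y0' : 0 < y by rewrite lt_def y0.
  have [mf lp] := (Lx_poweR f p0).1 lf.
  have [A AE] : exists A : set V, A = g @^-1` [set y] by exists (g @^-1` [set y]).
  have mA : measurable A by rewrite AE.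
  rewrite -AE; have := L1_abs_lty lp.
  apply: contraTT; rewrite -!leNgt !leye_eq => /eqP Ay.
  rewrite -leye_eq.
  have -> : (+oo = \int[lam]_x ((y `^ p)%:E * (\1_A x)%:E))%E.
    rewrite ge0_integralZl_EFin ?powR_ge0//; last first.
      by apply/measurable_EFinP; exact: measurable_indic.
    have -> : (\int[lam]_x (\1_A x)%:E = lam A)%E by rewrite integral_indic// setIT.
    by rewrite Ay gt0_muley// lte_fin powR_gt0.
  apply: ge0_le_integral => //.
  - by move=> x _; rewrite mule_ge0 ?lee_fin ?powR_ge0.
  - apply/measurable_EFinP; apply: measurable_funM => //; exact: measurable_indic.
  - apply/measurable_EFinP; apply: measurableT_comp => //.
    exact: (L1_measurable lp).
  move=> x _; rewrite -EFinM lee_fin ger0_norm ?powR_ge0// indicE.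
  have [|] := boolP (x \in _); last by rewrite mulr0 powR_ge0.
  rewrite inE AE /= mulr1 => gxy.
  apply: ge0_ler_powR; [exact: ltW|exact: ltW|exact: normr_ge0|].
  by rewrite -gxy (le_trans (gf x))// ler_norm.
have E : (g : V -> R) = (fun x => \sum_(y <- finmap.enum_fset (fset_set (range g))) y * \1_(g @^-1` [set y]) x).
  by apply/funext => x; rewrite {1}(fimfunE g x) fsbig_finite.
suff H s : Lx p%:E (fun x => \sum_(y <- s) y * \1_(g @^-1` [set y]) x) /\
    vanish (omega (fun x => \sum_(y <- s) y * \1_(g @^-1` [set y]) x)).
  by rewrite E; exact: H.
elim: s => [|y s [IH1 IH2]].
  under eq_fun do rewrite big_nil.
  have l0 : Lx p%:E (fun _ : V => 0).
    apply/(Lx_poweR _ p0); split; first exact: measurable_cst.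
    by apply: (L1_ext _ (L1_0 _)) => x; rewrite normr0 powR0 ?gt_eqF.
  split; first exact: l0.
  move=> e e0; exists 1 => // h _; apply: (nrm_le p0 (ltW e0) (Lx_diff h l0)).
  rewrite (_ : \int[lam]_x _ = \int[lam]_x (0 : R)); first by rewrite I0 powR_ge0.
  by apply: I_ext => x; rewrite subr0 normr0 powR0 ?gt_eqF.
under eq_fun do rewrite big_cons.
have [y0|y0] := eqVneq y 0.
  rewrite y0 (_ : (fun x => _) = (fun x => \sum_(j <- s) j * \1_(g @^-1` [set j]) x))//.
  by apply/funext => x; rewrite mul0r add0r.
have mA : measurable (g @^-1` [set y]) by [].
have l := Lx_cindic y mA (fin _ y0).
split; first exact: (LxD p1E l IH1).
by apply: (vanish_omegaD l IH1) => //; exact: vanish_omega_indic (fin _ y0).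
Qed.

Lemma vanish_omega_ge0 f : Lx p%:E f -> (forall x, 0 <= f x) -> vanish (omega f).
Proof.
move=> lf f0; have mf := Lx_meas lf.
have mf' : measurable_fun setT (EFin \o f) by exact/measurable_EFinP.
pose g := nnsfun_approx measurableT mf'.
have cvg_g x : g n x @[n --> \oo] --> f x.
  have := cvg_nnsfun_approx measurableT mf' (fun x _ => f0 x) (I : [set: V] x).
  by move=> /fine_cvg.
have gf n x : g n x <= f x.
  rewrite -(cvg_lim _ (cvg_g x))//; apply: nondecreasing_cvgn_le.
    by move=> i j ij; have /asboolP := nd_nnsfun_approx measurableT mf' ij; apply.
  by apply/cvg_ex; exists (f x).
have H n := vanish_omega_sfun lf (gf n).
apply: (vanish_omega_closed lf) => e e0.
have [_ lp] := (Lx_poweR f p0).1 lf.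
have mp n : measurable_fun [set: V] (fun x => `|f x - g n x| `^ p).
  apply: (measurableT_comp (measurable_powR p)); apply: measurableT_comp => //.
  by apply: measurable_funB => //; exact: (Lx_meas (H n).1).
have cv : (\int[lam]_x (`|f x - g n x| `^ p)) @[n --> \oo] --> \int[lam]_x (0 : R).
  apply: (I_dct mp _ lp).
  - exact: measurable_cst.
  - move=> n x; rewrite ger0_norm ?powR_ge0//.
    apply: ge0_ler_powR; [exact: ltW|exact: normr_ge0|exact: normr_ge0|].
    rewrite !ger0_norm ?subr_ge0//.
    by rewrite gerBl; exact: fun_ge0.
  move=> x; apply/cvgrPdist_le => e' e'0.
  have e1 : 0 < e' `^ p^-1 by rewrite powR_gt0.
  have /cvgrPdist_le /(_ _ e1) := cvg_g x; apply: filterS => n hn.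
  rewrite sub0r normrN ger0_norm ?powR_ge0//.
  rewrite -[leRHS](powRr1 (ltW e'0)) -(mulVf (lt0r_neq0 p0)) powRrM.
  by apply: ge0_ler_powR; [exact: ltW|exact: normr_ge0|exact: powR_ge0|].
rewrite I0 in cv.
have ep : 0 < e `^ p by rewrite powR_gt0.
have /cvgrPdist_le /(_ _ ep) [N _ /(_ N (leqnn N))] := cv.
rewrite sub0r normrN => HN.
exists (g N); split; [exact: (H N).1|exact: (H N).2|].
apply: (nrm_le p0 (ltW e0) (LxB p1E lf (H N).1)).
exact: (le_trans (ler_norm _) HN).
Qed.

(** Continuity of translations in L^p, p finite: indicators, then simple
    functions, then increasing limits, then positive and negative parts. *)
Lemma vanish_omega f : Lx p%:E f -> vanish (omega f).
Proof.
move=> lf; have [mf lp] := (Lx_poweR f p0).1 lf.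
have part g : measurable_fun [set: V] g -> (forall x, 0 <= g x) -> (forall x, `|g x| <= `|f x|) -> Lx p%:E g.
  move=> mg g0 gf; apply/LxP; split => //.
  by apply: le_lt_trans ((LxP _ _).1 lf).2; exact: Lx_norm_le.
pose f1 x := Num.max (f x) 0; pose f2 x := Num.max (- f x) 0.
have l1 : Lx p%:E f1.
  apply: part => [|x|x]; first exact: measurable_maxr.
    by rewrite le_max lexx orbT.
  by rewrite /f1 maxEle; case: ifP => _ //; rewrite normr0.
have l2 : Lx p%:E f2.
  apply: part => [|x|x]; first by apply: measurable_maxr => //; exact: measurable_funN.
    by rewrite le_max lexx orbT.
  by rewrite /f2 maxEle; case: ifP => _; rewrite ?normr0// normrN.
have E : f = (fun x => f1 x + - f2 x).
  apply/funext => x; rewrite /f1 /f2; case: leP => h1; case: leP => h2; lra.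
rewrite E; apply: (vanish_omegaD l1 (LxN p0E l2)).
  by apply: vanish_omega_ge0 => // x; rewrite /f1 le_max lexx orbT.
apply: (vanish_omegaN l2).
by apply: vanish_omega_ge0 => // x; rewrite /f2 le_max lexx orbT.
Qed.

End Lp_translation.

End translation_continuity.

(** * Smooth functions with compact support *)

Section real_calculus.
Context {R : realType}.
Implicit Types f g F : R -> R.

Lemma is_derive_continuous f df (x : R) : is_derive x 1 f df -> {for x, continuous f}.
Proof.
move=> [dfx _]; apply: differentiable_continuous; exact/derivable1_diffP.
Qed.

(** The mean value theorem regardless of the order of the two points. *)
Lemma mvt_abs f df : (forall t : R, is_derive t 1 f (df t)) ->
  forall a b : R, exists2 c, `|c - a| <= `|b - a| & f b - f a = df c * (b - a).
Proof.
move=> Hf a b.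
have cf : continuous f by move=> t; exact: is_derive_continuous (Hf t).
have cw (A : set R) : {within A, continuous f} by exact: continuous_subspaceT.
have [ab|ba] := leP a b.
  have [c] := MVT_segment ab (fun t _ => Hf t) (cw _).
  rewrite in_itv/= => /andP[ac cb] E; exists c => //.
  by rewrite !ger0_norm ?subr_ge0// lerB.
have [c] := MVT_segment (ltW ba) (fun t _ => Hf t) (cw _).
rewrite in_itv/= => /andP[bc ca] E; exists c.
  by rewrite !ler0_norm ?subr_le0// ?(ltW ba)// lerN2 lerB.
by rewrite -opprB E; ring.
Qed.

Lemma is_derive_sub (f : R -> R) (a t df : R) : is_derive (a - t) 1 f df ->
  is_derive t 1 (fun t => f (a - t)) (- df).
Proof.
move=> h; have i : is_derive t 1 (fun t : R => a - t) (-1).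
  have := is_deriveB (is_derive_cst a t (1 : R)) (is_derive_id t (1 : R)).
  by rewrite sub0r.
by have := @is_derive1_comp R f (fun t => a - t) t df (-1) h i; rewrite mulrN1.
Qed.

Lemma is_derive_add (f : R -> R) (a t df : R) : is_derive (a + t) 1 f df ->
  is_derive t 1 (fun t => f (a + t)) df.
Proof.
move=> h; have i : is_derive t 1 (fun t : R => a + t) 1.
  have := is_deriveD (is_derive_cst a t (1 : R)) (is_derive_id t (1 : R)).
  by rewrite add0r.
by have := @is_derive1_comp R f (fun t => a + t) t df 1 h i; rewrite mulr1.
Qed.

(** Differentiability n times with a continuous derivative, the derivatives
    being existentially quantified: closure under products and affine
    substitutions is then a plain induction on n. *)
Fixpoint Ck n g : Prop :=
  if n is m.+1 then exists g', (forall x : R, is_derive x 1 g (g' x)) /\ Ck m g'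
  else continuous g.

Lemma CkW n g : Ck n.+1 g -> Ck n g.
Proof.
elim: n g => [|n IH] g [g' [dg sg]].
  by move=> x; exact: is_derive_continuous (dg x).
by exists g'; split => //; exact: IH.
Qed.

Lemma CkD n f g : Ck n f -> Ck n g -> Ck n (fun x => f x + g x).
Proof.
elim: n f g => [|n IH] f g.
  by move=> cf cg x; apply: cvgD; [exact: cf|exact: cg].
move=> [f' [df sf]] [g' [dg sg]]; exists (fun x => f' x + g' x).
by split; [move=> x; exact: is_deriveD|exact: IH].
Qed.

Lemma CkM n f g : Ck n f -> Ck n g -> Ck n (fun x => f x * g x).
Proof.
elim: n f g => [|n IH] f g.
  by move=> cf cg x; apply: cvgM; [exact: cf|exact: cg].
move=> sf sg; have sf' := CkW sf; have sg' := CkW sg.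
move: sf sg => [f' [df sf]] [g' [dg sg]].
exists (fun x => f x * g' x + g x * f' x); split.
  by move=> x; exact: is_deriveM.
by apply: CkD; exact: IH.
Qed.

Lemma Ck_cst n (c : R) : Ck n (fun=> c).
Proof.
elim: n c => [|n IH] c; first by move=> x; exact: cvg_cst.
by exists (fun=> 0); split; [move=> x; exact: is_derive_cst|exact: IH].
Qed.

Lemma Ck_sub n g (a : R) : Ck n g -> Ck n (fun x => g (a - x)).
Proof.
elim: n g => [|n IH] g.
  move=> cg x; apply: (@continuous_comp _ _ _ (fun x : R => a - x) g); last exact: cg.
  by apply: cvgB; [exact: cvg_cst|exact: cvg_id].
move=> [g' [dg sg]]; exists (fun x => - 1 * g' (a - x)); split.
  by move=> x; rewrite mulN1r; exact: is_derive_sub.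
by apply: CkM; [exact: Ck_cst|exact: IH].
Qed.

Lemma Ck_add n g (a : R) : Ck n g -> Ck n (fun x => g (a + x)).
Proof.
elim: n g => [|n IH] g.
  move=> cg x; apply: (@continuous_comp _ _ _ (fun x : R => a + x) g); last exact: cg.
  by apply: cvgD; [exact: cvg_cst|exact: cvg_id].
move=> [g' [dg sg]]; exists (fun x => g' (a + x)); split.
  by move=> x; exact: is_derive_add.
exact: IH.
Qed.

Definition Cinfty g := forall n, Ck n g.

Lemma Cinfty_derive g : Cinfty g -> Cinfty (derive1 g) /\ forall x : R, is_derive x 1 g ((derive1 g) x).
Proof.
move=> sg; have [g' [dg _]] := sg 1%N.
have E : (derive1 g) = g' by apply/funext => x; rewrite derive1E; exact: derive_val.
split; last by move=> x; rewrite E.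
move=> n; have [h [dh sh]] := sg n.+1.
suff -> : (derive1 g) = h by [].
by apply/funext => x; rewrite derive1E; exact: derive_val.
Qed.

(** The functions t^-m exp (- 1 / t) extended by 0, whose span is stable under
    differentiation, so that smoothness follows by induction with m free. *)
Definition flat m (t : R) := if 0 < t then t^-1 ^+ m * expR (- t^-1) else 0.

Lemma flat_ge0 m t : 0 <= flat m t.
Proof.
rewrite /flat; case: ifP => // t0; rewrite mulr_ge0 ?expR_ge0//.
by rewrite exprn_ge0// invr_ge0 ltW.
Qed.

(** The exponential series gives exp s >= s^(m+1) / (m+1)!, used at s = 1 /
    t. *)
Lemma flat_le m (t : R) : 0 < t -> flat m t <= (m.+1)`!%:R * t.
Proof.
move=> t0; rewrite /flat t0.
have s0 : 0 < t^-1 by rewrite invr_gt0.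
have := expR_ge1Dxn m (ltW s0).
have [s sE] : exists s, s = t^-1 by exists t^-1.
rewrite -[X in _ -> _ <= _ * X]invrK -sE in s0 *.
have f0 : (0 : R) < (m.+1)`!%:R by rewrite ltr0n fact_gt0.
move=> h; rewrite expRN.
have e0 := expR_gt0 s.
rewrite ler_pdivrMr// mulrAC ler_pdivlMr// -exprSr -ler_pdivrMl// mulrC.
by apply: le_trans h; rewrite lerDr.
Qed.

Lemma flat_is_derive m (x : R) :
  is_derive x 1 (flat m) (flat m.+2 x - m%:R * flat m.+1 x).
Proof.
have [x0|x0|x0] := ltgtP x 0.
- rewrite /flat (ltNge 0 x) (ltW x0)/= mulr0 subrr.
  apply: (@near_eq_is_derive R _ _ (cst 0 : R -> R)) (is_derive_cst _ _ _).
  near=> y; rewrite ifF//; apply/negbTE; rewrite -leNgt; apply: ltW.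
  near: y; exact: lt_nbhsl.
- have fx k : flat k x = x^-1 ^+ k * expR (- x^-1) by rewrite /flat x0.
  rewrite !fx.
  apply: (@near_eq_is_derive R _ _ (fun t : R => t^-1 ^+ m * expR (- t^-1)) (flat m)).
    near=> y; rewrite /flat ifT//; near: y; exact: lt_nbhsr.
  have xn0 : x != 0 by rewrite gt_eqF.
  have dV : is_derive x 1 (fun t : R => t^-1) (- (x^-1 ^+ 2)).
    have := @is_deriveV R id x 1 1 xn0 (is_derive_id x (1 : R)).
    by move=> H; apply: (is_derive_eq H); rewrite -[_ *: _]/(_ * _) mulr1 exprVn.
  have dN : is_derive x 1 (fun t : R => - t^-1) (x^-1 ^+ 2).
    by have := is_deriveN dV; rewrite opprK.
  have dE := @is_derive1_comp R expR (fun t => - t^-1) x _ _ (is_derive_expR (- x^-1)) dN.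
  have dX := @is_deriveX _ _ _ m _ _ _ dV.
  have -> : (fun t : R => t^-1 ^+ m * expR (- t^-1)) =
      ((fun t : R => t^-1) ^+ m * (expR \o (fun t : R => - t^-1)))%R.
    by apply/funext => t; rewrite !fctE.
  apply: (is_derive_eq (is_deriveM dX dE)); rewrite !fctE.
  rewrite -![_ *: _]/(_ * _) /=.
  case: (m) => [|k]; rewrite /= ?expr0 ?mul0r ?mulr0 ?addr0 ?subr0 ?mul1r.
    by rewrite mulrC.
  rewrite !exprS; ring.
- have f00 k : flat k 0 = 0 by rewrite /flat ltxx.
  rewrite x0 !f00 mulr0 subrr.
  have cv : h^-1 *: (flat m (h *: (1 : R) + 0) - flat m 0) @[h --> 0^'] --> (0 : R).
    apply/cvgrPdist_le => e e0; near=> h.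
    rewrite sub0r normrN addr0 f00 subr0 -[h *: (1 : R)]/(h * 1) mulr1.
    rewrite -[_ *: _]/(_ * _).
    have [h0|h0] := leP h 0; first by rewrite /flat ltNge h0 mulr0 normr0 ltW.
    have -> : h^-1 * flat m h = flat m.+1 h by rewrite /flat h0 exprS mulrA.
    rewrite ger0_norm ?flat_ge0//; apply: (le_trans (flat_le _ h0)).
    have f0 : (0 : R) < (m.+2)`!%:R by rewrite ltr0n fact_gt0.
    rewrite -ler_pdivlMl// mulrC; apply: (le_trans (ler_norm _)).
    near: h; apply: dnbhs0_le; by rewrite divr_gt0.
  apply: DeriveDef; first by apply/cvg_ex; exists 0.
  exact: cvg_lim.
Unshelve. all: by end_near. Qed.

Lemma Ck_flat n m : Ck n (flat m).
Proof.
elim: n m => [|n IH] m.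
  by move=> x; exact: is_derive_continuous (flat_is_derive m x).
exists (fun x => flat m.+2 x + (- m%:R) * flat m.+1 x); split.
  by move=> x; rewrite mulNr; exact: flat_is_derive.
by apply: CkD => //; apply: CkM => //; exact: Ck_cst.
Qed.

(** A smooth bump on [- a, a]. *)
Definition tent (a t : R) := flat 0 (a + t) * flat 0 (a - t).

Lemma Cinfty_tent a : Cinfty (tent a).
Proof. by move=> n; apply: CkM; [exact/Ck_add/Ck_flat|exact/Ck_sub/Ck_flat]. Qed.

Lemma tent_ge0 a t : 0 <= tent a t. Proof. by rewrite mulr_ge0 ?flat_ge0. Qed.

Lemma tent_eq0 a t : a < `|t| -> tent a t = 0.
Proof.
rewrite /tent /flat => at_.
have [h|h] := leP 0 t.
  by rewrite [X in _ * X]ifF ?mulr0//; apply/negbTE; rewrite -leNgt subr_le0 ltW// -[t]ger0_norm.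
rewrite ifF ?mul0r//; apply/negbTE; rewrite -leNgt -lerBrDr sub0r ltW//.
by rewrite -[- t]gtr0_norm ?oppr_gt0// normrN.
Qed.

(** The lower bound is uniform near 0, so that products of such bumps have
    positive integrals. *)
Lemma tent_gt0 a t : 0 < a -> `|t| <= a / 2 -> expR (- (a / 2)^-1) ^+ 2 <= tent a t.
Proof.
move=> a0; rewrite ler_norml => /andP[h1 h2].
have a2 : 0 < a / 2 by rewrite divr_gt0.
have key y : a / 2 <= y -> expR (- (a / 2)^-1) <= flat 0 y.
  move=> ay; have y0 : 0 < y by exact: lt_le_trans a2 ay.
  by rewrite /flat y0 expr0 mul1r ler_expR lerN2 lef_pV2.
rewrite expr2 /tent; apply: ler_pM; rewrite ?expR_ge0//; apply: key.
  lra.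
lra.
Qed.

End real_calculus.

Section directional.
Context {R : realType} {d : nat}.
Local Notation V := 'rV[R]_d.
Implicit Types (f : V -> R) (x v : V).

Lemma is_derive_line f x v t df :
  is_derive (x + t *: v) v f df <-> is_derive t 1 (fun t : R => f (x + t *: v)) df.
Proof.
have E : (fun h : R => h^-1 *: ((f \o shift (x + t *: v)) (h *: v) - f (x + t *: v))) =
    (fun h : R => h^-1 *: (((fun t : R => f (x + t *: v)) \o shift t) (h *: (1 : R)) - f (x + t *: v))).
  apply/funext => h; congr (_ *: (f _ - _)).
  by rewrite /= -[h *: 1]/(h * 1) mulr1 scalerDl addrCA.
split=> -[D e]; split.
- by move: D; rewrite /derivable E.
- by rewrite -e /derive E.
- by move: D; rewrite /derivable E.
- by rewrite -e /derive E.
Qed.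

Definition ei (k : 'I_d) : V := delta_mx ord0 k.

Lemma eiE k t x j : (x + t *: ei k) ord0 j = x ord0 j + t * (j == k)%:R.
Proof. by rewrite !mxE eqxx. Qed.

Definition tensor (g : 'I_d -> R -> R) : V -> R := fun x => \prod_(i < d) g i (x ord0 i).

(** The class of products of smooth functions of one coordinate is stable
    under partial derivatives, which makes smoothness in several variables an
    induction on the list of derivatives. *)
Lemma tensor_is_derive g k x : (forall i, Cinfty (g i)) ->
  is_derive x (ei k) (tensor g) (tensor (fun i => if i == k then derive1 (g i) else g i) x).
Proof.
move=> sg; have E := is_derive_line (tensor g) x (ei k) 0.
move: E; rewrite scale0r addr0 => E; apply/E => {E}.
have [_ dg] := Cinfty_derive (sg k).
have D : is_derive (0 : R) 1 (fun t : R => g k (x ord0 k + t)) (derive1 (g k) (x ord0 k)).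
  by apply: is_derive_add; rewrite addr0.
set C := \prod_(i < d | i != k) g i (x ord0 i).
have -> : (fun t : R => tensor g (x + t *: ei k)) = (fun t : R => C * g k (x ord0 k + t)).
  apply/funext => t; rewrite /tensor (bigD1 k)//= eiE eqxx mulr1 mulrC; congr (_ * _).
  by apply: eq_bigr => i /negbTE ik; rewrite eiE ik mulr0 addr0.
have := is_deriveM (is_derive_cst C (0 : R) (1 : R)) D.
move=> H; apply: (is_derive_eq H).
rewrite scaler0 addr0 -[_ *: _]/(_ * _) /tensor (bigD1 k)//= eqxx mulrC; congr (_ * _).
by apply: eq_bigr => i /negbTE ->.
Qed.

Lemma cpartial_tensor g k : (forall i, Cinfty (g i)) ->
  cpartial k (tensor g) = tensor (fun i => if i == k then derive1 (g i) else g i).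
Proof.
move=> sg; apply/funext => x; rewrite /cpartial.
exact: (@derive_val _ _ _ _ _ _ _ (tensor_is_derive k x sg)).
Qed.

Lemma continuous_tensor g : (forall i, continuous (g i)) -> continuous (tensor g).
Proof.
move=> cg x; rewrite /tensor.
have c i : {for x, continuous (fun y : V => g i (y ord0 i))}.
  apply: (@continuous_comp _ _ _ (fun y : V => y ord0 i) (g i)); last exact: cg.
  exact: coord_continuous.
elim: (index_enum _) => [|i s IH].
  have -> : (fun y : V => \prod_(i <- [::]) g i (y ord0 i)) = cst 1.
    by apply/funext => y; rewrite big_nil.
  exact: cst_continuous.
have -> : (fun y : V => \prod_(j <- i :: s) g j (y ord0 j)) =
    (fun y : V => g i (y ord0 i) * \prod_(j <- s) g j (y ord0 j)).
  by apply/funext => y; rewrite big_cons.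
by apply: cvgM IH; exact: c.
Qed.

Lemma cpartials_tensor g s : (forall i, Cinfty (g i)) ->
  exists2 g', (forall i, Cinfty (g' i)) & cpartials s (tensor g) = tensor g'.
Proof.
elim: s => [|k s IH] sg /=; first by exists g.
have [g' sg' ->] := IH sg; rewrite cpartial_tensor//.
exists (fun i => if i == k then derive1 (g' i) else g' i) => // i.
by case: (i == k) => //; exact: (Cinfty_derive (sg' i)).1.
Qed.

Lemma smooth_tensor g : (forall i, Cinfty (g i)) -> smooth (tensor g).
Proof.
move=> sg s; have [g' sg' ->] := cpartials_tensor s sg; split.
  by apply: continuous_tensor => i; exact: (sg' i 0%N).
by move=> k x; have [] := tensor_is_derive k x sg'.
Qed.

Lemma closed_box M : closed (box M : set V).
Proof.
rewrite boxE; apply: closed_bigI => i _.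
apply: preimage_closed; last exact: interval_closed.
by move=> x _; exact: coord_continuous.
Qed.

Lemma compact_box_rV M : compact (box M : set V).
Proof.
have := @rV_compact R d (fun=> `[- M, M]%classic) (fun=> @segment_compact R (- M) M).
congr compact; apply/seteqP; split => x /= h i; have := h i;
by rewrite in_itv/= -ler_norml.
Qed.

Lemma compact_support f M : (forall x, ~ box M x -> f x = 0) ->
  compact (closure [set x | f x != 0]).
Proof.
move=> f0; apply: (subclosed_compact _ (@compact_box_rV M)); first exact: closed_closure.
have /closure_id -> := @closed_box M.
apply: closure_subset => x /=; apply: contra_neqP; exact: f0.
Qed.

Lemma test_tensor g M : (forall i, Cinfty (g i)) -> (forall i t, M < `|t| -> g i t = 0) ->
  test_function (tensor g).
Proof.
move=> sg g0; split; first exact: smooth_tensor.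
apply: (compact_support (M := M)) => x /existsNP[i xi].
by rewrite /tensor (bigD1 i)//= g0 ?mul0r// ltNge; apply/negP.
Qed.

End directional.

Section test_functions.
Context {R : realType} {d : nat}.
Local Notation V := 'rV[R]_d.
Implicit Types (phi : V -> R).

Lemma smooth_is_derive phi s k x : smooth phi ->
  is_derive x (ei k) (cpartials s phi) (cpartials (k :: s) phi x).
Proof. by move=> sm_phi; apply: DeriveDef => //; exact: (sm_phi s).2. Qed.

Lemma smooth_line phi s k x (t : R) : smooth phi ->
  is_derive t 1 (fun t : R => cpartials s phi (x + t *: ei k))
    (cpartials (k :: s) phi (x + t *: ei k)).
Proof. by move=> sp; apply/is_derive_line; exact: smooth_is_derive. Qed.

Lemma test_support phi : test_function phi -> exists2 M, 0 < M &
  forall s x, ~ box M x -> cpartials s phi x = 0.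
Proof.
move=> [sp cp]; have [M0 HM0] := compact_box cp.
exists (Num.max M0 1); first by rewrite lt_max ltr01 orbT.
set M := Num.max M0 1.
have HM : forall x, ~ box M x -> phi x = 0.
  move=> x nx; apply/eqP; apply: contra_notT nx => px.
  apply: (@box_le _ _ M0); first by rewrite le_max lexx.
  by apply: HM0; apply: subset_closure.
elim=> [|k s IH] x nx; first exact: HM.
rewrite -[cpartials _ _ x](@derive_val _ _ _ _ _ _ _ (smooth_is_derive s k x sp)).
apply: (@derive_val _ _ _ _ _ _ _).
apply: (@near_eq_is_derive R _ _ (cst 0)) (is_derive_cst _ _ _).
have oC : open (~` box M : set V) by rewrite openC; exact: closed_box.
have : nbhs x (~` box M : set V) by exact: open_nbhs_nbhs.
by apply: filterS => y ny; rewrite IH.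
Qed.

Lemma test_bound phi s : test_function phi -> exists2 C : R, 0 <= C & forall x, `|cpartials s phi x| <= C.
Proof.
move=> tp; have [M M0 HM] := test_support tp.
have cs : continuous (cpartials s phi) := (tp.1 s).1.
have : compact (cpartials s phi @` box M).
  apply: continuous_compact; last exact: compact_box_rV.
  exact: continuous_subspaceT.
move=> /compact_bounded [N [_ HN]].
exists (`|N| + 1); first by rewrite addr_ge0.
move=> x; have [bx|nx] := pselect (box M x); last by rewrite HM// normr0 addr_ge0.
apply: (HN (`|N| + 1)); last by exists x.
by rewrite ltr_pwDr// ler_norm.
Qed.

(** The mean value theorem applied twice, the second derivative being bounded
    as a continuous function with compact support. *)
Lemma test_taylor phi k : test_function phi -> exists2 C : R, 0 <= C &
  forall x h, `|phi (x + h *: ei k) - phi x - h * cpartial k phi x| <= C * h ^+ 2.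
Proof.
move=> tp; have sp := tp.1.
have [C C0 HC] := test_bound [:: k; k] tp; exists C => // x h.
have [c ch E] := mvt_abs (fun t => smooth_line [::] k x t sp) 0 h.
rewrite /= scale0r addr0 subr0 in E; rewrite E.
have [c' _ E'] := mvt_abs (fun t => smooth_line [:: k] k x t sp) 0 c.
rewrite /= scale0r addr0 !subr0 in E'.
rewrite mulrC -mulrBr E' !normrM mulrCA expr2 -[h * h]ger0_norm; last by rewrite -expr2 sqr_ge0.
rewrite normrM; rewrite !subr0 in ch.
apply: ler_pM; [exact: normr_ge0|by rewrite mulr_ge0| |by rewrite ler_wpM2l].
exact: (HC (x + c' *: ei k)).
Qed.

Lemma smooth_measurable phi s : smooth phi -> measurable_fun [set: V] (cpartials s phi).
Proof. by move=> sp; apply: continuous_measurable_rV; exact: (sp s).1. Qed.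

End test_functions.

(** * Mollifiers and distributional derivatives *)

Section mollifiers.
Context {R : realType} {d : nat}.
Local Notation lam := (@lebesgue_rV R d).
Local Notation V := 'rV[R]_d.
Implicit Types (f g H G phi K : V -> R) (k : 'I_d).

Lemma is_derive_eps (F : R -> R) (t D : R) :
  (forall e : R, 0 < e -> exists2 delta : R, 0 < delta &
     forall h : R, `|h| <= delta -> `|F (t + h) - F t - h * D| <= e * `|h|) ->
  is_derive t 1 F D.
Proof.
move=> HF.
have cv : h^-1 *: ((F \o shift t) (h *: (1 : R)) - F t) @[h --> 0^'] --> D.
  apply/cvgrPdist_le => e e0; have [delta d0 Hd] := HF e e0.
  near=> h.
  have h0 : h != 0 by near: h; exact: nbhs_dnbhs_neq.
  rewrite /= -[h *: 1]/(h * 1) mulr1 -[_ *: _]/(_ * _) [h + t]addrC.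
  have -> : D - h^-1 * (F (t + h) - F t) = - (h^-1 * (F (t + h) - F t - h * D)).
    by field.
  rewrite normrN normrM normfV ler_pdivrMl ?normr_gt0//.
  move: (Hd h) => {}Hd.
  have hd : `|h| <= delta by near: h; exact: dnbhs0_le.
  by have := Hd hd; rewrite [leRHS]mulrC.
apply: DeriveDef; first by apply/cvg_ex; exists D.
exact: cvg_lim.
Unshelve. all: by end_near. Qed.

Lemma measurable_test phi : test_function phi -> measurable_fun [set: V] phi.
Proof. by move=> [sp _]; exact: (smooth_measurable [::] sp). Qed.

Lemma L1_box (M : R) : L1 lam (\1_(box M : set V)).
Proof. by apply: L1_indic; [exact: measurable_box|exact: box_lty]. Qed.

(** Bounded measurable functions with compact support; a single pointwise
    inequality expresses both properties. *)
Definition bcs phi := measurable_fun [set: V] phi /\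
  exists C M, forall x, `|phi x| <= C * \1_(box M : set V) x.

Lemma bcs_L1 phi : bcs phi -> L1 lam phi.
Proof. by move=> [mp [C [M H]]]; exact: (L1_le mp (L1Z C (L1_box M)) H). Qed.

Lemma bcs_cpartials phi s : test_function phi -> bcs (cpartials s phi).
Proof.
move=> tp; split; first exact: (smooth_measurable s tp.1).
have [M M0 HM] := test_support tp; have [C C0 HC] := test_bound s tp.
exists C, M => x; rewrite indicE; have [bx|nx] := pselect (box M x).
  by rewrite mem_set// mulr1.
by rewrite HM// normr0 mulr_ge0.
Qed.

Lemma bcs_test phi : test_function phi -> bcs phi.
Proof. exact: (@bcs_cpartials phi [::]). Qed.

Lemma bcs_cpartial phi k : test_function phi -> bcs (cpartial k phi).
Proof. exact: (@bcs_cpartials phi [:: k]). Qed.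

(** The second-order remainder of a test function is supported in a slightly
    larger box, so it is integrable uniformly in h. *)
Lemma test_remainder phi k : test_function phi -> exists C M : R, 0 <= C /\
  forall x h, `|h| <= 1 ->
    `|phi (x + h *: ei k) - phi x - h * cpartial k phi x| <=
    C * h ^+ 2 * \1_(box M : set V) x.
Proof.
move=> tp; have [C C0 HC] := test_taylor k tp; have [M M0 HM] := test_support tp.
exists C, (M + 1); split => // x h h1.
rewrite indicE; have [bx|nx] := pselect (box (M + 1) x); first by rewrite mem_set// mulr1.
have E : phi (x + h *: ei k) = 0.
  apply: (HM [::]) => b; apply: nx => i; have := b i; rewrite eiE.
  case: (i == k); rewrite ?mulr1 ?mulr0 ?addr0 => bi; last by rewrite (le_trans bi)// lerDl.
  rewrite -[x ord0 i](addrK h) (le_trans (ler_normB _ _))// lerD//.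
have nx' : ~ box M x by move=> b; apply: nx; apply: box_le b; rewrite lerDl.
have E0 : phi x = 0 := HM [::] x nx'.
have E1 : cpartial k phi x = 0 := HM [:: k] x nx'.
by rewrite memNset// mulr0 E E0 E1 mulr0 !subr0 normr0.
Qed.

(** Mollifiers supported in the boxes of radius 1 / (n + 1). They are not
    normalised: their integrals are positive, which is enough for averages. *)
Definition rho n : V -> R := tensor (fun=> tent (n.+1%:R^-1 : R)).

Lemma rho_ge0 n x : 0 <= rho n x.
Proof. by apply: prodr_ge0 => i _; exact: tent_ge0. Qed.

Lemma rho_eq0 n x : ~ box (n.+1%:R^-1 : R) x -> rho n x = 0.
Proof.
move=> /existsNP[i xi]; rewrite /rho /tensor (bigD1 i)//= tent_eq0 ?mul0r//.
by rewrite ltNge; apply/negP.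
Qed.

Lemma rho_test n : test_function (rho n).
Proof.
apply: (test_tensor (M := n.+1%:R^-1)) => [i|i t]; first exact: Cinfty_tent.
exact: tent_eq0.
Qed.

Lemma rho_reflect_test n c : test_function (fun y => rho n (c - y)).
Proof.
rewrite (_ : (fun y => _) = tensor (fun i t => tent n.+1%:R^-1 (c ord0 i - t))).
  apply: (test_tensor (M := n.+1%:R^-1 + \sum_i `|c ord0 i|)) => [i m|i t Mt].
    exact/Ck_sub/Cinfty_tent.
  apply: tent_eq0; rewrite -[c ord0 i - t]opprB normrN.
  apply: (lt_le_trans _ (lerB_normD _ _)) => //.
  rewrite ltrBrDr normrN; apply: le_lt_trans Mt.
  by rewrite lerD2l (bigD1 i)//= lerDl sumr_ge0.
by apply/funext => y; apply: eq_bigr => i _; rewrite !mxE.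
Qed.

Lemma cpartial_reflect f k c y : smooth f ->
  cpartial k (fun y => f (c - y)) y = - cpartial k f (c - y).
Proof.
move=> sf; apply: derive_val.
have E := is_derive_line (fun y => f (c - y)) y (ei k) 0.
move: E; rewrite scale0r addr0 => E; apply/E => {E}.
have h := smooth_line [::] k (c - y) (0 - 0) sf.
rewrite [X in is_derive _ _ _ (- X)](_ : _ = cpartials [:: k] f (c - y + (0 - 0) *: ei k)); last first.
  by rewrite subrr scale0r addr0.
have := is_derive_sub h.
rewrite (_ : (fun t : R => f (c - y + (0 - t) *: ei k)) = (fun t : R => f (c - (y + t *: ei k))))//.
by apply/funext => t; rewrite sub0r scaleNr opprD addrA.
Qed.

Lemma L1_rho n : L1 lam (rho n).
Proof. exact: bcs_L1 (bcs_test (rho_test n)). Qed.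

Lemma I_rho_gt0 n : 0 < \int[lam]_x rho n x.
Proof.
pose a : R := n.+1%:R^-1; have a0 : 0 < a by rewrite invr_gt0.
set b := expR (- (a / 2)^-1) ^+ 2; have b0 : 0 < b by rewrite exprn_gt0// expR_gt0.
have a2 : 0 <= a / 2 by rewrite divr_ge0// ltW.
have bd : 0 < b ^+ d * (2 * (a / 2)) ^+ d by rewrite mulr_gt0// exprn_gt0// mulr_gt0// divr_gt0.
apply: (lt_le_trans bd).
have -> : b ^+ d * (2 * (a / 2)) ^+ d = \int[lam]_x (b ^+ d * \1_(box (a / 2) : set V) x).
  rewrite (IZ _ (L1_box _)); congr (_ * _).
  have mb : measurable (box (a / 2) : set V) := measurable_box _.
  transitivity (fine (lam (box (a / 2)))); first by rewrite lebesgue_box.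
  by rewrite /Rintegral; congr fine; rewrite (integral_indic lam measurableT mb) setIT.
apply: (I_le (L1Z _ (L1_box _)) (L1_rho n)) => x.
rewrite indicE; have [|] := boolP (x \in _); last by rewrite mulr0 rho_ge0.
rewrite inE mulr1 => bx.
have -> : b ^+ d = \prod_(i < d) b by rewrite prodr_const card_ord.
by apply: ler_prod => i _; rewrite (ltW b0) tent_gt0.
Qed.

Lemma rho_approx n H (h0 e delta : R) : BM H -> n.+1%:R^-1 <= delta ->
  (forall w, box delta w -> `|H w - h0| <= e) ->
  `|\int[lam]_w (rho n w * H w) - (\int[lam]_w rho n w) * h0| <= e * \int[lam]_w rho n w.
Proof.
move=> bH nd He.
have l1 := L1_BM (L1_rho n) bH.
have l2 := L1Z h0 (L1_rho n).
rewrite [X in _ - X]mulrC -(IZ h0 (L1_rho n)) -(IB l1 l2) -(IZ e (L1_rho n)).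
apply: (I_norm_le (L1B l1 l2) (L1Z e (L1_rho n))) => w.
rewrite [h0 * _]mulrC -mulrBr normrM (ger0_norm (rho_ge0 n w)) mulrC.
have [bw|nw] := pselect (box n.+1%:R^-1 w).
  by rewrite ler_wpM2r ?rho_ge0// He//; exact: box_le bw.
by rewrite rho_eq0// !mulr0.
Qed.

(** Uniform continuity with respect to translations of the argument. *)
Definition UC H := forall e : R, 0 < e -> exists2 delta : R, 0 < delta &
  forall y, box delta y -> forall w, `|H (w + y) - H w| <= e.

(** Differentiability in direction k, uniformly with respect to the point. The
    sign is that of translations: differentiating in z the pairing of a fixed
    function with f (. - z) gives minus its pairing with (d_k f) (. - z). *)
Definition UD k H G := forall e : R, 0 < e -> exists2 delta : R, 0 < delta &
  forall w h, `|h| <= delta -> `|H (w + h *: ei k) - H w + h * G w| <= e * `|h|.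

Lemma UD_is_derive k H G w (t : R) : UD k H G ->
  is_derive t 1 (fun t : R => H (w + t *: ei k)) (- G (w + t *: ei k)).
Proof.
move=> ud; apply: is_derive_eps => e e0; have [delta d0 Hd] := ud e e0.
exists delta => // h hd.
by rewrite scalerDl addrA mulrN opprK; exact: Hd.
Qed.

Lemma UD_mvt k H G w (a b : R) : UD k H G -> exists2 c, `|c - a| <= `|b - a| &
  H (w + b *: ei k) - H (w + a *: ei k) = - G (w + c *: ei k) * (b - a).
Proof.
move=> ud; have [c ca E] := mvt_abs (fun t => UD_is_derive w t ud) a b.
by exists c.
Qed.

(** A function whose distributional derivative is a uniformly continuous
    function is classically differentiable. The averages of H against a
    translate of a mollifier are differentiable in the translation, with
    derivatives the averages of G; the mean value theorem applied to them and
    a limit give the claim, so it suffices to test against translates of the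
    mollifiers. *)
Lemma weak_UD k H G : BM H -> BM G -> UC H -> UC G ->
  (forall n c, \int[lam]_w (cpartial k (rho n) (w - c) * H w) =
               \int[lam]_w (rho n (w - c) * G w)) ->
  UD k H G.
Proof.
move=> bH bG uH uG W.
have mH := bH.1; have [CH HCH] := bH.2.
have BMs (F : V -> R) (c : V) : BM F -> BM (fun w : V => F (w + c)).
  by move=> [mF [C HC]]; split; [exact: measurable_shiftD|exists C].
pose J n (w : V) (t : R) := \int[lam]_v (rho n (v - (w + t *: ei k)) * H v).
have JE n w (t : R) : is_derive t 1 (J n w) (- \int[lam]_v (rho n (v - (w + t *: ei k)) * G v)).
  rewrite -W.
  have [C [M [C0 HC]]] := test_remainder k (rho_test n).
  have CH0 : 0 <= CH by apply: le_trans (HCH 0).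
  pose B : R := C * CH * \int[lam]_v (\1_(box M : set V) v).
  have B0 : 0 <= B by rewrite mulr_ge0 ?mulr_ge0// I_ge0.
  apply: is_derive_eps => e e0; exists (Num.min 1 (e / (B + 1))).
    by rewrite lt_min ltr01 divr_gt0// ltr_wpDl.
  move=> h; rewrite le_min => /andP[h1 he].
  have L s : L1 lam (fun v => rho n (v - (w + s *: ei k)) * H v).
    exact: L1_BM (L1_shift _ (L1_rho n)) bH.
  have LD : L1 lam (fun v => cpartial k (rho n) (v - (w + t *: ei k)) * H v).
    by apply: L1_BM bH; apply: L1_shift; exact: bcs_L1 (bcs_cpartial k (rho_test n)).
  rewrite mulrN opprK /J -(IB (L (t + h)) (L t)) -(IZ _ LD) -(ID (L1B (L (t + h)) (L t)) (L1Z h LD)).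
  have lb := L1_shift (w + t *: ei k) (L1_box M).
  apply: (@le_trans _ _ (\int[lam]_v ((C * CH * h ^+ 2) * \1_(box M : set V) (v - (w + t *: ei k))))).
    apply: (I_norm_le (L1D (L1B (L (t + h)) (L t)) (L1Z h LD)) (L1Z _ lb)) => v.
    set x := v - (w + t *: ei k).
    have -> : v - (w + (t + h) *: ei k) = x + (- h) *: ei k.
      by rewrite /x scalerDl scaleNr addrA opprD addrA.
    have := HC x (- h); rewrite normrN => /(_ h1) Hx.
    rewrite mulrA -mulrBl -mulrDl normrM.
    rewrite mulNr opprK sqrrN in Hx.
    apply: (@le_trans _ _ (C * h ^+ 2 * \1_(box M : set V) x * CH)).
      by apply: ler_pM => //; exact: HCH.
    by rewrite le_eqVlt; apply/predU1l; ring.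
  rewrite (IZ _ lb) (I_shift _ (L1_measurable (L1_box M))).
  have -> : C * CH * h ^+ 2 * \int[lam]_v \1_(box M : set V) v = B * h ^+ 2 by rewrite /B; ring.
  rewrite -[h ^+ 2]ger0_norm ?sqr_ge0// normrX expr2 mulrA ler_wpM2r//.
  apply: (@le_trans _ _ (B * (e / (B + 1)))); first by rewrite ler_wpM2l.
  by rewrite mulrA ler_pdivrMr ?ltr_wpDl// mulrC ler_wpM2l ?(ltW e0)// lerDl.
have Jshift n w t : J n w t = \int[lam]_v (rho n v * H (v + (w + t *: ei k))).
  rewrite /J -(I_shiftD (w + t *: ei k)).
    by apply: I_ext => v; rewrite addrK.
  by apply: measurable_funM => //; apply: measurable_shift; exact: (L1_measurable (L1_rho n)).
have Kshift n w t : \int[lam]_v (rho n (v - (w + t *: ei k)) * G v) =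
    \int[lam]_v (rho n v * G (v + (w + t *: ei k))).
  rewrite -(I_shiftD (w + t *: ei k)).
    by apply: I_ext => v; rewrite addrK.
  apply: measurable_funM; last exact: bG.1.
  by apply: measurable_shift; exact: (L1_measurable (L1_rho n)).
move=> e e0; have [delta d0 Hd] := uG e e0.
have d2 : 0 < delta / 2 by rewrite divr_gt0.
exists (delta / 2) => // w h hd.
apply/ler_addgt0Pl => e' e'0.
have e2 : 0 < e' / 2 by rewrite divr_gt0.
have [delta' d'0 Hd'] := uH _ e2.
have dm : 0 < Num.min (delta / 2) delta' by rewrite lt_min d2.
have [N /(_ N (leqnn N)) /ltW] := invSn_lt dm; rewrite le_min => /andP[Nd Nd'].
have In0 := I_rho_gt0 N.
have [c] := mvt_abs (JE N w) 0 h; rewrite !subr0 => ch E.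
have A1 := @rho_approx N (fun v => H (v + (w + h *: ei k))) (H (w + h *: ei k)) (e' / 2) delta' (BMs _ _ bH) Nd'.
have A2 := @rho_approx N (fun v => H (v + (w + 0 *: ei k))) (H (w + 0 *: ei k)) (e' / 2) delta' (BMs _ _ bH) Nd'.
have A3 := @rho_approx N (fun v => G (v + (w + c *: ei k))) (G w) e (delta / 2) (BMs _ _ bG) Nd.
rewrite -Jshift in A1; rewrite -Jshift in A2; rewrite -Kshift in A3.
have near0 c1 v : box delta' v -> `|H (v + c1) - H c1| <= e' / 2.
  by move=> bv; rewrite [v + c1]addrC; exact: Hd'.
have {}A1 := A1 (near0 _).
have {}A2 := A2 (near0 _).
have {}A3 : `|\int[lam]_v (rho N (v - (w + c *: ei k)) * G v) - \int[lam]_v rho N v * G w| <= e * \int[lam]_v rho N v.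
  apply: A3 => v bv; rewrite addrCA; apply: Hd => i; rewrite eiE.
  rewrite (le_trans (ler_normD _ _))// [leRHS]splitr lerD//.
  apply: le_trans (le_trans ch hd); case: (i == k); rewrite ?mulr1 ?mulr0 ?normr0//.
rewrite scale0r addr0 in A2.
move: E A1 A2 A3 In0.
move: (J N w h) (J N w 0) (\int[lam]_v (rho N (v - (w + c *: ei k)) * G v)) (\int[lam]_w rho N w).
move: (H (w + h *: ei k)) (H w) (G w) => Hh H0 G0 j1 j0 k0 I0 E A1 A2 A3 Ip.
rewrite -(ler_pM2r Ip) -[X in _ * X <= _](gtr0_norm Ip) -normrM.
have -> : (Hh - H0 + h * G0) * I0 = - (j1 - I0 * Hh) + (j0 - I0 * H0) - h * (k0 - I0 * G0).
  by rewrite -[j1](subrK j0) E; ring.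
apply: (le_trans (ler_normB _ _)); rewrite normrM mulrDl; apply: lerD.
  apply: (le_trans (ler_normD _ _)); rewrite normrN [leRHS](_ : _ = e' / 2 * I0 + e' / 2 * I0); last by field.
  exact: lerD.
by rewrite mulrAC [leRHS]mulrC ler_wpM2l.
Qed.

End mollifiers.

(** * Weak derivatives *)

Section weak_derivative_theory.
Context {R : realType} {d : nat}.
Local Notation lam := (@lebesgue_rV R d).
Local Notation V := 'rV[R]_d.
Implicit Types (f g F H G phi psi K : V -> R) (k i : 'I_d).

Lemma sign_abs (c : R) : (if 0 <= c then 1 else -1) * c = `|c|.
Proof.
have [h|h] := leP 0 c; first by rewrite mul1r ger0_norm.
by rewrite mulN1r ltr0_norm.
Qed.

Lemma pairing_L1 psi f (C : R) : measurable_fun [set: V] psi -> measurable_fun [set: V] f ->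
  (forall z, \int[lam]_x `|psi x * f (x - z)|%:E <= C%:E)%E ->
  forall z, L1 lam (fun x => psi x * f (x - z)).
Proof.
move=> mpsi mf HC z; apply: L1_lty; last exact: le_lt_trans (HC z) (ltry _).
by apply: measurable_funM => //; exact: measurable_shift.
Qed.

(** [convol_swap] with w multiplied by the sign of w times the convolution. *)
Lemma convol_abs K (w g : V -> R) (C : R) : L1 lam K ->
  measurable_fun [set: V] w -> measurable_fun [set: V] g ->
  (forall z, \int[lam]_x `|w x * g (x - z)|%:E <= C%:E)%E ->
  (\int[lam]_x `|w x * convol K g x|%:E <= (\int[lam]_z (`|K z| * C))%:E)%E.
Proof.
move=> lK mw mg HC; have mK := L1_measurable lK.
have mc := measurable_convol mK mg.
pose sg x : R := if 0 <= w x * convol K g x then 1 else -1.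
have msg : measurable_fun [set: V] sg.
  by apply: measurable_fun_ifT => //; apply: measurable_fun_ler => //; exact: measurable_funM.
have nsg x : `|sg x| = 1 by rewrite /sg; case: ifP; rewrite ?normrN normr1.
have mw' : measurable_fun [set: V] (fun x => sg x * w x) by exact: measurable_funM.
have HC' z : (\int[lam]_x `|sg x * w x * g (x - z)|%:E <= C%:E)%E.
  have := HC z; rewrite (_ : (fun x => `|sg x * w x * g (x - z)|%:E) = (fun x => `|w x * g (x - z)|%:E))//.
  by apply/funext => x; rewrite -mulrA normrM nsg mul1r.
have [l1 l2 E] := convol_swap lK mw' mg HC'.
apply: (@le_trans _ _ (\int[lam]_x (sg x * w x * convol K g x)%:E)%E).
  rewrite le_eqVlt; apply/predU1l; apply: eq_integral => x _.
  by congr EFin; rewrite -mulrA; exact/esym/sign_abs.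
rewrite -(I_EFin l1) E lee_fin; apply: (le_trans (ler_norm _)).
have lKC : L1 lam (fun z => `|K z| * C).
  by apply: (L1_ext _ (L1Z C (L1_norm lK))) => z; rewrite mulrC.
apply: (I_norm_le l2 lKC) => z; rewrite normrM; apply: ler_wpM2l; first exact: normr_ge0.
have lz := pairing_L1 mw' mg HC' z.
apply: (le_trans (I_norm_le lz (L1_norm lz) (fun x => lexx _))).
by rewrite -lee_fin (I_abs_EFin lz); exact: HC'.
Qed.

Lemma box_cover (x : V) : exists n : nat, box (n%:R : R) x.
Proof.
exists (Num.truncn (\sum_i `|x ord0 i|)).+1 => i.
have := truncnS_gt (\sum_i `|x ord0 i|); move=> /ltW; apply: le_trans.
by rewrite (bigD1 i)//= lerDl sumr_ge0.
Qed.

Lemma locally_integrable_box f (M : R) : locally_integrable_rV f ->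
  L1 lam (fun x => f x * \1_(box M : set V) x).
Proof.
move=> [mf lf]; have mb := @measurable_box R d M.
apply: L1_lty; first by apply: measurable_funM => //; exact: measurable_indic.
have := lf _ (@compact_box_rV R d M); rewrite [in X in X -> _]integral_mkcond.
congr (_ < _)%E; apply: eq_integral => x _.
rewrite patchE indicE normrM; case: (x \in _) => /=; first by rewrite normr1 mulr1.
by rewrite normr0 mulr0.
Qed.

(** Boxes are cofinal among compact sets. *)
Lemma locint_of_box f : measurable_fun [set: V] f ->
  (forall M : R, L1 lam (fun x => f x * \1_(box M : set V) x)) -> locally_integrable_rV f.
Proof.
move=> mf lf; split=> // K cK.
have [M KM] := compact_box cK.
have mK : measurable K.
  rewrite -[K]setCK; apply: measurableC; apply: open_measurable_rV.
  by rewrite openC; apply: compact_closed cK; exact: norm_hausdorff.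
apply: le_lt_trans (L1_abs_lty (lf M)).
have mb := @measurable_box R d M.
apply: (@le_trans _ _ (\int[lam]_(x in box M) `|f x|%:E)%E).
  apply: ge0_subset_integral => //.
  by apply/measurable_EFinP; apply: measurable_funTS; exact: measurableT_comp.
rewrite le_eqVlt; apply/predU1l; rewrite [LHS]integral_mkcond.
apply: eq_integral => x _.
rewrite patchE indicE normrM; case: (x \in _) => /=; first by rewrite normr1 mulr1.
by rewrite normr0 mulr0.
Qed.

Lemma L1_locint_bcs f phi : locally_integrable_rV f -> bcs phi ->
  L1 lam (fun x => f x * phi x).
Proof.
move=> lf [mp [C [M HC]]].
apply: (@L1_le _ _ _ _ _ (fun x => `|C| * `|f x * \1_(box M : set V) x|)).
- by apply: measurable_funM mp; exact: lf.1.
- exact: (L1Z _ (L1_norm (locally_integrable_box M lf))).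
- move=> x; rewrite !normrM mulrCA ler_wpM2l//.
  apply: (le_trans (HC x)); rewrite (le_trans (ler_norm _))// normrM//.
Qed.

Lemma locintB f g : locally_integrable_rV f -> locally_integrable_rV g ->
  locally_integrable_rV (fun x => f x - g x).
Proof.
move=> lf lg; apply: locint_of_box.
  by apply: measurable_funB; [exact: lf.1|exact: lg.1].
move=> M; apply: (L1_ext _ (L1B (locally_integrable_box M lf) (locally_integrable_box M lg))) => x.
by rewrite -mulrBl.
Qed.

Lemma ae_boxes (P : V -> Prop) :
  (forall n : nat, \forall x \ae lam, box (n%:R : R) x -> P x) -> \forall x \ae lam, P x.
Proof.
move=> /ae_foralln; apply: filterS => x Hx.
by have [n bn] := box_cover x; exact: Hx bn.
Qed.

(** The fundamental lemma of the calculus of variations. With psi the sign of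
    F on a box, the integral of psi (x) F (x - w) over x is a continuous
    function of w at 0 (continuity of translations in L^1), and its averages
    against mollifiers are, by Fubini's theorem, averages of integrals of F
    against test functions, hence 0. Its value at 0 is the integral of |F| on
    the box. *)
Lemma du_bois_reymond F : locally_integrable_rV F ->
  (forall phi, test_function phi -> \int[lam]_x (F x * phi x) = 0) ->
  \forall x \ae lam, F x = 0.
Proof.
move=> lF HF; have mF := lF.1; apply: ae_boxes => n; set M : R := n%:R.
(* the value at 0 is 1, so that |sg| = 1 everywhere *)
pose sg x : R := if 0 <= F x then 1 else -1.
have sgF x : sg x * F x = `|F x|.
  exact: sign_abs.
have nsg x : `|sg x| = 1 by rewrite /sg; case: ifP; rewrite ?normrN normr1.
have mb M' := @measurable_box R d M'.
have mi M' : measurable_fun [set: V] (\1_(box M' : set V) : V -> R) by exact: measurable_indic.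
have msg : measurable_fun [set: V] sg.
  by apply: measurable_fun_ifT => //; exact: measurable_fun_ler.
pose psi x := sg x * \1_(box M : set V) x.
have mpsi : measurable_fun [set: V] psi by exact: measurable_funM.
have npsi x : `|psi x| <= 1.
  by rewrite /psi normrM nsg mul1r indicE; case: (_ \in _); rewrite ?normr1 ?normr0.
have Bpsi : BM psi by split => //; exists 1.
(* translations by vectors of norm at most 1 of the box of radius M stay in
   that of radius M + 1 *)
pose F' x := F x * \1_(box (M + 1) : set V) x.
have lF' : L1 lam F' by exact: locally_integrable_box.
have mF' := L1_measurable lF'.
pose H w := \int[lam]_x (psi x * F' (x - w)).
have lH w : L1 lam (fun x => psi x * F' (x - w)).
  by apply: (L1_ext _ (L1_BM (L1_shift w lF') Bpsi)) => x; rewrite mulrC.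
have lF'1 : Lx 1%:E F'.
  apply/(Lx_poweR _ ltr01); split => //.
  by apply: (L1_ext _ (L1_norm lF')) => x; rewrite powRr1.
have Hcont (e : R) : 0 < e -> exists2 delta, 0 < delta &
    forall w, box delta w -> `|H w - H 0| <= e.
  move=> e0; have [delta d0 Hd] := vanish_omega (lexx 1) lF'1 e0.
  exists delta => // w bw; rewrite /H -(IB (lH w) (lH 0)).
  apply: le_trans (Hd _ bw).
  have lD : L1 lam (fun x => `|F' x - F' (x - w)|).
    by apply: L1_norm; exact: (L1B lF' (L1_shift w lF')).
  have -> : omega 1 F' w = \int[lam]_x `|F' x - F' (x - w)|.
    have := nrm_powR ltr01 (Lx_diff (lexx 1) w lF'1).
    rewrite powRr1 ?nrm_ge0// /omega => ->; apply: I_ext => x; exact: powRr1.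
  apply: (I_norm_le (L1B (lH w) (lH 0)) lD) => x.
  rewrite subr0 -mulrBr normrM distrC.
  by rewrite -[leRHS]mul1r ler_wpM2r.
have BH : BM H.
  split.
    apply: (@measurable_param _ _ V V R lam (fun p : V * V => psi p.2 * F' (p.2 - p.1))).
    apply: measurable_funM; first exact: (measurableT_comp mpsi).
    by apply: (measurableT_comp mF'); exact: measurable_subrV.
  exists (\int[lam]_x `|F' x|) => w.
  rewrite -(I_shift w (L1_measurable (L1_norm lF'))).
  apply: (I_norm_le (lH w) (L1_shift w (L1_norm lF'))) => x.
  by rewrite normrM -[leRHS]mul1r ler_wpM2r.
have rho0 m : \int[lam]_w (rho m w * H w) = 0.
  have hb z : (\int[lam]_x `|psi x * F' (x - z)|%:E <= (\int[lam]_x `|F' x|)%:E)%E.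
    rewrite -(I_abs_EFin (lH z)) lee_fin -(I_shift z (L1_measurable (L1_norm lF'))).
    apply: (I_le (L1_norm (lH z)) (L1_shift z (L1_norm lF'))) => x.
    by rewrite normrM -[leRHS]mul1r ler_wpM2r.
  have [_ _ <-] := convol_swap (L1_rho m) mpsi mF' hb.
  rewrite -[RHS](I0 lam); apply: I_ext => x.
  have [bx|nx] := pselect (box M x); last by rewrite /psi indicE memNset// mulr0 mul0r.
  rewrite [X in _ * X](_ : _ = 0) ?mulr0// /convol.
  rewrite -(HF _ (rho_reflect_test m x)) -[RHS](I_reflect x).
    apply: I_ext => z; rewrite opprB addrCA subrr addr0 mulrC /F' indicE.
    have [bz|nz] := pselect (box (m.+1%:R^-1 : R) z).
      rewrite mem_set ?mulr1// => i.
      have -> : (x - z) ord0 i = x ord0 i - z ord0 i by rewrite !mxE.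
      rewrite (le_trans (ler_normB _ _))// lerD//.
      by rewrite (le_trans (bz i))// invf_le1// ler1n.
    by rewrite (rho_eq0 nz) !mulr0.
  by apply: measurable_funM mF _; exact: measurable_test (rho_reflect_test m x).
have H00 : H 0 = 0.
  apply/eqP; rewrite -normr_eq0 eq_le normr_ge0 andbT; apply/ler_addgt0Pl => e e0; rewrite addr0.
  have [delta d0 Hd] := Hcont e e0.
  have [N /(_ N (leqnn N)) /ltW Nd] := invSn_lt d0.
  have := rho_approx BH Nd Hd; rewrite rho0 sub0r normrN normrM.
  have I0 := I_rho_gt0 (R := R) (d := d) N.
  by rewrite (gtr0_norm I0) mulrC ler_pM2r.
have mFM : measurable_fun [set: V] (fun x => F x * \1_(box M : set V) x) by exact: measurable_funM.
have : (\int[lam]_x `|(F x * \1_(box M : set V) x)%:E| = 0)%E.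
  rewrite -(I_abs_EFin (locally_integrable_box M lF)); apply: (congr1 EFin); rewrite -[RHS]H00.
  apply: I_ext => x; rewrite subr0 /psi /F' !indicE.
  have [bx|nx] := pselect (box M x); last by rewrite memNset// !(mulr0, mul0r) normr0.
  rewrite !mem_set ?mulr1 ?sgF//; apply: box_le bx; by rewrite lerDl.
move/(ae_eq_integral_abs _ measurableT); rewrite -/(EFin \o _) => /(_ (measurable_fine_EFin mFM)).
apply: filterS => x /(_ I) [] /=; rewrite indicE => E bx; move: E.
by rewrite mem_set// mulr1.
Qed.

(** Uniqueness up to null sets is what allows [weak_partial], which chooses an
    arbitrary representative, to be computed. *)
Lemma weak_partial_uniq i f f' g g' : is_weak_partial i f g -> is_weak_partial i f' g' ->
  (\forall x \ae lam, f x = f' x) -> \forall x \ae lam, g x = g' x.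
Proof.
move=> [lf lg W] [lf' lg' W'] ff'.
have bphi phi (tp : test_function phi) := (bcs_test tp, bcs_cpartial i tp).
have : \forall x \ae lam, g x - g' x = 0.
  apply: (du_bois_reymond (locintB lg lg')) => phi tp.
  have [b1 b2] := bphi _ tp.
  have l1 := L1_locint_bcs lg b1; have l1' := L1_locint_bcs lg' b1.
  have -> : \int[lam]_x ((g x - g' x) * phi x) = \int[lam]_x (g x * phi x - g' x * phi x).
    by apply: I_ext => x; rewrite mulrBl.
  rewrite (IB l1 l1') -[\int[lam]_x (g x * _)]opprK -[\int[lam]_x (g' x * _)]opprK -W// -W'//.
  rewrite opprK addrC; apply/eqP; rewrite subr_eq0; apply/eqP.
  apply: I_ae.
  - exact: L1_measurable (L1_locint_bcs lf' b2).
  - exact: L1_measurable (L1_locint_bcs lf b2).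
  - by apply: filterS ff' => x ->.
by apply: filterS => x /eqP; rewrite subr_eq0 => /eqP.
Qed.

Lemma is_weak_partial_ae i f f' g : is_weak_partial i f g ->
  measurable_fun [set: V] f' -> (\forall x \ae lam, f x = f' x) -> is_weak_partial i f' g.
Proof.
move=> [lf lg W] mf' ff'.
have lf' : locally_integrable_rV f'.
  apply: locint_of_box => // M.
  have mi : measurable_fun [set: V] (\1_(box M : set V) : V -> R).
    by apply: measurable_indic; exact: measurable_box.
  apply: (L1_ae (measurable_funM mf' mi) (locally_integrable_box M lf)).
  by apply: filterS ff' => x /= ->.
split=> // phi tp; rewrite -W//; apply: I_ae.
- exact: L1_measurable (L1_locint_bcs lf' (bcs_cpartial i tp)).
- exact: L1_measurable (L1_locint_bcs lf (bcs_cpartial i tp)).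
- by apply: filterS ff' => x ->.
Qed.

Lemma weak_partialP i f : weakly_differentiable i f -> is_weak_partial i f (weak_partial i f).
Proof. by move=> [g wg]; exact: (xgetPex (cst 0) (ex_intro _ g wg)). Qed.

Lemma weak_partial_ae i f f' g : is_weak_partial i f g ->
  measurable_fun [set: V] f' -> (\forall x \ae lam, f x = f' x) ->
  measurable_fun [set: V] (weak_partial i f') /\ \forall x \ae lam, g x = weak_partial i f' x.
Proof.
move=> wf mf' ff'; have wf' := is_weak_partial_ae wf mf' ff'.
have w := weak_partialP (ex_intro _ g wf').
split; first by case: w => _ [].
by apply: (weak_partial_uniq wf' w); exact: nearW.
Qed.

(** The functions whose integrals over the translates of a box are bounded.
    This class contains every L^p with p finite and is stable under
    convolution with an integrable kernel, so it contains the heat evolutions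
    of the functions considered. *)
Definition ulocal f := measurable_fun [set: V] f /\
  forall M : R, exists C : R, forall z,
    (\int[lam]_x `|\1_(box M : set V) x * f (x - z)|%:E <= C%:E)%E.

Lemma ulocal_bcs f phi : ulocal f -> bcs phi -> exists C : R, forall z,
  (\int[lam]_x `|phi x * f (x - z)|%:E <= C%:E)%E.
Proof.
move=> [mf uf] [mphi [C [M HC]]]; have [D HD] := uf M.
have mi : measurable_fun [set: V] (\1_(box M : set V) : V -> R).
  by apply: measurable_indic; exact: measurable_box.
exists (`|C| * D) => z.
apply: (@le_trans _ _ (\int[lam]_x (`|C|%:E * `|\1_(box M : set V) x * f (x - z)|%:E))%E).
  apply: ge0_le_integral => //.
  - apply/measurable_EFinP; apply: measurableT_comp => //.
    by apply: measurable_funM => //; exact: measurable_shift.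
  - under eq_fun do rewrite -EFinM.
    apply/measurable_EFinP; apply: measurable_funM => //; apply: measurableT_comp => //.
    by apply: measurable_funM => //; exact: measurable_shift.
  - move=> x _; rewrite -EFinM lee_fin !normrM mulrA ler_wpM2r// (le_trans (HC x))//.
    by rewrite -normrM ler_norm.
rewrite ge0_integralZl_EFin//; last first.
  apply/measurable_EFinP; apply: measurableT_comp => //.
  by apply: measurable_funM => //; exact: measurable_shift.
by rewrite EFinM lee_wpmul2l.
Qed.

Lemma ulocal_L1 f phi z : ulocal f -> bcs phi -> L1 lam (fun x => phi x * f (x - z)).
Proof.
move=> uf bphi; have [C HC] := ulocal_bcs uf bphi.
apply: L1_lty; last exact: le_lt_trans (HC z) (ltry _).
by apply: measurable_funM; [exact: bphi.1|apply: measurable_shift; exact: uf.1].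
Qed.

Lemma ulocal_bcs_R f phi : ulocal f -> bcs phi -> exists2 C : R, 0 <= C & forall z,
  \int[lam]_x `|phi x * f (x - z)| <= C.
Proof.
move=> uf bphi; have [C HC] := ulocal_bcs uf bphi.
have H z : \int[lam]_x `|phi x * f (x - z)| <= C.
  by rewrite -lee_fin (I_abs_EFin (ulocal_L1 z uf bphi)).
by exists C => //; apply: le_trans (H 0); rewrite I_ge0.
Qed.

Lemma bcs_box (M : R) : bcs (\1_(box M : set V)).
Proof.
split; first by apply: measurable_indic; exact: measurable_box.
by exists 1, M => x; rewrite mul1r ger0_norm// indicE.
Qed.

Lemma ulocal_locint f : ulocal f -> locally_integrable_rV f.
Proof.
move=> uf; apply: locint_of_box => [|M]; first exact: uf.1.
by apply: (L1_ext _ (ulocal_L1 0 uf (bcs_box M))) => x; rewrite subr0 mulrC.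
Qed.

Lemma ulocal_convol K f : L1 lam K -> ulocal f -> ulocal (convol K f).
Proof.
move=> lK uf; have mf := uf.1; split; first exact: (measurable_convol (L1_measurable lK) mf).
move=> M; have bM := bcs_box M; have [C C0 HC] := ulocal_bcs_R uf bM.
exists (\int[lam]_y (`|K y| * C)) => z.
have HC' y : (\int[lam]_x `|\1_(box M : set V) x * f (x - y - z)|%:E <= C%:E)%E.
  under eq_integral do rewrite -addrA -opprD.
  by rewrite -(I_abs_EFin (ulocal_L1 _ uf bM)) lee_fin.
apply: le_trans (convol_abs lK bM.1 (measurable_shift z mf) HC').
rewrite le_eqVlt; apply/predU1l; apply: eq_integral => x _.
have -> // : convol K (fun x => f (x - z)) x = convol K f (x - z).
by apply: I_ext => y; rewrite addrAC.
Qed.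

End weak_derivative_theory.

(** * Integration by parts against kernels *)

Section kernels.
Context {R : realType} {d : nat}.
Local Notation lam := (@lebesgue_rV R d).
Local Notation V := 'rV[R]_d.
Implicit Types (f g F H G phi psi K : V -> R) (k i : 'I_d).

Lemma ulocal_Lx (p : R) f : 1 <= p -> Lx p%:E f -> ulocal f.
Proof.
move=> p1 lf; have p0 : 0 < p by exact: lt_le_trans ltr01 p1.
have [mf lfp] := (Lx_poweR f p0).1 lf; split=> // M.
have bM := @bcs_box R d M; have lM := bcs_L1 bM.
exists (\int[lam]_x (\1_(box M : set V) x + `|f x| `^ p)) => z.
have l1 := L1D lM (L1_shift z lfp).
apply: (@le_trans _ _ (\int[lam]_x (\1_(box M : set V) x + `|f (x - z)| `^ p)%:E)%E).
  apply: ge0_le_integral => //.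
  - apply/measurable_EFinP; apply: measurableT_comp => //.
    by apply: measurable_funM; [exact: bM.1|exact: measurable_shift].
  - by apply/measurable_EFinP; exact: L1_measurable l1.
  - move=> x _; rewrite lee_fin normrM indicE; have [bx|_] := boolP (x \in _); last first.
      by rewrite normr0 mul0r add0r powR_ge0.
    rewrite normr1 mul1r; have [f1|f1] := leP 1 `|f (x - z)|.
      by rewrite (le_trans (le1r_powR f1 p1))// lerDr.
    by rewrite (le_trans (ltW f1))// lerDl powR_ge0.
rewrite -(I_EFin l1) lee_fin (ID lM (L1_shift z lfp)) (ID lM lfp) lerD2l.
by rewrite (I_shift z (L1_measurable lfp)).
Qed.

Lemma pairing_BM psi f (C : R) : measurable_fun [set: V] psi -> measurable_fun [set: V] f ->
  (forall z, \int[lam]_x `|psi x * f (x - z)|%:E <= C%:E)%E ->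
  BM (fun z : V => \int[lam]_x (psi x * f (x - z))).
Proof.
move=> mpsi mf HC; have lp := pairing_L1 mpsi mf HC; split.
  apply: (@measurable_param _ _ V V R lam (fun p : V * V => psi p.2 * f (p.2 - p.1))).
  apply: measurable_funM; first exact: (measurableT_comp mpsi).
  by apply: (measurableT_comp mf); exact: measurable_subrV.
exists C => z; apply: (le_trans (I_norm_le (lp z) (L1_norm (lp z)) (fun x => lexx _))).
by rewrite -lee_fin (I_abs_EFin (lp z)).
Qed.

(** A weak derivative turns into a classical derivative once it is paired with
    translates, provided that the pairings are uniformly continuous: by
    Fubini's theorem the hypothesis of [weak_UD] is the definition of the weak
    derivative tested against x - c - z. *)
Lemma UD_pairing k f g psi (C D : R) : is_weak_partial k f g ->
  measurable_fun [set: V] psi ->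
  (forall z, \int[lam]_x `|psi x * f (x - z)|%:E <= C%:E)%E ->
  (forall z, \int[lam]_x `|psi x * g (x - z)|%:E <= D%:E)%E ->
  UC (fun z => \int[lam]_x (psi x * f (x - z))) ->
  UC (fun z => \int[lam]_x (psi x * g (x - z))) ->
  UD k (fun z => \int[lam]_x (psi x * f (x - z))) (fun z => \int[lam]_x (psi x * g (x - z))).
Proof.
move=> [lf lg W] mpsi HC HD uH uG; have mf := lf.1; have mg := lg.1.
apply: (weak_UD (pairing_BM mpsi mf HC) (pairing_BM mpsi mg HD) uH uG).
move=> n c.
have tr := rho_test (R := R) (d := d) n.
have l1 := L1_shift c (bcs_L1 (bcs_cpartial k tr)).
have l2 := L1_shift c (L1_rho (R := R) (d := d) n).
have [_ _ <-] := convol_swap l1 mpsi mf HC.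
have [_ _ <-] := convol_swap l2 mpsi mg HD.
apply: I_ext => x; apply: (congr1 (fun y => psi x * y)).
have sh z : x - c - (x - z) = z - c by rewrite opprB [LHS]addrC addrA subrK.
have tp := rho_reflect_test n (x - c).
have := W _ tp; have sr := tr.1.
have -> : \int[lam]_y (f y * cpartial k (fun z => rho n (x - c - z)) y) =
    \int[lam]_y (- (cpartial k (rho n) (x - c - y) * f y)).
  by apply: I_ext => y; rewrite cpartial_reflect// mulrN mulrC.
have L : L1 lam (fun y => cpartial k (rho n) (x - c - y) * f y).
  apply: (L1_ext _ (L1N (L1_locint_bcs lf (bcs_cpartial k tp)))) => y.
  by rewrite cpartial_reflect// mulrN opprK mulrC.
rewrite (IN L) => /eqP; rewrite eqr_opp => /eqP E.
have mc : measurable_fun [set: V] (cpartial k (rho n)) := (bcs_cpartial k tr).1.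
transitivity (\int[lam]_y (cpartial k (rho n) (x - c - y) * f y)).
  rewrite /convol -(I_reflect x (g := fun y => cpartial k (rho n) (x - c - y) * f y)).
    by apply: I_ext => z; rewrite sh.
  exact: L1_measurable L.
rewrite E /convol -(I_reflect x).
  by apply: I_ext => z; rewrite sh mulrC.
by apply: measurable_funM => //; exact: (measurable_test tp).
Qed.

(** Classical differentiability of an integrable kernel, with a local
    domination of the derivative that makes difference quotients converge in
    L^1. *)
Definition kder k K K' := [/\ L1 lam K, measurable_fun [set: V] K',
  (forall z (t : R), is_derive t 1 (fun t : R => K (z + t *: ei k)) (K' (z + t *: ei k))) &
  exists2 E, L1 lam E & forall z (t : R), `|t| <= 1 -> `|K' (z + t *: ei k)| <= E z].

Lemma kder_L1 k K K' : kder k K K' -> L1 lam K'.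
Proof.
move=> [lK mK' _ [E lE HE]]; apply: (L1_le mK' lE) => z.
by have := HE z 0; rewrite normr0 ler01 scale0r addr0; apply.
Qed.

(** Both sides are limits of integrals of difference quotients, which
    translation invariance moves from one factor to the other. *)
Lemma kernel_IBP k K K' phi psi : kder k K K' -> BM phi -> BM psi -> UD k phi psi ->
  \int[lam]_z (K z * psi z) = \int[lam]_z (K' z * phi z).
Proof.
move=> dK Bphi Bpsi ud; have lK' := kder_L1 dK; case: dK => lK mK' DK [E lE HE].
have mK := L1_measurable lK; have mphi := Bphi.1.
have [C HC] := Bphi.2; have [D HD] := Bpsi.2.
have C0 : 0 <= C by exact: le_trans (HC 0).
pose h (n : nat) : R := n.+1%:R^-1.
have h0 n : 0 < h n by rewrite invr_gt0.
have h1 n : h n <= 1 by rewrite invf_le1// ler1n.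
pose q n z := (h n)^-1 * (K (z + (- h n) *: ei k) - K z).
have mq n : measurable_fun [set: V] (q n).
  apply: measurable_funM => //; apply: measurable_funB => //; exact: measurable_shiftD.
have cA : (\int[lam]_z (q n z * phi z)) @[n --> \oo] --> \int[lam]_z (- (K' z * phi z)).
  apply: (I_dct (G := fun z => C * E z)).
  - by move=> n; exact: measurable_funM.
  - by apply: measurable_funN; apply: measurable_funM.
  - exact: L1Z.
  - move=> n z; rewrite normrM mulrC; apply: ler_pM => //.
    have [c] := mvt_abs (DK z) 0 (- h n).
    rewrite !subr0 scale0r addr0 normrN (gtr0_norm (h0 n)) => ch E1.
    rewrite /q E1 normrM normrM normrN normfV (gtr0_norm (h0 n)) mulrC -mulrA divff ?gt_eqF//.
    by rewrite mulr1 HE// (le_trans ch).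
  - move=> z; rewrite -mulNr; apply: cvgM; last exact: cvg_cst.
    have := DK z 0; rewrite scale0r addr0 => -[dv ev].
    have := dv; rewrite /derivable => /cvg_ex[l Hl].
    have lE' : l = K' z by rewrite -ev /derive; apply/esym; exact: cvg_lim Hl.
    have hn : (fun n => - h n) n @[n --> \oo] --> (0 : R).
      rewrite -oppr0; apply: cvgN; exact: cvg_harmonic.
    have hne n : - h n != 0 by rewrite oppr_eq0 gt_eqF.
    have /cvgr_dnbhsP/(_ (fun n => - h n) (conj hne hn)) := Hl; rewrite lE'.
    move=> /cvgN; apply: cvg_trans; apply: near_eq_cvg; near=> n.
    rewrite /q fctE /= scale0r !addr0 -[(- h n)%:A]/(- h n * 1) mulr1 -[_ *: (_ - _)]/(_ * _).
    by rewrite invrN mulNr opprK.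
pose p n z := (h n)^-1 * (phi (z + h n *: ei k) - phi z).
have mp n : measurable_fun [set: V] (p n).
  apply: measurable_funM => //; apply: measurable_funB => //; exact: measurable_shiftD.
have cB : (\int[lam]_z (K z * p n z)) @[n --> \oo] --> \int[lam]_z (K z * - psi z).
  apply: (I_dct (G := fun z => D * `|K z|)).
  - by move=> n; exact: measurable_funM.
  - by apply: measurable_funM => //; apply: measurable_funN; exact: Bpsi.1.
  - exact: L1Z (L1_norm lK).
  - move=> n z; rewrite normrM mulrC; apply: ler_pM => //.
    have [c _ E1] := UD_mvt z 0 (h n) ud.
    rewrite subr0 scale0r addr0 in E1.
    rewrite /p E1 normrM normrM normrN normfV (gtr0_norm (h0 n)) mulrC -mulrA divff ?gt_eqF//.
    by rewrite mulr1 HD.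
  - move=> z; apply: cvgM; first exact: cvg_cst.
    apply/cvgrPdist_le => e e0; have [delta d0 Hd] := ud e e0.
    have [N HN] := invSn_lt d0.
    exists N => // n /= Nn; have := Hd z (h n); rewrite (gtr0_norm (h0 n)) => /(_ (ltW (HN n Nn))) Hn.
    have -> : - psi z - p n z = - ((h n)^-1 * (phi (z + h n *: ei k) - phi z + h n * psi z)).
      by rewrite /p; field; rewrite gt_eqF.
    by rewrite normrN normrM normfV (gtr0_norm (h0 n)) ler_pdivrMl// [leRHS]mulrC.
(* discrete integration by parts *)
have AB n : \int[lam]_z (q n z * phi z) = \int[lam]_z (K z * p n z).
  have l1 : L1 lam (fun z : V => K (z - h n *: ei k) * phi z) := L1_BM (L1_shift _ lK) Bphi.
  have l2 : L1 lam (fun z => K z * phi z) := L1_BM lK Bphi.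
  have Bs : BM (fun z : V => phi (z + h n *: ei k)).
    by split; [exact: measurable_shiftD|exists C].
  have l3 : L1 lam (fun z : V => K z * phi (z + h n *: ei k)) := L1_BM lK Bs.
  transitivity ((h n)^-1 * (\int[lam]_z (K (z - h n *: ei k) * phi z) - \int[lam]_z (K z * phi z))).
    rewrite -(IB l1 l2) -(IZ _ (L1B l1 l2)); apply: I_ext => z.
    by rewrite /q scaleNr -mulrBl mulrA.
  rewrite -(I_shiftD (h n *: ei k) (L1_measurable l1)).
  have -> : \int[lam]_z (K (z + h n *: ei k - h n *: ei k) * phi (z + h n *: ei k)) =
      \int[lam]_z (K z * phi (z + h n *: ei k)) by apply: I_ext => z; rewrite addrK.
  rewrite -(IB l3 l2) -(IZ _ (L1B l3 l2)); apply: I_ext => z.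
  by rewrite /p -mulrBr mulrCA.
have E1 : \int[lam]_z (- (K' z * phi z)) = \int[lam]_z (K z * - psi z).
  move: cA; under eq_fun do rewrite AB; move=> cA.
  exact: (cvg_unique (@norm_hausdorff _ R) cA cB).
move: E1; rewrite (IN (L1_BM lK' Bphi)).
rewrite (_ : \int[lam]_z (K z * - psi z) = \int[lam]_z (- (K z * psi z))); last by apply: I_ext => z; rewrite mulrN.
by rewrite (IN (L1_BM lK Bpsi)) => /eqP; rewrite eqr_opp => /eqP.
Unshelve. all: by end_near. Qed.

(** By Fubini's theorem, testing the convolution against phi is integrating K
    against the pairing of phi with translates of f, which is differentiable
    because phi is; then integration by parts. *)
Lemma convol_weak_partial k K K' f : kder k K K' -> ulocal f ->
  is_weak_partial k (convol K f) (convol K' f).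
Proof.
move=> dK uf; have lK : L1 lam K by case: dK.
have lK' := kder_L1 dK; have mf := uf.1.
split; [exact: ulocal_locint (ulocal_convol lK uf)|exact: ulocal_locint (ulocal_convol lK' uf)|].
move=> phi tp; have b0 := bcs_test tp; have b1 := bcs_cpartial k tp.
have [C0 HC0] := ulocal_bcs uf b0; have [C1 HC1] := ulocal_bcs uf b1.
pose h z := \int[lam]_x (phi x * f (x - z)).
pose g z := \int[lam]_x (cpartial k phi x * f (x - z)).
have Bh : BM h := pairing_BM b0.1 mf HC0.
have Bg : BM g := pairing_BM b1.1 mf HC1.
have ud : UD k h (fun z => - g z).
  have [C [M [Cp HC]]] := test_remainder k tp.
  have [D Dp HD] := ulocal_bcs_R uf (bcs_box M).
  have CD : 0 <= C * D by rewrite mulr_ge0.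
  move=> e e0; exists (Num.min 1 (e / (C * D + 1))).
    by rewrite lt_min ltr01 divr_gt0// ltr_wpDl.
  move=> z t; rewrite le_min => /andP[t1 te].
  have Ls s : L1 lam (fun x => phi (x + s *: ei k) * f (x - z)).
    apply: (L1_ext _ (L1_shiftD (s *: ei k) (ulocal_L1 (z + s *: ei k) uf b0))) => x /=.
    by rewrite opprD addrACA subrr addr0.
  have L0 := ulocal_L1 z uf b0; have Lg := ulocal_L1 z uf b1.
  have lb := ulocal_L1 z uf (bcs_box M).
  have -> : h (z + t *: ei k) = \int[lam]_x (phi (x + t *: ei k) * f (x - z)).
    rewrite /h -(I_shiftD (t *: ei k) (L1_measurable (ulocal_L1 (z + t *: ei k) uf b0))).
    by apply: I_ext => x; rewrite opprD addrACA subrr addr0.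
  rewrite mulrN /h /g -(IB (Ls t) L0) -(IZ t Lg) -(IB (L1B (Ls t) L0) (L1Z t Lg)).
  apply: (@le_trans _ _ (\int[lam]_x ((C * t ^+ 2) * `|\1_(box M : set V) x * f (x - z)|))).
    apply: (I_norm_le (L1B (L1B (Ls t) L0) (L1Z t Lg)) (L1Z _ (L1_norm lb))) => x.
    rewrite mulrA -!mulrBl !normrM mulrA; apply: ler_wpM2r; first exact: normr_ge0.
    have -> : `|\1_(box M : set V) x : R| = \1_(box M : set V) x by rewrite ger0_norm// indicE.
    exact: HC.
  rewrite (IZ _ (L1_norm lb)).
  apply: (@le_trans _ _ (C * t ^+ 2 * D)).
    by apply: ler_wpM2l (HD z); rewrite mulr_ge0// sqr_ge0.
  have -> : C * t ^+ 2 * D = C * D * t ^+ 2 by ring.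
  rewrite -[t ^+ 2]ger0_norm ?sqr_ge0// normrX expr2 mulrA; apply: ler_wpM2r => //.
  apply: (@le_trans _ _ (C * D * (e / (C * D + 1)))); first by apply: ler_wpM2l.
  by rewrite mulrA ler_pdivrMr ?ltr_wpDl// mulrC ler_wpM2l ?(ltW e0)// lerDl.
have [_ _ E1] := convol_swap lK b1.1 mf HC1.
have [_ _ E0] := convol_swap lK' b0.1 mf HC0.
transitivity (\int[lam]_x (cpartial k phi x * convol K f x)).
  by apply: I_ext => x; rewrite mulrC.
transitivity (- \int[lam]_x (phi x * convol K' f x)); last first.
  by apply: (congr1 -%R); apply: I_ext => x; rewrite mulrC.
rewrite E1 E0 -(kernel_IBP dK Bh (BM_N Bg) ud) -(IN (L1_BM lK (BM_N Bg))).
by apply: I_ext => z; rewrite mulrN opprK.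
Qed.

End kernels.

(** * Gaussian kernels *)

Lemma scaleRE (R : realType) (x y : R) : x *: (y : R^o) = x * y. Proof. by []. Qed.

Section gaussian.
Context {R : realType} {d : nat}.
Local Notation lam := (@lebesgue_rV R d).
Local Notation V := 'rV[R]_d.
Implicit Types (z : V) (i j k : 'I_d) (al : R).

Definition sqn z : R := \sum_(i < d) (z ord0 i) ^+ 2.
Definition l1n z : R := \sum_(i < d) `|z ord0 i|.

Lemma sqn_ge0 z : 0 <= sqn z. Proof. by apply: sumr_ge0 => i _; exact: sqr_ge0. Qed.
Lemma l1n_ge0 z : 0 <= l1n z. Proof. by apply: sumr_ge0 => i _. Qed.

Lemma coord_l1n z i : `|z ord0 i| <= l1n z.
Proof. by rewrite /l1n (bigD1 i)//= lerDl sumr_ge0. Qed.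

Lemma l1n_le z z' : (forall i, `|z ord0 i| <= `|z' ord0 i|) -> l1n z <= l1n z'.
Proof. by move=> H; apply: ler_sum => i _. Qed.

Lemma sqn_line z k (t : R) : sqn (z + t *: ei k) = sqn z + 2 * t * z ord0 k + t ^+ 2.
Proof.
rewrite /sqn (bigD1 k)//= [in RHS](bigD1 k)//= eiE eqxx mulr1.
rewrite (eq_bigr (fun i => (z ord0 i) ^+ 2)); first by ring.
by move=> i /negbTE ik; rewrite eiE ik mulr0 addr0.
Qed.

Lemma sqr_coord_sqn z k : (z ord0 k) ^+ 2 <= sqn z.
Proof. by rewrite /sqn (bigD1 k)//= lerDl sumr_ge0// => i _; exact: sqr_ge0. Qed.

(** The Cauchy-Schwarz inequality, through 2 |z_i| |z_j| <= z_i^2 + z_j^2. *)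
Lemma l1n_sqn z : (l1n z) ^+ 2 <= d%:R * sqn z.
Proof.
rewrite expr2 /l1n mulr_suml.
apply: (@le_trans _ _ (\sum_(i < d) \sum_(j < d) (((z ord0 i) ^+ 2 + (z ord0 j) ^+ 2) / 2))).
  apply: ler_sum => i _; rewrite mulr_sumr; apply: ler_sum => j _.
  rewrite -[(z ord0 i) ^+ 2]real_normK ?num_real// -[(z ord0 j) ^+ 2]real_normK ?num_real//.
  move: `|z ord0 i| `|z ord0 j| => a b.
  have := sqr_ge0 (a - b); rewrite sqrrB; lra.
have -> : \sum_(i < d) \sum_(j < d) (((z ord0 i) ^+ 2 + (z ord0 j) ^+ 2) / 2) =
   \sum_(i < d) (d%:R * (z ord0 i) ^+ 2 + sqn z) / 2.
  apply: eq_bigr => i _; rewrite -mulr_suml; congr (_ / 2).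
  by rewrite big_split/= sumr_const card_ord mulr_natl.
rewrite -mulr_suml big_split/= -mulr_sumr -/(sqn z) sumr_const card_ord -[X in _ + X]mulr_natl.
by rewrite le_eqVlt; apply/predU1l; field.
Qed.

Lemma measurable_sqn : measurable_fun [set: V] sqn.
Proof.
by apply: measurable_sum => i; apply: measurable_funX; exact: measurable_coord_id.
Qed.

Local Notation p := (@heat_kernel R d).

Lemma heat_kernelE al z : p al z = (4 * pi * al) `^ (- (d%:R / 2)) * expR (- (sqn z) / (4 * al)).
Proof. by []. Qed.

Lemma heat_kernel_ge0 al z : 0 <= p al z.
Proof. by rewrite heat_kernelE mulr_ge0 ?powR_ge0 ?expR_ge0. Qed.

Lemma heat_kernel_even al z : p al (- z) = p al z.
Proof.
rewrite !heat_kernelE; have -> // : sqn (- z) = sqn z.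
by apply: eq_bigr => i _; rewrite mxE sqrrN.
Qed.

Lemma measurable_heat_kernel al : measurable_fun [set: V] (p al).
Proof.
apply: measurable_funM => //; apply: measurableT_comp => //.
by apply: measurable_funM => //; apply: measurable_funN; exact: measurable_sqn.
Qed.

(** The heat kernel is the product of the densities of centred normal laws of
    variance 2 al. *)
Lemma integral_heat_kernel al : 0 < al -> (\int[lam]_z (p al z)%:E = 1)%E.
Proof.
move=> al0; pose s := Num.sqrt (2 * al).
have a2 : 0 < 2 * al by rewrite mulr_gt0.
have s0 : s != 0 by rewrite gt_eqF// sqrtr_gt0.
have s2 : s ^+ 2 = 2 * al by rewrite sqr_sqrtr// ltW.
have b0 : 0 <= 4 * pi * al by rewrite mulr_ge0 ?(ltW al0)// mulr_ge0// pi_ge0.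
transitivity (\int[lam]_z (\prod_(i < d) normal_pdf 0 s (z ord0 i))%:E)%E.
  apply: eq_integral => z _; congr EFin.
  rewrite normal_pdfE// big_split/= prodr_const card_ord heat_kernelE; congr (_ * _).
    rewrite (_ : - (d%:R / 2) = - (2^-1) * d%:R); last by rewrite mulNr mulrC.
    rewrite powRrM powR_mulrn ?powR_ge0//; congr (_ ^+ _).
    rewrite powRN powR12_sqrt// /normal_peak s2; congr (Num.sqrt _)^-1; ring.
  rewrite -expR_sum; congr expR.
  rewrite /sqn -sumrN mulr_suml; apply: eq_bigr => i _.
  by rewrite s2 subr0; congr (_ / _); ring.
have := @integral_prod_rV R d (fun=> normal_pdf 0 s) (fun=> 1).
rewrite big1// => ->// i.
- exact: measurable_normal_pdf.
- exact: normal_pdf_ge0.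
- exact: integral_normal_pdf.
Qed.

Lemma L1_heat_kernel al : 0 < al -> L1 lam (p al).
Proof.
move=> al0; apply: L1_lty; first exact: measurable_heat_kernel.
under eq_integral do rewrite ger0_norm ?heat_kernel_ge0//.
by rewrite integral_heat_kernel// ltry.
Qed.

Lemma I_heat_kernel al : 0 < al -> \int[lam]_z p al z = 1.
Proof. by move=> al0; rewrite /Rintegral integral_heat_kernel. Qed.

(** The dimensional constant of all the Gaussian bounds; it is locked since
    its value does not matter. *)
Definition cG : R := locked (2 `^ (d%:R / 2) * (8 * d%:R + 1) ^+ 3 * 6).

Lemma cG_ge0 : 0 <= cG.
Proof. by rewrite /cG -lock !mulr_ge0 ?powR_ge0// exprn_ge0// addr_ge0// mulr_ge0. Qed.

(** Powers of the variable are absorbed by doubling the time: p_al is 2^(d/2)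
    exp (- X) p_(2 al) with X = |z|^2 / (8 al), and X^n exp (- X) <= n!. *)
Lemma l1n_heat_kernel al z (n : nat) : 0 < al -> (n <= 3)%N ->
  (l1n z ^+ 2) ^+ n * p al z <= cG * al ^+ n * p (2 * al) z.
Proof.
move=> al0 n3; pose X := sqn z / (8 * al).
have a8 : 0 < 8 * al by rewrite mulr_gt0.
have X0 : 0 <= X by rewrite divr_ge0 ?sqn_ge0// ltW.
have pE : p al z = 2 `^ (d%:R / 2) * expR (- X) * p (2 * al) z.
  rewrite !heat_kernelE.
  have -> : 4 * pi * (2 * al) = 2 * (4 * pi * al) by ring.
  rewrite (powRM _ (x := 2))//; last by rewrite mulr_ge0 ?(ltW al0)// mulr_ge0// pi_ge0.
  have -> : expR (- sqn z / (4 * al)) = expR (- X) * expR (- sqn z / (4 * (2 * al))).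
    by rewrite -expRD; congr expR; rewrite /X; field; rewrite gt_eqF.
  have -> : (2 : R) `^ (- (d%:R / 2)) = (2 `^ (d%:R / 2))^-1 by rewrite powRN.
  have : (2 : R) `^ (d%:R / 2) != 0 by rewrite gt_eqF// powR_gt0.
  move: (2 `^ (d%:R / 2)) (expR (- X)) (expR _) ((4 * pi * al) `^ _) => a b e f a0.
  by field.
have N2 : l1n z ^+ 2 <= (8 * d%:R) * al * X.
  apply: (le_trans (l1n_sqn z)); rewrite /X le_eqVlt; apply/predU1l.
  by field; rewrite gt_eqF.
have Xn : X ^+ n * expR (- X) <= n`!%:R.
  rewrite expRN ler_pdivrMr ?expR_gt0//; case: n {n3} => [|n].
    by rewrite expr0 mul1r -expR0 ler_expR.
  have := expR_ge1Dxn n X0; have f0 : (0 : R) < n.+1`!%:R by rewrite ltr0n fact_gt0.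
  by move=> h; rewrite -ler_pdivrMl// mulrC (le_trans _ h)// lerDr.
have f6 : (n`!%:R : R) <= 6.
  by case: n n3 {Xn} => [|[|[|[|n]]]]//= _; rewrite ler_nat.
have d3 : (8 * d%:R) ^+ n <= (8 * d%:R + 1 : R) ^+ 3.
  apply: (@le_trans _ _ ((8 * d%:R + 1) ^+ n)).
    by apply: lerXn2r; rewrite ?nnegrE ?lerDl// ?addr_ge0// mulr_ge0.
  by apply: ler_weXn2l => //; rewrite lerDr mulr_ge0.
rewrite pE /cG -lock.
have D0 : 0 <= 8 * d%:R :> R by rewrite mulr_ge0.
have N0 : 0 <= l1n z ^+ 2 by exact: sqr_ge0.
move: (p (2 * al) z) (heat_kernel_ge0 (2 * al) z) (powR_ge0 (2 : R) (d%:R / 2)) (expR_ge0 (- X)) X0 N2 Xn d3 D0 N0.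
clear pE; clearbody X; move: (2 `^ (d%:R / 2)) (expR (- X)) (l1n z ^+ 2) (8 * d%:R) ((_ + 1) ^+ 3) => c e N D M P P0 c0 e0 X0 N2 Xn d3 D0 N0.
have -> : N ^+ n * (c * e * P) = N ^+ n * (c * e) * P by rewrite mulrA.
apply: ler_wpM2r => //.
have -> : c * M * 6 * al ^+ n = (c * al ^+ n) * (M * 6) by ring.
apply: (@le_trans _ _ ((D * al * X) ^+ n * (c * e))).
  by apply: ler_wpM2r; [exact: mulr_ge0|apply: lerXn2r; rewrite ?nnegrE// !mulr_ge0// ltW].
have -> : (D * al * X) ^+ n * (c * e) = (c * al ^+ n) * (D ^+ n * (X ^+ n * e)).
  by rewrite !exprMn; ring.
apply: ler_wpM2l; first by rewrite mulr_ge0// exprn_ge0// ltW.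
apply: ler_pM => //; first exact: exprn_ge0.
- by rewrite mulr_ge0// exprn_ge0.
- exact: le_trans Xn f6.
Qed.

(** Bounds the kernel near a point by an integrable function of that point,
    with - (z_k + 2 t)^2 <= 0 absorbing the cross term. *)
Lemma heat_kernel_line al z k (t : R) : 0 < al -> `|t| <= 1 ->
  p al (z + t *: ei k) <= 2 `^ (d%:R / 2) * expR ((4 * al)^-1) * p (2 * al) z.
Proof.
move=> al0 t1; rewrite !heat_kernelE.
have -> : 4 * pi * (2 * al) = 2 * (4 * pi * al) by ring.
rewrite (powRM _ (x := 2))//; last by rewrite mulr_ge0 ?(ltW al0)// mulr_ge0// pi_ge0.
have -> : (2 : R) `^ (- (d%:R / 2)) = (2 `^ (d%:R / 2))^-1 by rewrite powRN.
have a0 : (0 : R) < 2 `^ (d%:R / 2) by rewrite powR_gt0.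
have E : expR (- sqn (z + t *: ei k) / (4 * al)) <= expR ((4 * al)^-1) * expR (- sqn z / (4 * (2 * al))).
  rewrite -expRD ler_expR sqn_line.
  have -> : (4 * al)^-1 + - sqn z / (4 * (2 * al)) = (2 - sqn z) / (8 * al) by field; rewrite gt_eqF.
  have -> : - (sqn z + 2 * t * z ord0 k + t ^+ 2) / (4 * al) =
    (- 2 * (sqn z + 2 * t * z ord0 k + t ^+ 2)) / (8 * al) by field; rewrite gt_eqF.
  rewrite ler_pM2r; last by rewrite invr_gt0 mulr_gt0.
  have h1 := sqr_coord_sqn z k.
  have h2 : t ^+ 2 <= 1 by rewrite -[t ^+ 2]real_normK ?num_real// expr_le1.
  have h3 := sqr_ge0 (z ord0 k + 2 * t).
  have e3 : (z ord0 k + 2 * t) ^+ 2 = z ord0 k ^+ 2 + 4 * (t * z ord0 k) + 4 * t ^+ 2 by ring.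
  rewrite e3 in h3; rewrite -mulrA.
  move: h1 h2 h3; move: (z ord0 k ^+ 2) (t * z ord0 k) (t ^+ 2) (sqn z) => a b c e h1 h2 h3; lra.
move: E a0; move: (2 `^ (d%:R / 2)) (expR _) (expR _) (expR _) ((4 * pi * al) `^ _) (powR_ge0 (4 * pi * al) (- (d%:R / 2))) => a b e f c c0 E a0.
have -> : a * e * (a^-1 * c * b) = c * (e * b) by field; rewrite gt_eqF.
by rewrite ler_wpM2l.
Qed.

Section derivatives.
Variables (al : R) (al0 : 0 < al).
Let b : R := (2 * al)^-1.

(** The first, second and third partial derivatives of the heat kernel are
    [p1], [p2] and [p3]. *)
Definition p1 j z := - b * z ord0 j * p al z.
Definition p2 i j z := (b ^+ 2 * z ord0 i * z ord0 j - b * (i == j)%:R) * p al z.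
Definition p3 k i j z := (- b ^+ 3 * z ord0 k * z ord0 i * z ord0 j +
  b ^+ 2 * ((k == i)%:R * z ord0 j + (k == j)%:R * z ord0 i + (i == j)%:R * z ord0 k)) * p al z.

(** The identity that makes the commutator with the Laplacian the second-order
    term of the expansion of the commutator with the semigroup. *)
Lemma p3E k i j z : 2 * al * p3 k i j z =
  - (z ord0 k * p2 i j z + (k == i)%:R * p1 j z + (k == j)%:R * p1 i z).
Proof. by rewrite /p3 /p2 /p1 /b; field; rewrite gt_eqF. Qed.

Lemma p2_even i j z : p2 i j (- z) = p2 i j z.
Proof. by rewrite /p2 heat_kernel_even !mxE; ring. Qed.

Lemma heat_kernel_is_derive k z (t : R) :
  is_derive t 1 (fun t => p al (z + t *: ei k)) (p1 k (z + t *: ei k)).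
Proof.
have E : (fun t => p al (z + t *: ei k)) = (fun t : R => (4 * pi * al) `^ (- (d%:R / 2)) *
    expR (- (sqn z + 2 * t * z ord0 k + t ^+ 2) / (4 * al))).
  by apply/funext => s; rewrite heat_kernelE sqn_line.
rewrite E.
have D : is_derive t 1 (fun t : R => - (sqn z + 2 * t * z ord0 k + t ^+ 2) / (4 * al))
    (- (2 * z ord0 k + 2 * t) / (4 * al)).
  have D1 : is_derive t 1 (fun t : R => - (sqn z + 2 * t * z ord0 k + t ^+ 2)) (- (2 * z ord0 k + 2 * t)).
    apply: is_deriveN.
    have := is_deriveD (is_deriveD (is_derive_cst (sqn z) t (1 : R))
      (is_deriveM (is_derive_cst (2 * z ord0 k) t (1 : R)) (is_derive_id t (1 : R)))) (is_deriveX 2 (is_derive_id t (1 : R))).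
    rewrite (_ : (_ + _ : R -> R) = (fun t => sqn z + 2 * t * z ord0 k + t ^+ 2)); last first.
      by apply/funext => s; rewrite !fctE /=; ring.
    move=> H; apply: (is_derive_eq H).
    by rewrite !scaleRE !fctE /=; ring.
  have := is_deriveM D1 (is_derive_cst ((4 * al)^-1) t (1 : R)).
  move=> H; apply: (is_derive_eq H).
  by rewrite !scaleRE !fctE /=; ring.
have DE := @is_derive1_comp R expR _ t _ _ (is_derive_expR _) D.
have DM := is_deriveM (is_derive_cst ((4 * pi * al) `^ (- (d%:R / 2))) t (1 : R)) DE.
apply: (is_derive_eq DM); rewrite scaler0 addr0 -[_ *: _]/(_ * _).
rewrite /p1 heat_kernelE sqn_line eiE eqxx mulr1 /b /=.
by move: (expR _) ((4 * pi * al) `^ _) => x y; field; rewrite gt_eqF.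
Qed.

Lemma weighted_is_derive (P P' : V -> R) k z (t : R) :
  is_derive t 1 (fun t => P (z + t *: ei k)) (P' (z + t *: ei k)) ->
  is_derive t 1 (fun t => P (z + t *: ei k) * p al (z + t *: ei k))
    ((P' (z + t *: ei k) - b * (z + t *: ei k) ord0 k * P (z + t *: ei k)) * p al (z + t *: ei k)).
Proof.
move=> D; have H := is_deriveM D (heat_kernel_is_derive k z t).
apply: (is_derive_eq H); rewrite !scaleRE /p1.
by move: (p al _) (P _) (P' _) (_ ord0 k) => x y w v; ring.
Qed.

Lemma coord_is_derive j k z (t : R) :
  is_derive t 1 (fun t : R => (z + t *: ei k) ord0 j) (j == k)%:R.
Proof.
have -> : (fun t : R => (z + t *: ei k) ord0 j) = (fun t : R => z ord0 j + t * (j == k)%:R).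
  by apply/funext => s; rewrite eiE.
have H := is_deriveD (is_derive_cst (z ord0 j) t (1 : R))
  (is_deriveM (is_derive_id t (1 : R)) (is_derive_cst ((j == k)%:R : R) t (1 : R))).
apply: (is_derive_eq H).
by rewrite !scaleRE /=; ring.
Qed.

Lemma p1_is_derive j k z (t : R) :
  is_derive t 1 (fun t => p1 j (z + t *: ei k)) (p2 k j (z + t *: ei k)).
Proof.
have D := is_deriveM (is_derive_cst (- b) t (1 : R)) (coord_is_derive j k z t).
have D1 : is_derive t 1 (fun t : R => - b * (z + t *: ei k) ord0 j) (- b * (j == k)%:R).
  by apply: (is_derive_eq D); rewrite !scaleRE /=; ring.
have := @weighted_is_derive (fun y => - b * y ord0 j) (fun=> - b * (j == k)%:R) k z t D1.
move=> H; apply: (is_derive_eq H).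
rewrite /p2 [k == j]eq_sym.
by move: (p al _) (_ ord0 k) (_ ord0 j) => x y w; ring.
Qed.

Lemma p2_is_derive i j k z (t : R) :
  is_derive t 1 (fun t => p2 i j (z + t *: ei k)) (p3 k i j (z + t *: ei k)).
Proof.
have D0 := is_deriveM (coord_is_derive i k z t) (coord_is_derive j k z t).
have D := is_deriveB (is_deriveM (is_derive_cst (b ^+ 2) t (1 : R)) D0) (is_derive_cst (b * (i == j)%:R) t (1 : R)).
pose P' (y : V) := b ^+ 2 * ((i == k)%:R * y ord0 j + y ord0 i * (j == k)%:R).
have D1 : is_derive t 1 (fun t : R => b ^+ 2 * (z + t *: ei k) ord0 i * (z + t *: ei k) ord0 j - b * (i == j)%:R)
    (P' (z + t *: ei k)).
  have -> : (fun t : R => b ^+ 2 * (z + t *: ei k) ord0 i * (z + t *: ei k) ord0 j - b * (i == j)%:R) =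
    (cst (b ^+ 2) * ((fun t : R => (z + t *: ei k) ord0 i) * (fun t : R => (z + t *: ei k) ord0 j)) - cst (b * (i == j)%:R)).
    by apply/funext => s; rewrite !fctE /= mulrA.
  by apply: (is_derive_eq D); rewrite !scaleRE /P' !fctE /=; ring.
have := @weighted_is_derive (fun y => b ^+ 2 * y ord0 i * y ord0 j - b * (i == j)%:R) P' k z t D1.
move=> H; apply: (is_derive_eq H).
rewrite /p3 /P' ![k == _]eq_sym.
by move: (p al _) (_ ord0 k) (_ ord0 j) (_ ord0 i) => x y w v; ring.
Qed.

Local Notation P := (p (2 * al)).
Let P_ge0 z : 0 <= P z. Proof. exact: heat_kernel_ge0. Qed.
Let b0 : 0 < b. Proof. by rewrite invr_gt0 mulr_gt0. Qed.
Let NP z n : (n <= 3)%N -> (l1n z ^+ 2) ^+ n * p al z <= cG * al ^+ n * P z.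
Proof. exact: l1n_heat_kernel. Qed.

Lemma p0_le z : p al z <= cG * P z.
Proof. by have := NP z (isT : (0 <= 3)%N); rewrite !expr0 mul1r mulr1. Qed.

Lemma p0_le2 z : l1n z ^+ 2 * p al z <= cG * al * P z.
Proof. by have := NP z (isT : (1 <= 3)%N); rewrite !expr1. Qed.

Lemma p0_le4 z : l1n z ^+ 4 * p al z <= cG * al ^+ 2 * P z.
Proof. by have := NP z (isT : (2 <= 3)%N); rewrite -exprM. Qed.

Lemma p1_le j z : `|p1 j z| * l1n z <= cG * P z.
Proof.
have h := p0_le2 z; have zj := coord_l1n z j; have N0 := l1n_ge0 z.
apply: (@le_trans _ _ (b * (l1n z ^+ 2 * p al z))).
  rewrite /p1; move: (p al z) (heat_kernel_ge0 al z) => x x0.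
  have -> : `|- b * z ord0 j * x| = b * `|z ord0 j| * x.
    by rewrite normrM normrM normrN (gtr0_norm b0) (ger0_norm x0).
  rewrite -!mulrA; apply: ler_wpM2l; first exact: ltW.
  by rewrite [x * _]mulrC; apply: ler_wpM2r => //; rewrite mulr_ge0.
apply: (@le_trans _ _ (b * (cG * al * P z))); first by rewrite ler_wpM2l// ltW.
rewrite (_ : _ * _ = (cG * P z) / 2); last by rewrite /b; field; rewrite gt_eqF.
have X0 : 0 <= cG * P z by rewrite mulr_ge0 ?cG_ge0.
by move: (cG * P z) X0 => X X0; lra.
Qed.

(** With N the l^1 norm, al |p2| N^(2 n) <= (N^(2 n + 2) / (4 al) + N^(2 n) /
    2) p. *)
Lemma p2_le i j z (n : nat) : (n <= 2)%N ->
  al * `|p2 i j z| * (l1n z ^+ 2) ^+ n <= cG * al ^+ n * P z.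
Proof.
move=> n2.
have h1 := NP z (n2 : (n.+1 <= 3)%N); have h0 := NP z (leqW n2).
have zi := coord_l1n z i; have zj := coord_l1n z j.
have N0 := l1n_ge0 z; have p0 := heat_kernel_ge0 al z.
have A : `|p2 i j z| <= (b ^+ 2 * l1n z ^+ 2 + b) * p al z.
  rewrite /p2 normrM (ger0_norm p0); apply: ler_wpM2r => //.
  apply: (le_trans (ler_normB _ _)); apply: lerD.
    rewrite -mulrA normrM [`|z ord0 i * _|]normrM (ger0_norm (sqr_ge0 b)).
    apply: ler_wpM2l; first exact: sqr_ge0.
    by rewrite expr2; apply: ler_pM.
  rewrite normrM (gtr0_norm b0) ler_piMr// ?(ltW b0)//.
  by case: (i == j); rewrite ?normr1 ?normr0.
apply: (@le_trans _ _ (al * ((b ^+ 2 * l1n z ^+ 2 + b) * p al z) * (l1n z ^+ 2) ^+ n)).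
  apply: ler_wpM2r; first by rewrite exprn_ge0// sqr_ge0.
  by rewrite ler_wpM2l// ltW.
have -> : al * ((b ^+ 2 * l1n z ^+ 2 + b) * p al z) * (l1n z ^+ 2) ^+ n =
  (4 * al)^-1 * ((l1n z ^+ 2) ^+ n.+1 * p al z) + 2^-1 * ((l1n z ^+ 2) ^+ n * p al z).
  by rewrite [(l1n z ^+ 2) ^+ n.+1]exprS /b; move: (p al z) (l1n z ^+ 2) => x y; move: (y ^+ n) => w; field; rewrite gt_eqF.
apply: (@le_trans _ _ ((4 * al)^-1 * (cG * al ^+ n.+1 * P z) + 2^-1 * (cG * al ^+ n * P z))).
  apply: lerD; apply: ler_wpM2l => //.
  by rewrite invr_ge0 mulr_ge0// ltW.
have X0 : 0 <= cG * al ^+ n * P z.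
  by apply: mulr_ge0 (P_ge0 z); rewrite mulr_ge0 ?cG_ge0// exprn_ge0// ltW.
have -> : (4 * al)^-1 * (cG * al ^+ n.+1 * P z) = 4^-1 * (cG * al ^+ n * P z).
  by rewrite exprS; move: (P z) => x; field; rewrite gt_eqF.
move: X0; move: (cG * al ^+ n * P z) => X X0; lra.
Qed.

(** Differentiation under the integral sign takes place at a fixed al, so the
    constant may depend on al. *)
Lemma p3_le k i j : exists C : R, forall z, `|p3 k i j z| <= C * P z.
Proof.
exists ((b ^+ 3 * (al + al ^+ 2) + 3 * b ^+ 2 * (1 + al)) * cG) => z.
have h0 := p0_le z; have h1 := p0_le2 z; have h2 := p0_le4 z.
have zi := coord_l1n z i; have zj := coord_l1n z j; have zk := coord_l1n z k.
have N0 := l1n_ge0 z; have p0 := heat_kernel_ge0 al z.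
have b3 : 0 <= b ^+ 3 by rewrite exprn_ge0// ltW.
have b2 : 0 <= b ^+ 2 by rewrite exprn_ge0// ltW.
have dl (c : bool) (x : R) : `|x| <= l1n z -> `|c%:R * x| <= l1n z.
  by case: c => h; rewrite ?mul1r// mul0r normr0.
have A : `|p3 k i j z| <= (b ^+ 3 * l1n z ^+ 3 + b ^+ 2 * (3 * l1n z)) * p al z.
  rewrite /p3 normrM (ger0_norm p0); apply: ler_wpM2r => //.
  apply: (le_trans (ler_normD _ _)); apply: lerD.
    move: (b ^+ 3) b3 => B B3; rewrite !mulNr normrN -!mulrA normrM (ger0_norm B3); apply: ler_wpM2l => //.
    rewrite normrM [`|z ord0 i * _|]normrM !exprS expr0 mulr1.
    by apply: ler_pM => //; apply: ler_pM.
  rewrite normrM ger0_norm//; apply: ler_wpM2l => //.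
  rewrite (_ : 3 * l1n z = l1n z + l1n z + l1n z); last by ring.
  apply: (le_trans (ler_normD _ _)); apply: lerD; last exact: dl.
  by apply: (le_trans (ler_normD _ _)); apply: lerD; exact: dl.
apply: (le_trans A).
have N3 : l1n z ^+ 3 <= l1n z ^+ 2 + l1n z ^+ 4.
  have -> : l1n z ^+ 3 = l1n z ^+ 2 * l1n z by rewrite exprSr.
  have -> : l1n z ^+ 4 = l1n z ^+ 2 * l1n z ^+ 2 by rewrite -exprD.
  rewrite -[X in X + _]mulr1 -mulrDr; apply: ler_wpM2l; first exact: sqr_ge0.
  by have := sqr_ge0 (l1n z - 1); move: (l1n z) N0 => x x0; nra.
have N1 : l1n z <= 1 + l1n z ^+ 2.
  by have := sqr_ge0 (l1n z - 1); move: (l1n z) N0 => x x0; nra.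
apply: (@le_trans _ _ ((b ^+ 3 * (l1n z ^+ 2 + l1n z ^+ 4) + b ^+ 2 * (3 * (1 + l1n z ^+ 2))) * p al z)).
  apply: ler_wpM2r => //; apply: lerD; apply: ler_wpM2l => //; apply: ler_wpM2l => //.
have -> : (b ^+ 3 * (l1n z ^+ 2 + l1n z ^+ 4) + b ^+ 2 * (3 * (1 + l1n z ^+ 2))) * p al z =
  b ^+ 3 * (l1n z ^+ 2 * p al z + l1n z ^+ 4 * p al z) + b ^+ 2 * (3 * (p al z + l1n z ^+ 2 * p al z)) by ring.
have -> : (b ^+ 3 * (al + al ^+ 2) + 3 * b ^+ 2 * (1 + al)) * cG * P z =
  b ^+ 3 * (cG * al * P z + cG * al ^+ 2 * P z) + b ^+ 2 * (3 * (cG * P z + cG * al * P z)) by ring.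
by apply: lerD; apply: ler_wpM2l => //; [apply: lerD|apply: ler_wpM2l => //; apply: lerD].
Qed.

Lemma kder_of k (K K' : V -> R) (C : R) : measurable_fun [set: V] K -> measurable_fun [set: V] K' ->
  (forall z, `|K z| <= C * P z) -> (forall z, `|K' z| <= C * P z) ->
  (forall z (t : R), is_derive t 1 (fun t => K (z + t *: ei k)) (K' (z + t *: ei k))) ->
  kder k K K'.
Proof.
move=> mK mK' HK HK' D.
have al2 : 0 < 2 * al by rewrite mulr_gt0.
have lP := L1_heat_kernel al2.
split => //; first exact: (L1_le mK (L1Z C lP) HK).
exists (fun z => `|C| * (2 `^ (d%:R / 2) * expR ((4 * (2 * al))^-1)) * p (2 * (2 * al)) z).
  by apply: L1Z; apply: L1_heat_kernel; rewrite mulr_gt0.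
move=> z t t1; apply: (le_trans (HK' _)).
apply: (@le_trans _ _ (`|C| * P (z + t *: ei k))).
  by apply: ler_wpM2r => //; exact: ler_norm.
by rewrite -mulrA ler_wpM2l//; exact: heat_kernel_line.
Qed.

Lemma measurable_weighted (Q : V -> R) : measurable_fun [set: V] Q -> measurable_fun [set: V] (fun z => Q z * p al z).
Proof. by move=> mQ; apply: measurable_funM => //; exact: measurable_heat_kernel. Qed.

Lemma measurable_p1 j : measurable_fun [set: V] (p1 j).
Proof.
apply: measurable_weighted; apply: measurable_funM => //; exact: measurable_coord_id.
Qed.

Lemma measurable_p2 i j : measurable_fun [set: V] (p2 i j).
Proof.
apply: measurable_weighted; apply: measurable_funB => //.
apply: measurable_funM; last exact: measurable_coord_id.
by apply: measurable_funM => //; exact: measurable_coord_id.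
Qed.

Lemma measurable_p3 k i j : measurable_fun [set: V] (p3 k i j).
Proof.
have mc := @measurable_coord_id R d.
apply: measurable_weighted; apply: measurable_funD.
  by apply: measurable_funM; [apply: measurable_funM; [apply: measurable_funM|]|].
by apply: measurable_funM => //; apply: measurable_funD; [apply: measurable_funD|]; apply: measurable_funM.
Qed.

Lemma p1_le1 k z : `|p1 k z| <= b * (1 + al) * cG * P z.
Proof.
have zk := coord_l1n z k; have N0 := l1n_ge0 z.
have N1 : l1n z <= 1 + l1n z ^+ 2.
  by have := sqr_ge0 (l1n z - 1); move: (l1n z) N0 => x x0; nra.
have h0 := p0_le z; have h1 := p0_le2 z.
apply: (@le_trans _ _ (b * ((1 + l1n z ^+ 2) * p al z))).
  rewrite /p1; move: (p al z) (heat_kernel_ge0 al z) => x x0.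
  have -> : `|- b * z ord0 k * x| = b * (`|z ord0 k| * x).
    by rewrite normrM normrM normrN (gtr0_norm b0) (ger0_norm x0) mulrA.
  by apply: ler_wpM2l; [exact: ltW|apply: ler_wpM2r => //; exact: le_trans zk N1].
move: h0 h1; move: (p al z) (P z) => x y h0 h1.
rewrite -!mulrA; apply: ler_wpM2l; first exact: ltW.
rewrite mulrDl mul1r mulrDl mul1r; apply: lerD => //.
by rewrite mulrA [al * _]mulrC.
Qed.

Lemma kder_p0 k : kder k (p al) (p1 k).
Proof.
apply: (@kder_of _ _ _ (cG + b * (1 + al) * cG)).
- exact: measurable_heat_kernel.
- exact: measurable_p1.
- move=> z; rewrite ger0_norm ?heat_kernel_ge0// (le_trans (p0_le z))// ler_wpM2r// lerDl.
  by rewrite !mulr_ge0 ?cG_ge0 ?addr_ge0// ltW.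
- move=> z; rewrite mulrDl; apply: ler_wpDl; first by apply: mulr_ge0 (P_ge0 z); exact: cG_ge0.
  exact: p1_le1.
- exact: heat_kernel_is_derive.
Qed.

Lemma p2_le1 i j z : `|p2 i j z| <= al^-1 * cG * P z.
Proof.
have := p2_le i j z (isT : (0 <= 2)%N); rewrite !expr0 !mulr1 mulrC.
by rewrite -ler_pdivlMr// mulrC mulrA.
Qed.

Lemma kder_p1 k j : kder k (p1 j) (p2 k j).
Proof.
have c0 := cG_ge0; have a0 : 0 <= al by exact: ltW.
have ai : 0 <= al^-1 by rewrite invr_ge0.
apply: (@kder_of _ _ _ (b * (1 + al) * cG + al^-1 * cG)).
- exact: measurable_p1.
- exact: measurable_p2.
- move=> z; rewrite mulrDl; apply: ler_wpDr; first by apply: mulr_ge0 (P_ge0 z); rewrite !mulr_ge0.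
  exact: p1_le1.
- move=> z; rewrite mulrDl; apply: ler_wpDl; first by apply: mulr_ge0 (P_ge0 z); rewrite mulr_ge0// mulr_ge0 ?addr_ge0// ltW.
  exact: p2_le1.
- exact: p1_is_derive.
Qed.

Lemma kder_p2 k i j : kder k (p2 i j) (p3 k i j).
Proof.
have c0 := cG_ge0; have a0 : 0 <= al by exact: ltW.
have ai : 0 <= al^-1 by rewrite invr_ge0.
have [C HC] := p3_le k i j.
apply: (@kder_of _ _ _ (al^-1 * cG + `|C|)).
- exact: measurable_p2.
- exact: measurable_p3.
- move=> z; rewrite mulrDl; apply: ler_wpDr; first by apply: mulr_ge0 (P_ge0 z).
  exact: p2_le1.
- move=> z; rewrite mulrDl; apply: ler_wpDl; first by apply: mulr_ge0 (P_ge0 z); rewrite !mulr_ge0.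
  by apply: (le_trans (HC z)); apply: ler_wpM2r => //; exact: ler_norm.
- exact: p2_is_derive.
Qed.

End derivatives.

Lemma heat_convol al (f : V -> R) : 0 < al -> measurable_fun [set: V] f ->
  heat al f = convol (p al) f.
Proof.
move=> al0 mf; apply/funext => x; rewrite /heat gt_eqF//.
rewrite -(I_reflect x (g := fun y => p al (x - y) * f y)).
  by apply: I_ext => y; rewrite opprB addrC subrK.
apply: measurable_funM => //; apply: measurable_reflect; exact: measurable_heat_kernel.
Qed.

End gaussian.

(** * Increments and Taylor remainders *)

Section increments.
Context {R : realType} {d : nat}.
Local Notation V := 'rV[R]_d.
Implicit Types (H : V -> R) (G : 'I_d -> V -> R) (w z : V) (k : 'I_d).

Lemma UD_add k H H' F F' : UD k H F -> UD k H' F' ->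
  UD k (fun w => H w + H' w) (fun w => F w + F' w).
Proof.
move=> h h' e e0; have e2 : 0 < e / 2 by rewrite divr_gt0.
have [a a0 Ha] := h _ e2; have [b b0 Hb] := h' _ e2.
exists (Num.min a b); first by rewrite lt_min a0.
move=> w t; rewrite le_min => /andP[ta tb].
have -> : H (w + t *: ei k) + H' (w + t *: ei k) - (H w + H' w) + t * (F w + F' w) =
  (H (w + t *: ei k) - H w + t * F w) + (H' (w + t *: ei k) - H' w + t * F' w) by ring.
rewrite (le_trans (ler_normD _ _))// [e]splitr mulrDl lerD//; [exact: Ha|exact: Hb].
Qed.

Lemma UD_opp k H F : UD k H F -> UD k (fun w => - H w) (fun w => - F w).
Proof.
move=> h e e0; have [a a0 Ha] := h _ e0; exists a => // w t ta.
rewrite mulrN -opprD -opprD normrN; exact: Ha.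
Qed.

Lemma UD_translate k H F (c : V) : UD k H F -> UD k (fun w => H (c + w)) (fun w => F (c + w)).
Proof.
move=> h e e0; have [a a0 Ha] := h _ e0; exists a => // w t ta.
by rewrite addrA; exact: Ha.
Qed.

Lemma UD_linear k (c : 'I_d -> R) :
  UD k (fun w : V => \sum_(i < d) w ord0 i * c i) (fun=> - c k).
Proof.
move=> e e0; exists 1 => // w t _.
have -> : \sum_(i < d) (w + t *: ei k) ord0 i * c i = \sum_(i < d) w ord0 i * c i + t * c k.
  rewrite (bigD1 k)//= [in RHS](bigD1 k)//= eiE eqxx mulr1.
  rewrite (eq_bigr (fun i => w ord0 i * c i)); first by ring.
  by move=> i /negbTE ik; rewrite eiE ik mulr0 addr0.
by rewrite [_ + t * c k]addrC addrK mulrN subrr normr0 mulr_ge0// ltW.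
Qed.

(** The vertices of the path from 0 to z that changes one coordinate at a
    time; along it partial derivatives suffice. *)
Definition staircase z (m : nat) : V := \row_(i < d) (if (i < m)%N then z ord0 i else 0).

Lemma staircaseS z (m : 'I_d) : staircase z m.+1 = staircase z m + z ord0 m *: ei m.
Proof.
apply/rowP => i; rewrite eiE !mxE; have [->|im] := eqVneq i m.
  by rewrite ltnSn ltnn add0r mulr1.
rewrite mulr0 addr0 ltnS leq_eqVlt -val_eqE /= in im *.
by rewrite (negbTE im).
Qed.

Lemma path_bound H G w z (M : R) : (forall k, UD k H (G k)) ->
  (forall k (y : V), (forall i, `|y ord0 i| <= `|z ord0 i|) -> `|G k (w + y)| <= M) ->
  `|H (w + z) - H w| <= M * l1n z.
Proof.
move=> ud GM.
have s0 : staircase z 0 = 0 by apply/rowP => i; rewrite !mxE ltn0.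
have sd : staircase z d = z by apply/rowP => i; rewrite !mxE ltn_ord.
have -> : H (w + z) - H w =
    \sum_(m < d) (H (w + staircase z m.+1) - H (w + staircase z m)).
  rewrite -(big_mkord xpredT (fun m => H (w + staircase z m.+1) - H (w + staircase z m))).
  by rewrite telescope_sumr// sd s0 addr0.
apply: (le_trans (ler_norm_sum _ _ _)); rewrite /l1n mulr_sumr; apply: ler_sum => m _.
rewrite staircaseS addrA.
have [c] := UD_mvt (w + staircase z m) 0 (z ord0 m) (ud m).
rewrite !subr0 scale0r addr0 => cz ->; rewrite normrM normrN ler_wpM2r//.
rewrite -addrA; apply: GM => i; rewrite eiE mxE.
have [->|im] := eqVneq i m; first by rewrite ltnn add0r mulr1.
by rewrite mulr0 addr0; case: ifP => // _; rewrite normr0.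
Qed.

(** The mean value inequality for H minus its linear part, whose derivatives
    vanish at 0 and are estimated by the same inequality. *)
Lemma taylor2_bound H G (GG : 'I_d -> 'I_d -> V -> R) z (M : R) :
  (forall k, UD k H (G k)) -> (forall k l, UD l (G k) (GG l k)) ->
  (forall k l w, `|GG l k w| <= M) ->
  `|H z - H 0 + \sum_(k < d) z ord0 k * G k 0| <= M * l1n z ^+ 2.
Proof.
move=> ud ud2 GM.
pose F w := H w + \sum_(k < d) w ord0 k * G k 0.
have udF k : UD k F (fun w => G k w - G k 0) := UD_add (ud k) (UD_linear k (fun k => G k 0)).
have F0 : F 0 = H 0 by rewrite /F big1 ?addr0// => k _; rewrite mxE mul0r.
have -> : H z - H 0 + \sum_(k < d) z ord0 k * G k 0 = F (0 + z) - F 0.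
  by rewrite F0 add0r /F addrAC.
rewrite expr2 mulrA; apply: (path_bound udF) => k y yz.
have M0 : 0 <= M by apply: le_trans (GM k k 0).
apply: (@le_trans _ _ (M * l1n y)); last by rewrite ler_wpM2l// l1n_le.
rewrite -[X in G k X - _]addr0 add0r addr0.
have := @path_bound (G k) (fun l => GG l k) 0 y M (ud2 k) (fun l y' _ => GM k l _).
by rewrite add0r.
Qed.

(** The mean value inequality in the direction z for the increment of H by
    w. *)
Lemma second_difference_bound H G (GG : 'I_d -> 'I_d -> V -> R) w z (M : R) :
  (forall k, UD k H (G k)) -> (forall k l, UD l (G k) (GG l k)) ->
  (forall k l w, `|GG l k w| <= M) ->
  `|H 0 - H w - H z + H (w + z)| <= M * l1n w * l1n z.
Proof.
move=> ud ud2 GM.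
have udF k : UD k (fun y => H (w + y) - H y) (fun y => G k (w + y) - G k y) :=
  UD_add (UD_translate w (ud k)) (UD_opp (ud k)).
have -> : H 0 - H w - H z + H (w + z) =
  (fun y => H (w + y) - H y) (0 + z) - (fun y => H (w + y) - H y) 0.
  by rewrite /= add0r addr0; ring.
apply: (path_bound udF) => k y _; rewrite [w + _]addrC.
exact: (@path_bound (G k) (fun l => GG l k) (0 + y) w M (ud2 k) (fun l y' _ => GM k l _)).
Qed.

End increments.

(** * The trilinear integral *)

Section trilinear.
Context {R : realType} {d : nat}.
Local Notation lam := (@lebesgue_rV R d).
Local Notation V := 'rV[R]_d.
Variables (q : \bar R) (r s : R).
Hypotheses (hq : (1 < q)%E) (hr : 1 < r) (hs : 1 < s).
Hypothesis hqrs : (q^-1 + (r%:E)^-1 + (s%:E)^-1 = 1)%E.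
Implicit Types (u v a b K : V -> R) (w z : V) (k : 'I_d).

Let q0 : (0 <= q)%E. Proof. by rewrite (le_trans _ (ltW hq)). Qed.
Let r0 : (0 <= r%:E)%E. Proof. by rewrite lee_fin (le_trans _ (ltW hr)). Qed.
Let s0 : (0 <= s%:E)%E. Proof. by rewrite lee_fin (le_trans _ (ltW hs)). Qed.

(** The pairing of u with a translate of v and a translate of a. All the
    estimates at a fixed time are estimates of this function of the two
    translation vectors. *)
Definition Phi u a v w1 w2 : R := \int[lam]_x (u x * v (x - w2) * a (x - w1)).

Lemma Phi_L1 u a v w1 w2 : Lx r%:E u -> Lx q a -> Lx s%:E v ->
  L1 lam (fun x => u x * v (x - w2) * a (x - w1)).
Proof. by move=> lu la lv; exact: (hoelder3 hq hr hs hqrs lu (Lx_shift w2 s0 lv) (Lx_shift w1 q0 la)).1. Qed.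

Lemma Phi_abs u a v w1 w2 : Lx r%:E u -> Lx q a -> Lx s%:E v ->
  \int[lam]_x `|u x * v (x - w2) * a (x - w1)| <= nrm r%:E u * nrm s%:E v * nrm q a.
Proof.
move=> lu la lv; rewrite -(nrm_shift w2 s0 lv) -(nrm_shift w1 q0 la).
exact: (hoelder3 hq hr hs hqrs lu (Lx_shift w2 s0 lv) (Lx_shift w1 q0 la)).2.
Qed.

Lemma Phi_abs_EFin u a v w1 w2 : Lx r%:E u -> Lx q a -> Lx s%:E v ->
  (\int[lam]_x `|u x * v (x - w2) * a (x - w1)|%:E <= (nrm r%:E u * nrm s%:E v * nrm q a)%:E)%E.
Proof.
by move=> lu la lv; rewrite -(I_abs_EFin (Phi_L1 w1 w2 lu la lv)) lee_fin; exact: Phi_abs.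
Qed.

Lemma Phi_bound u a v w1 w2 : Lx r%:E u -> Lx q a -> Lx s%:E v ->
  `|Phi u a v w1 w2| <= nrm r%:E u * nrm s%:E v * nrm q a.
Proof.
move=> lu la lv; apply: le_trans (Phi_abs w1 w2 lu la lv).
have l := Phi_L1 w1 w2 lu la lv.
exact: (I_norm_le l (L1_norm l) (fun x => lexx _)).
Qed.

Lemma measurable_Phi d0 (T : measurableType d0) u a v (m1 m2 : T -> V) :
  Lx r%:E u -> Lx q a -> Lx s%:E v ->
  measurable_fun [set: T] m1 -> measurable_fun [set: T] m2 ->
  measurable_fun [set: T] (fun t => Phi u a v (m1 t) (m2 t)).
Proof.
move=> /Lx_meas mu /Lx_meas ma /Lx_meas mv mm1 mm2.
apply: (@measurable_param _ _ T V R lam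
  (fun p : T * V => u p.2 * v (p.2 - m2 p.1) * a (p.2 - m1 p.1))).
apply: measurable_funM.
  apply: measurable_funM; first exact: (measurableT_comp mu).
  apply: (measurableT_comp mv); apply: measurable_subrV => //.
  exact: measurableT_comp.
apply: (measurableT_comp ma); apply: measurable_subrV => //.
exact: measurableT_comp.
Qed.

Lemma PhiDl u u' a v w1 w2 : Lx r%:E u -> Lx r%:E u' -> Lx q a -> Lx s%:E v ->
  Phi (fun x => u x - u' x) a v w1 w2 = Phi u a v w1 w2 - Phi u' a v w1 w2.
Proof.
move=> lu lu' la lv; rewrite /Phi -(IB (Phi_L1 w1 w2 lu la lv) (Phi_L1 w1 w2 lu' la lv)).
by apply: I_ext => x; rewrite !mulrBl.
Qed.

Lemma Phi_shift u a v w1 w2 c : Lx r%:E u -> Lx q a -> Lx s%:E v ->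
  Phi u a v w1 w2 = \int[lam]_x (u (x + c) * v (x + c - w2) * a (x + c - w1)).
Proof.
by move=> lu la lv; exact/esym/(I_shiftD c (L1_measurable (Phi_L1 w1 w2 lu la lv))).
Qed.

(** After the change of variables x + w1 + y1 the function a is no longer
    translated, and the increments fall on u and v only, whose translations
    are continuous since r and s are finite; q may be infinite. *)
Lemma Phi_UC u a v : Lx r%:E u -> Lx q a -> Lx s%:E v ->
  forall e : R, 0 < e -> exists2 delta : R, 0 < delta &
    forall y1 y2, box delta y1 -> box delta y2 -> forall w1 w2,
      `|Phi u a v (w1 + y1) (w2 + y2) - Phi u a v w1 w2| <= e.
Proof.
move=> lu la lv e e0.
pose A := nrm q a; pose U := nrm r%:E u; pose W := nrm s%:E v.
have A0 : 0 <= A := nrm_ge0 _ _; have U0 : 0 <= U := nrm_ge0 _ _; have W0 : 0 <= W := nrm_ge0 _ _.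
pose e' := e / (2 * (A * (U + W) + 1)).
have den : 0 < 2 * (A * (U + W) + 1) by rewrite mulr_gt0// ltr_wpDl// mulr_ge0// addr_ge0.
have e'0 : 0 < e' by rewrite divr_gt0.
have [d1 d10 Hd1] := vanish_omega (ltW hr) lu e'0.
have [d2 d20 Hd2] := vanish_omega (ltW hs) lv e'0.
(* half of d2, as v is translated by y1 - y2 *)
exists (Num.min d1 (d2 / 2)); first by rewrite lt_min d10 divr_gt0.
move=> y1 y2 b1 b2 w1 w2.
have B1 : box d1 y1 by apply: box_le b1; rewrite ge_min lexx.
have B2 : box d2 (y1 - y2).
  move=> i; have h1 := b1 i; have h2 := b2 i; rewrite !mxE.
  rewrite le_min in h1; rewrite le_min in h2.
  case/andP: h1 => _ h1; case/andP: h2 => _ h2.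
  by rewrite (le_trans (ler_normB _ _))// [leRHS]splitr lerD.
rewrite (Phi_shift (w1 + y1) (w2 + y2) (w1 + y1) lu la lv) (Phi_shift w1 w2 w1 lu la lv).
set c := w1 + y1; set b := c - (w2 + y2).
pose du x := u x - u (x - y1); pose dv x := v x - v (x - (y1 - y2)).
have ldu : Lx r%:E du by exact: (Lx_diff (ltW hr) y1 lu).
have ldv : Lx s%:E dv by exact: (Lx_diff (ltW hs) (y1 - y2) lv).
have L1a : L1 lam (fun x => du (x - (- c)) * v (x - (- b)) * a (x - 0)).
  exact: (hoelder3 hq hr hs hqrs (Lx_shift _ r0 ldu) (Lx_shift _ s0 lv) (Lx_shift _ q0 la)).1.
have L1b : L1 lam (fun x => u (x - (- w1)) * dv (x - (- b)) * a (x - 0)).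
  exact: (hoelder3 hq hr hs hqrs (Lx_shift _ r0 lu) (Lx_shift _ s0 ldv) (Lx_shift _ q0 la)).1.
have N1 := (hoelder3 hq hr hs hqrs (Lx_shift (- c) r0 ldu) (Lx_shift (- b) s0 lv) (Lx_shift 0 q0 la)).2.
have N2 := (hoelder3 hq hr hs hqrs (Lx_shift (- w1) r0 lu) (Lx_shift (- b) s0 ldv) (Lx_shift 0 q0 la)).2.
rewrite !nrm_shift// in N1; rewrite !nrm_shift// in N2.
have Lc : L1 lam (fun x => u (x + c) * v (x + c - (w2 + y2)) * a (x + c - c)).
  exact: (L1_shiftD c (Phi_L1 c (w2 + y2) lu la lv)).
have Lw : L1 lam (fun x => u (x + w1) * v (x + w1 - w2) * a (x + w1 - w1)).
  exact: (L1_shiftD w1 (Phi_L1 w1 w2 lu la lv)).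
rewrite -(IB Lc Lw).
have -> : \int[lam]_x (u (x + c) * v (x + c - (w2 + y2)) * a (x + c - c) -
      u (x + w1) * v (x + w1 - w2) * a (x + w1 - w1)) =
    \int[lam]_x (du (x - (- c)) * v (x - (- b)) * a (x - 0) +
      u (x - (- w1)) * dv (x - (- b)) * a (x - 0)).
  apply: I_ext => x; rewrite /du /dv !opprK subr0 !addrK.
  have -> : x + c - (w2 + y2) = x + b by apply/rowP => i; rewrite /b /c !mxE; ring.
  have -> : x + c - y1 = x + w1 by apply/rowP => i; rewrite /c !mxE; ring.
  have -> : x + b - (y1 - y2) = x + w1 - w2.
    by apply/rowP => i; rewrite /b /c !mxE; ring.
  by ring.
rewrite (ID L1a L1b) (le_trans (ler_normD _ _))//.
have h1 := le_trans (I_norm_le L1a (L1_norm L1a) (fun x => lexx _)) N1.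
have h2 := le_trans (I_norm_le L1b (L1_norm L1b) (fun x => lexx _)) N2.
have o1 : nrm r%:E du <= e' := Hd1 _ B1.
have o2 : nrm s%:E dv <= e' := Hd2 _ B2.
apply: (le_trans (lerD h1 h2)).
apply: (@le_trans _ _ (e' * W * A + U * e' * A)).
  by apply: lerD; apply: ler_wpM2r => //; [apply: ler_wpM2r|apply: ler_wpM2l].
have -> : e' * W * A + U * e' * A = e * ((A * (U + W)) / (2 * (A * (U + W) + 1))).
  by rewrite /e'; ring.
rewrite ler_piMr ?(ltW e0)// ler_pdivrMr// mul1r.
have : 0 <= A * (U + W) by rewrite mulr_ge0// addr_ge0.
by move: (A * (U + W)) => x x0; lra.
Qed.

Lemma Phi_UC1 u a v w2 : Lx r%:E u -> Lx q a -> Lx s%:E v -> UC (fun w1 => Phi u a v w1 w2).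
Proof.
move=> lu la lv e e0; have [dl d0 H] := Phi_UC lu la lv e0; exists dl => // y By w.
have B0 : box dl (0 : V) by move=> i; rewrite mxE normr0 ltW.
by have := H y 0 By B0 w w2; rewrite addr0.
Qed.

Lemma Phi_UC2 u a v w1 : Lx r%:E u -> Lx q a -> Lx s%:E v -> UC (fun w2 => Phi u a v w1 w2).
Proof.
move=> lu la lv e e0; have [dl d0 H] := Phi_UC lu la lv e0; exists dl => // y By w.
have B0 : box dl (0 : V) by move=> i; rewrite mxE normr0 ltW.
by have := H 0 y B0 By w1 w; rewrite addr0.
Qed.

Lemma Phi_UD1 k u a a' v w2 : Lx r%:E u -> Lx q a -> Lx q a' -> Lx s%:E v ->
  is_weak_partial k a a' -> UD k (fun w1 => Phi u a v w1 w2) (fun w1 => Phi u a' v w1 w2).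
Proof.
move=> lu la la' lv W.
have mpsi : measurable_fun [set: V] (fun x => u x * v (x - w2)).
  by apply: measurable_funM; [exact: Lx_meas lu|apply: measurable_shift; exact: Lx_meas lv].
exact: (UD_pairing W mpsi (fun z => Phi_abs_EFin z w2 lu la lv) (fun z => Phi_abs_EFin z w2 lu la' lv)
  (Phi_UC1 w2 lu la lv) (Phi_UC1 w2 lu la' lv)).
Qed.

Lemma Phi_UD2 k u a v v' w1 : Lx r%:E u -> Lx q a -> Lx s%:E v -> Lx s%:E v' ->
  is_weak_partial k v v' -> UD k (fun w2 => Phi u a v w1 w2) (fun w2 => Phi u a v' w1 w2).
Proof.
move=> lu la lv lv' W.
have mpsi : measurable_fun [set: V] (fun x => u x * a (x - w1)).
  by apply: measurable_funM; [exact: Lx_meas lu|apply: measurable_shift; exact: Lx_meas la].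
have E b : (fun w2 => Phi u a b w1 w2) = (fun w2 => \int[lam]_x (u x * a (x - w1) * b (x - w2))).
  by apply/funext => w2; apply: I_ext => x; rewrite mulrAC.
have HB b : Lx s%:E b -> forall z, (\int[lam]_x `|u x * a (x - w1) * b (x - z)|%:E <=
    (nrm r%:E u * nrm s%:E b * nrm q a)%:E)%E.
  move=> lb z; rewrite (_ : (fun x : V => _) = (fun x : V => `|u x * b (x - z) * a (x - w1)|%:E)).
    exact: Phi_abs_EFin.
  by apply/funext => x; rewrite mulrAC.
rewrite !E; apply: (UD_pairing W mpsi (HB _ lv) (HB _ lv')); rewrite -E; exact: Phi_UC2.
Qed.

(** The product rule along the diagonal. Differentiability in each variable
    separately is enough because the derivatives are uniformly continuous in
    both. *)
Lemma Phi_UD_diag k u a a' v v' : Lx r%:E u -> Lx q a -> Lx q a' -> Lx s%:E v -> Lx s%:E v' ->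
  is_weak_partial k a a' -> is_weak_partial k v v' ->
  UD k (fun z => Phi u a v z z) (fun z => Phi u a' v z z + Phi u a v' z z).
Proof.
move=> lu la la' lv lv' Wa Wv e e0.
have e3 : 0 < e / 2 by rewrite divr_gt0.
have [d1 d10 H1] := Phi_UC lu la' lv e3.
have [d2 d20 H2] := Phi_UC lu la lv' e3.
have Bt (dl t : R) (c : V -> V) : box dl (0 : V) -> `|t| <= dl -> box dl (t *: ei k : V).
  move=> _ tb i; have := eiE k t 0 i; rewrite add0r => ->; rewrite mxE add0r.
  case: (i == k); rewrite ?mulr1 ?mulr0 ?normr0//; exact: le_trans tb.
have B0 (dl : R) : 0 < dl -> box dl (0 : V) by move=> dl0 i; rewrite mxE normr0 ltW.
exists (Num.min d1 d2); first by rewrite lt_min d10.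
move=> w t; rewrite le_min => /andP[t1 t2].
have [c1 c1t E1] := UD_mvt w 0 t (Phi_UD1 (w + t *: ei k) lu la la' lv Wa).
have [c2 c2t E2] := UD_mvt w 0 t (Phi_UD2 w lu la lv lv' Wv).
rewrite !subr0 scale0r addr0 in c1t c2t E1 E2.
have h1 := H1 (c1 *: ei k) (t *: ei k) (Bt _ _ id (B0 _ d10) (le_trans c1t t1)) (Bt _ _ id (B0 _ d10) t1) w w.
have h2 := H2 0 (c2 *: ei k) (B0 _ d20) (Bt _ _ id (B0 _ d20) (le_trans c2t t2)) w w.
rewrite addr0 in h2.
move: E1 E2 h1 h2.
move: (Phi u a v _ _) (Phi u a v w (w + t *: ei k)) (Phi u a v w w).
move: (Phi u a' v (w + c1 *: ei k) _) (Phi u a' v w w) (Phi u a v' w (w + c2 *: ei k)) (Phi u a v' w w).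
move=> g1 g1' g2 g2' x1 x2 x3 E1 E2 h1 h2.
have -> : x1 - x3 + t * (g1' + g2') = - (t * (g1 - g1') + t * (g2 - g2')).
  have -> : x1 = x2 - g1 * t by rewrite -[x1](subrK x2) E1; ring.
  have -> : x2 = x3 - g2 * t by rewrite -[x2](subrK x3) E2; ring.
  by ring.
rewrite normrN -mulrDr normrM mulrC ler_wpM2r// (le_trans (ler_normD _ _))//.
by rewrite [leRHS]splitr lerD.
Qed.

Lemma Phi_BM_diag u a v : Lx r%:E u -> Lx q a -> Lx s%:E v -> BM (fun z => Phi u a v z z).
Proof.
move=> lu la lv; split; first exact: (@measurable_Phi _ V u a v id id lu la lv).
by exists (nrm r%:E u * nrm s%:E v * nrm q a) => z; exact: Phi_bound.
Qed.

Lemma Phi_BM0 u a v : Lx r%:E u -> Lx q a -> Lx s%:E v -> BM (fun z => Phi u a v 0 z).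
Proof.
move=> lu la lv; split; first exact: (@measurable_Phi _ V u a v (cst 0) id lu la lv).
by exists (nrm r%:E u * nrm s%:E v * nrm q a) => z; exact: Phi_bound.
Qed.

End trilinear.

(** * The first estimate at a fixed time *)

Lemma le_sum2 (R : numDomainType) (I : finType) (F : I -> I -> R) (k l : I) : (forall k l, 0 <= F k l) ->
  F k l <= \sum_k \sum_l F k l.
Proof.
move=> F0; rewrite (bigD1 k)//= (bigD1 l)//= -addrA lerDl addr_ge0//.
  by apply: sumr_ge0.
by apply: sumr_ge0 => k' _; apply: sumr_ge0.
Qed.

Section first_estimate.
Context {R : realType} {d : nat}.
Local Notation lam := (@lebesgue_rV R d).
Local Notation V := 'rV[R]_d.
Local Notation p := (@heat_kernel R d).
Variables (q : \bar R) (r s : R).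
Hypotheses (hq : (1 < q)%E) (hr : 1 < r) (hs : 1 < s).
Hypothesis hqrs : (q^-1 + (r%:E)^-1 + (s%:E)^-1 = 1)%E.
Variables (al : R) (al0 : 0 < al).
Implicit Types (u f v a K : V -> R) (w z : V) (i j k l : 'I_d).

Lemma p2C i j z : p2 al i j z = p2 al j i z.
Proof. by rewrite /p2 eq_sym; ring. Qed.

Lemma Phi_convol u a v K : Lx r%:E u -> Lx q a -> Lx s%:E v -> L1 lam K ->
  L1 lam (fun x => u x * a x * convol K v x) /\
  \int[lam]_x (u x * a x * convol K v x) = \int[lam]_z (K z * Phi u a v 0 z).
Proof.
move=> lu la lv lK.
have mua : measurable_fun [set: V] (fun x => u x * a x).
  by apply: measurable_funM; [exact: Lx_meas lu|exact: Lx_meas la].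
have E x z : u x * a x * v (x - z) = u x * v (x - z) * a (x - 0) by rewrite subr0 mulrAC.
have hb z : (\int[lam]_x `|u x * a x * v (x - z)|%:E <=
    (nrm r%:E u * nrm s%:E v * nrm q a)%:E)%E.
  rewrite (_ : (fun x : V => _) = (fun x : V => `|u x * v (x - z) * a (x - 0)|%:E)).
    exact: Phi_abs_EFin.
  by apply/funext => x; rewrite E.
have [l1 _ E1] := convol_swap lK mua (Lx_meas lv) hb.
split; first exact: l1.
rewrite E1; apply: I_ext => z; apply: (congr1 (fun t => K z * t)).
by apply: I_ext => x; rewrite E.
Qed.

Lemma Phi_convol_sum (I : finType) u (a g : I -> V -> R) K : Lx r%:E u ->
  (forall n, Lx q (a n)) -> (forall n, Lx s%:E (g n)) -> L1 lam K ->
  L1 lam (fun x => u x * convol K (fun y => \sum_i a i y * g i y) x) /\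
  \int[lam]_x (u x * convol K (fun y => \sum_i a i y * g i y) x) =
    \sum_i \int[lam]_z (K z * Phi u (a i) (g i) z z).
Proof.
move=> lu la lg lK; have mu := Lx_meas lu.
have mG : measurable_fun [set: V] (fun y => \sum_i a i y * g i y).
  by apply: measurable_sum => i; apply: measurable_funM; [exact: Lx_meas (la i)|exact: Lx_meas (lg i)].
have E x z : u x * (\sum_i a i (x - z) * g i (x - z)) = \sum_i u x * g i (x - z) * a i (x - z).
  by rewrite mulr_sumr; apply: eq_bigr => i _; ring.
have lz z : L1 lam (fun x => \sum_i u x * g i (x - z) * a i (x - z)).
  by apply: L1_sum => i; exact: (Phi_L1 hq hr hs hqrs).
have hb z : (\int[lam]_x `|u x * (\sum_i a i (x - z) * g i (x - z))|%:E <=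
    (\sum_i nrm r%:E u * nrm s%:E (g i) * nrm q (a i))%:E)%E.
  rewrite (_ : (fun x : V => _) = (fun x : V => `|\sum_i u x * g i (x - z) * a i (x - z)|%:E)); last first.
    by apply/funext => x; rewrite E.
  rewrite -(I_abs_EFin (lz z)) lee_fin.
  have ls : L1 lam (fun x => \sum_i `|u x * g i (x - z) * a i (x - z)|).
    by apply: L1_sum => i; apply: L1_norm; exact: (Phi_L1 hq hr hs hqrs).
  apply: (le_trans (I_le (L1_norm (lz z)) ls (fun x => ler_norm_sum _ _ _))).
  rewrite I_sum; last by move=> i; apply: L1_norm; exact: (Phi_L1 hq hr hs hqrs).
  by apply: ler_sum => i _; exact: (Phi_abs hq hr hs hqrs).
have [l1 _ E1] := convol_swap lK mu mG hb.
split; first exact: l1.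
rewrite E1 -I_sum; last first.
  by move=> i; exact: L1_BM lK (Phi_BM_diag hq hr hs hqrs lu (la i) (lg i)).
apply: I_ext => z; rewrite -mulr_sumr; apply: (congr1 (fun t => K z * t)).
rewrite /Phi -I_sum; last by move=> i; exact: (Phi_L1 hq hr hs hqrs).
by apply: I_ext => x; rewrite E.
Qed.

(** The estimate for one coefficient a = a_ij. The derivatives falling on f
    are moved onto the kernel and onto a, after which the third derivatives of
    the kernel are eliminated by [p3E]; what remains is a sum of Taylor
    remainders of a, each multiplied by a kernel that compensates for its
    growth. *)
Lemma commutator_remainder u a (Da : 'I_d -> V -> R) (DDa : 'I_d -> 'I_d -> V -> R)
    f (Df : 'I_d -> V -> R) (DDf : 'I_d -> 'I_d -> V -> R) i j :
  Lx r%:E u ->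
  Lx q a -> (forall k, Lx q (Da k)) -> (forall k l, Lx q (DDa k l)) ->
  (forall k, is_weak_partial k a (Da k)) -> (forall k l, is_weak_partial k (Da l) (DDa k l)) ->
  Lx s%:E f -> (forall k, Lx s%:E (Df k)) -> (forall k l, Lx s%:E (DDf k l)) ->
  (forall k, is_weak_partial k f (Df k)) -> (forall k l, is_weak_partial k (Df l) (DDf k l)) ->
  `| \int[lam]_z (p al z * Phi u a (DDf i j) z z)
     - \int[lam]_z (p2 al i j z * Phi u a f 0 z)
     - al * \sum_(k < d) (2 * \int[lam]_z (p3 al k i j z * Phi u (Da k) f 0 z)
                      + \int[lam]_z (p2 al i j z * Phi u (DDa k k) f 0 z)) |
  <= @cG R d * (4 + d%:R) * (nrm r%:E u * nrm s%:E f * \sum_(k < d) \sum_(l < d) nrm q (DDa k l)).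
Proof.
move=> lu la lDa lDDa wa wDa lf lDf lDDf wf wDf.
set M := (X in _ <= _ * X).
have BMd b g (lb : Lx q b) (lg : Lx s%:E g) := Phi_BM_diag hq hr hs hqrs lu lb lg.
have BM0 b g (lb : Lx q b) (lg : Lx s%:E g) := Phi_BM0 hq hr hs hqrs lu lb lg.
have UDd k b b' g g' (lb : Lx q b) (lb' : Lx q b') (lg : Lx s%:E g) (lg' : Lx s%:E g')
    (wb : is_weak_partial k b b') (wg : is_weak_partial k g g') :=
  Phi_UD_diag hq hr hs hqrs lu lb lb' lg lg' wb wg.
have lp := L1_heat_kernel (d := d) al0.
have lp1 k : L1 lam (p1 al k) := kder_L1 (kder_p0 al0 k).
have lp2 k l : L1 lam (p2 al k l) := kder_L1 (kder_p1 al0 k l).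
have lp3 k : L1 lam (p3 al k i j) := kder_L1 (kder_p2 al0 k i j).
have IBP k K K' b b' g g' (dK : kder k K K') (lK : L1 lam K)
    (lb : Lx q b) (lb' : Lx q b') (lg : Lx s%:E g) (lg' : Lx s%:E g')
    (wb : is_weak_partial k b b') (wg : is_weak_partial k g g') :
    \int[lam]_z (K z * Phi u b g' z z) =
    \int[lam]_z (K' z * Phi u b g z z) - \int[lam]_z (K z * Phi u b' g z z).
  have := kernel_IBP dK (BMd _ _ lb lg) (BM_D (BMd _ _ lb' lg) (BMd _ _ lb lg')) (UDd _ _ _ _ _ lb lb' lg lg' wb wg).
  move=> <-; rewrite -(IB (L1_BM lK (BM_D (BMd _ _ lb' lg) (BMd _ _ lb lg'))) (L1_BM lK (BMd _ _ lb' lg))).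
  by apply: I_ext => z; ring.
rewrite (IBP _ _ _ _ _ _ _ (kder_p0 al0 i) lp la (lDa i) (lDf j) (lDDf i j) (wa i) (wDf i j)).
rewrite (IBP _ _ _ _ _ _ _ (kder_p1 al0 j i) (lp1 i) la (lDa j) lf (lDf j) (wa j) (wf j)).
rewrite (IBP _ _ _ _ _ _ _ (kder_p0 al0 j) lp (lDa i) (lDDa j i) lf (lDf j) (wDa j i) (wf j)).
have L1t := L1_BM (lp2 j i) (BMd _ _ la lf).
have L2t := L1_BM (lp1 i) (BMd _ _ (lDa j) lf).
have L3t := L1_BM (lp1 j) (BMd _ _ (lDa i) lf).
have L4t := L1_BM lp (BMd _ _ (lDDa j i) lf).
have L5t := L1_BM (lp2 i j) (BM0 _ _ la lf).
have L6t k := L1_BM (lp3 k) (BM0 _ _ (lDa k) lf).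
have L7t k := L1_BM (lp2 i j) (BM0 _ _ (lDDa k k) lf).
have L8t k := L1D (L1Z 2 (L6t k)) (L7t k).
rewrite (eq_bigr (fun k => \int[lam]_z (2 * (p3 al k i j z * Phi u (Da k) f 0 z) +
    p2 al i j z * Phi u (DDa k k) f 0 z))); last first.
  by move=> k _; rewrite (ID (L1Z 2 (L6t k)) (L7t k)) (IZ 2 (L6t k)).
rewrite -(I_sum _ L8t) -(IZ al (L1_sum _ L8t)).
rewrite -(IB L1t L2t) -(IB L3t L4t) -(IB (L1B L1t L2t) (L1B L3t L4t)).
rewrite -(IB (L1B (L1B L1t L2t) (L1B L3t L4t)) L5t).
rewrite -(IB (L1B (L1B (L1B L1t L2t) (L1B L3t L4t)) L5t) (L1Z al (L1_sum _ L8t))).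
have al2 : 0 < 2 * al by rewrite mulr_gt0.
have lP := L1_heat_kernel (d := d) al2.
have -> : @cG R d * (4 + d%:R) * M = \int[lam]_z (@cG R d * (4 + d%:R) * M * p (2 * al) z).
  by rewrite (IZ _ lP) I_heat_kernel// mulr1.
apply: (I_norm_le (L1B (L1B (L1B (L1B L1t L2t) (L1B L3t L4t)) L5t) (L1Z al (L1_sum _ L8t))) (L1Z _ lP)) => z.
have MP k l w1 w2 : `|Phi u (DDa k l) f w1 w2| <= M.
  apply: (le_trans (Phi_bound hq hr hs hqrs w1 w2 lu (lDDa k l) lf)).
  rewrite /M; apply: ler_wpM2l; first by rewrite mulr_ge0 ?nrm_ge0.
  by apply: (le_sum2 (F := fun k l => nrm q (DDa k l))) => k' l'; exact: nrm_ge0.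
have M0 : 0 <= M := le_trans (normr_ge0 _) (MP i j 0 0).
have UD1 k l w2 := Phi_UD1 hq hr hs hqrs w2 lu (lDa l) (lDDa k l) lf (wDa k l).
have UD0 k w2 := Phi_UD1 hq hr hs hqrs w2 lu la (lDa k) lf (wa k).
have first k : `|Phi u (Da k) f z z - Phi u (Da k) f 0 z| <= M * l1n z.
  have := @path_bound _ _ (fun w => Phi u (Da k) f w z) (fun l w => Phi u (DDa l k) f w z) 0 z M
    (fun l => UD1 l k z) (fun l y _ => MP l k _ _).
  by rewrite add0r.
have second : `|Phi u a f z z - Phi u a f 0 z + \sum_(k < d) z ord0 k * Phi u (Da k) f 0 z| <= M * l1n z ^+ 2.
  exact: (@taylor2_bound _ _ (fun w => Phi u a f w z) (fun l w => Phi u (Da l) f w z)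
    (fun l k w => Phi u (DDa l k) f w z) z M (fun k => UD0 k z) (fun k l => UD1 l k z)
    (fun k l w => MP l k w z)).
have third : `|\sum_(k < d) Phi u (DDa k k) f 0 z| <= d%:R * M.
  apply: (le_trans (ler_norm_sum _ _ _)).
  have -> : d%:R * M = \sum_(k < d) M by rewrite sumr_const card_ord mulr_natl.
  by apply: ler_sum => k _.
have bp := p0_le al0 z; have bp1i := p1_le al0 i z; have bp1j := p1_le al0 j z.
have bp2 := p2_le al0 i j z (isT : (0 <= 2)%N).
have bp2' := p2_le al0 i j z (isT : (1 <= 2)%N).
have P0 : 0 <= p (2 * al) z := heat_kernel_ge0 _ _.
have pp0 : 0 <= p al z := heat_kernel_ge0 _ _.
have c0 := @cG_ge0 R d.
have -> : al * (\sum_(k < d) (2 * (p3 al k i j z * Phi u (Da k) f 0 z) + p2 al i j z * Phi u (DDa k k) f 0 z)) =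
  - (p2 al i j z * (\sum_(k < d) z ord0 k * Phi u (Da k) f 0 z)) - p1 al j z * Phi u (Da i) f 0 z
   - p1 al i z * Phi u (Da j) f 0 z + al * p2 al i j z * \sum_(k < d) Phi u (DDa k k) f 0 z.
  have S m (F : 'I_d -> R) : \sum_(k < d) (k == m)%:R * F k = F m.
    rewrite (bigD1 m)//= eqxx mul1r big1 ?addr0// => k /negbTE ->; exact: mul0r.
  rewrite -(S i (fun k => Phi u (Da k) f 0 z)) -(S j (fun k => Phi u (Da k) f 0 z)).
  rewrite !mulr_sumr -!sumrN -!big_split/=; apply: eq_bigr => k _.
  have := p3E al0 k i j z; move: (p3 al k i j z) (p2 al i j z) => x y e.
  have -> : al * (2 * (x * Phi u (Da k) f 0 z) + y * Phi u (DDa k k) f 0 z) =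
    2 * al * x * Phi u (Da k) f 0 z + al * y * Phi u (DDa k k) f 0 z by ring.
  by rewrite e; ring.
rewrite (p2C j i).
move: first second third bp bp1i bp1j bp2 bp2' P0 pp0 c0 (MP j i z z).
rewrite !expr0 !mulr1 !expr1.
move: (Phi u (DDa j i) f z z) (Phi u a f z z) (Phi u a f 0 z) => X1 X2 X3.
move: (\sum_(k < d) z ord0 k * _) (\sum_(k < d) Phi _ _ _ _ _) => X4 X5 Hf.
move: (Hf i) (Hf j) (l1n_ge0 z) => {Hf}.
move: (Phi u (Da i) f z z) (Phi u (Da i) f 0 z) (Phi u (Da j) f z z) (Phi u (Da j) f 0 z) => X6 X7 X8 X9.
move: (p al z) (p1 al i z) (p1 al j z) (p2 al i j z) (p (2 * al) z) (@cG R d) (l1n z) (d%:R : R).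
move=> x xi xj y P c N D hi hj N0 second third bp bpi bpj b2 b2' P0 x0 c0 h1.
have -> : y * X2 - xi * X8 - (xj * X6 - x * X1) - y * X3 -
   (- (y * X4) - xj * X7 - xi * X9 + al * y * X5) =
   x * X1 - xj * (X6 - X7) - xi * (X8 - X9) + y * (X2 - X3 + X4) - al * y * X5 by ring.
have y2 : `|y| * N ^+ 2 <= c * P.
  by move: b2'; rewrite -mulrA [c * al]mulrC -mulrA ler_pM2l.
have n1 : `|x * X1| <= c * P * M.
  by rewrite normrM (ger0_norm x0); apply: ler_pM.
have n2 (t e : R) : `|t| * N <= c * P -> `|e| <= M * N -> `|t * e| <= c * P * M.
  move=> ht he; rewrite normrM; apply: (@le_trans _ _ (`|t| * (M * N))); first exact: ler_wpM2l.
  by rewrite mulrCA mulrC; apply: ler_wpM2r.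
have n3 : `|y * (X2 - X3 + X4)| <= c * P * M.
  rewrite normrM; apply: (@le_trans _ _ (`|y| * (M * N ^+ 2))); first exact: ler_wpM2l.
  by rewrite mulrCA mulrC; apply: ler_wpM2r.
have n4 : `|al * y * X5| <= c * P * (D * M).
  by rewrite normrM normrM (gtr0_norm al0); apply: ler_pM => //; rewrite mulr_ge0// ltW.
have -> : c * (4 + D) * M * P = c * P * M + c * P * M + c * P * M + c * P * M + c * P * (D * M) by ring.
apply: (le_trans (ler_normB _ _)); apply: lerD n4.
apply: (le_trans (ler_normD _ _)); apply: lerD n3.
apply: (le_trans (ler_normB _ _)); apply: lerD (n2 _ _ bpi hj).
by apply: (le_trans (ler_normB _ _)); apply: lerD n1 (n2 _ _ bpj hi).
Qed.

End first_estimate.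

Section heat_partials.
Context {R : realType} {d : nat}.
Local Notation lam := (@lebesgue_rV R d).
Local Notation V := 'rV[R]_d.
Variables (al : R) (al0 : 0 < al).
Implicit Types (f : V -> R) (i j k : 'I_d).

(** The weak partial derivatives of a heat evolution are chosen arbitrarily
    among representatives; they agree almost everywhere with the convolutions
    with the derivatives of the kernel. *)
Lemma heat_partial1 f j : ulocal f ->
  measurable_fun [set: V] (weak_partial j (heat al f)) /\
  \forall x \ae lam, convol (p1 al j) f x = weak_partial j (heat al f) x.
Proof.
move=> uf; have mf := uf.1; rewrite heat_convol//.
apply: (weak_partial_ae (convol_weak_partial (kder_p0 al0 j) uf)); last exact: nearW.
by apply: measurable_convol => //; exact: measurable_heat_kernel.
Qed.

Lemma heat_partial2 f i j : ulocal f ->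
  measurable_fun [set: V] (weak_partials [:: i; j] (heat al f)) /\
  \forall x \ae lam, convol (p2 al i j) f x = weak_partials [:: i; j] (heat al f) x.
Proof.
move=> uf; have [m1 e1] := heat_partial1 j uf.
exact: (weak_partial_ae (convol_weak_partial (kder_p1 al0 i j) uf) m1 e1).
Qed.

Lemma heat_partial3 f k i j : ulocal f ->
  measurable_fun [set: V] (weak_partials [:: k; i; j] (heat al f)) /\
  \forall x \ae lam, convol (p3 al k i j) f x = weak_partials [:: k; i; j] (heat al f) x.
Proof.
move=> uf; have [m2 e2] := heat_partial2 i j uf.
exact: (weak_partial_ae (convol_weak_partial (kder_p2 al0 k i j) uf) m2 e2).
Qed.

End heat_partials.

Section first_estimate_pointwise.
Context {R : realType} {d : nat}.
Local Notation lam := (@lebesgue_rV R d).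
Local Notation V := 'rV[R]_d.
Local Notation p := (@heat_kernel R d).
Variables (q : \bar R) (r s : R).
Hypotheses (hq : (1 < q)%E) (hr : 1 < r) (hs : 1 < s).
Hypothesis hqrs : (q^-1 + (r%:E)^-1 + (s%:E)^-1 = 1)%E.
Variables (al : R) (al0 : 0 < al).
Implicit Types (u f v : V -> R) (A : V -> 'M[R]_d) (i j k l : 'I_d).

Lemma W2x_Lx (t : \bar R) f : W2x t f -> Lx t f. Proof. by case. Qed.
Lemma W2x_Lx1 (t : \bar R) f i : W2x t f -> Lx t (weak_partial i f).
Proof. by case=> _ /(_ i)[]. Qed.
Lemma W2x_Lx2 (t : \bar R) f i j : W2x t f -> Lx t (weak_partials [:: i; j] f).
Proof. by case=> _ _ /(_ i j)[]. Qed.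
Lemma W2x_weak1 (t : \bar R) f i : W2x t f -> is_weak_partial i f (weak_partial i f).
Proof. by case=> _ /(_ i)[w _] _; exact: weak_partialP. Qed.
Lemma W2x_weak2 (t : \bar R) f i j : W2x t f ->
  is_weak_partial i (weak_partial j f) (weak_partials [:: i; j] f).
Proof. by case=> _ _ /(_ i j)[w _]; exact: weak_partialP. Qed.

Lemma contract_hessianE A f : contract_hessian A f =
  fun x => \sum_(c : 'I_d * 'I_d) A x c.1 c.2 * weak_partials [:: c.1; c.2] f x.
Proof.
apply/funext => x; rewrite /contract_hessian.
exact: (pair_bigA _ (fun i j => A x i j * weak_partials [:: i; j] f x)).
Qed.

Lemma measurable_contract_hessian A f :
  (forall i j, measurable_fun [set: V] (fun x => A x i j)) ->
  (forall i j, measurable_fun [set: V] (weak_partials [:: i; j] f)) ->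
  measurable_fun [set: V] (contract_hessian A f).
Proof.
move=> mA mf; apply: measurable_sum => i; apply: measurable_sum => j.
by apply: measurable_funM; [exact: mA|exact: mf].
Qed.

(** Every pairing with a convolution is rewritten by Fubini's theorem as an
    integral of [Phi] against the kernel: translates along the diagonal when
    the kernel acts after a, translates of f alone when it acts before. *)
Lemma pairing_commutator u A f : Lx r%:E u ->
  (forall i j, Lx q (fun x => A x i j)) -> W2x s%:E f ->
  pairing u (commutator (heat al) (contract_hessian A) f) =
  \sum_(c : 'I_d * 'I_d)
    (\int[lam]_z (p al z * Phi u (fun x => A x c.1 c.2) (weak_partials [:: c.1; c.2] f) z z)
     - \int[lam]_z (p2 al c.1 c.2 z * Phi u (fun x => A x c.1 c.2) f 0 z)).
Proof.
move=> lu lA wf; have mu := Lx_meas lu.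
have lf := W2x_Lx wf; have uf := ulocal_Lx (ltW hs) lf.
pose a (c : 'I_d * 'I_d) x := A x c.1 c.2.
pose g (c : 'I_d * 'I_d) := weak_partials [:: c.1; c.2] f.
have la c : Lx q (a c) := lA c.1 c.2.
have lg c : Lx s%:E (g c) := W2x_Lx2 c.1 c.2 wf.
have [lT ET] := Phi_convol_sum hq hr hs hqrs lu la lg (L1_heat_kernel (d := d) al0).
have Cv c := Phi_convol hq hr hs hqrs lu (la c) lf (kder_L1 (kder_p1 al0 c.1 c.2)).
have lS : L1 lam (fun x => \sum_c u x * a c x * convol (p2 al c.1 c.2) f x).
  by apply: L1_sum => c; exact: (Cv c).1.
have mH : measurable_fun [set: V] (contract_hessian A (heat al f)).
  apply: measurable_contract_hessian => i j; first exact: Lx_meas (lA i j).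
  exact: (heat_partial2 al0 i j uf).1.
have mG : measurable_fun [set: V] (contract_hessian A f).
  apply: measurable_contract_hessian => i j; first exact: Lx_meas (lA i j).
  exact: Lx_meas (W2x_Lx2 i j wf).
have hG : heat al (contract_hessian A f) = convol (p al) (fun y => \sum_c a c y * g c y).
  by rewrite heat_convol// contract_hessianE.
transitivity (\int[lam]_x (u x * convol (p al) (fun y => \sum_c a c y * g c y) x -
    \sum_c u x * a c x * convol (p2 al c.1 c.2) f x)).
  apply: I_ae.
  - have mT : measurable_fun [set: V] (heat al (contract_hessian A f)).
      rewrite (heat_convol al0 mG).
      exact: (measurable_convol (measurable_heat_kernel al) mG).
    exact: (measurable_funM mu (measurable_funB mT mH)).
  - exact: L1_measurable (L1B lT lS).
  - have ae2 : \forall x \ae lam, forall c : 'I_d * 'I_d,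
        convol (p2 al c.1 c.2) f x = weak_partials [:: c.1; c.2] (heat al f) x.
      by apply: filter_forall => c; exact: (heat_partial2 al0 c.1 c.2 uf).2.
    apply: filterS ae2 => x Hx.
    rewrite /commutator hG mulrBr; apply: (congr1 (fun t => _ - t)).
    rewrite contract_hessianE mulr_sumr; apply: eq_bigr => c _.
    by rewrite -Hx mulrA.
rewrite (IB lT lS) ET (I_sum _ (fun c => (Cv c).1)) -sumrB.
by apply: eq_bigr => c _; rewrite (Cv c).2.
Qed.

Lemma pairing_laplacian_commutator u A f : Lx r%:E u ->
  (forall i j, W2x q (fun x => A x i j)) -> Lx s%:E f ->
  pairing u (laplacian_commutator A (heat al f)) =
  \sum_(c : 'I_d * 'I_d) \sum_(k < d)
    (2 * \int[lam]_z (p3 al k c.1 c.2 z * Phi u (weak_partial k (fun x => A x c.1 c.2)) f 0 z)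
     + \int[lam]_z (p2 al c.1 c.2 z * Phi u (weak_partials [:: k; k] (fun x => A x c.1 c.2)) f 0 z)).
Proof.
move=> lu wA lf; have mu := Lx_meas lu; have uf := ulocal_Lx (ltW hs) lf.
pose a1 (c : 'I_d * 'I_d) k := weak_partial k (fun x => A x c.1 c.2).
pose a2 (c : 'I_d * 'I_d) k := weak_partials [:: k; k] (fun x => A x c.1 c.2).
have l1 c k : Lx q (a1 c k) := W2x_Lx1 k (wA c.1 c.2).
have l2 c k : Lx q (a2 c k) := W2x_Lx2 k k (wA c.1 c.2).
have C1 c k := Phi_convol hq hr hs hqrs lu (l1 c k) lf (kder_L1 (kder_p2 al0 k c.1 c.2)).
have C2 c k := Phi_convol hq hr hs hqrs lu (l2 c k) lf (kder_L1 (kder_p1 al0 c.1 c.2)).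
have lS c k := L1D (L1Z 2 (C1 c k).1) (C2 c k).1.
pose F x := \sum_(c : 'I_d * 'I_d) \sum_(k < d)
    (2 * (u x * a1 c k x * convol (p3 al k c.1 c.2) f x) + u x * a2 c k x * convol (p2 al c.1 c.2) f x).
have lF : L1 lam F by apply: L1_sum => c; apply: L1_sum => k; exact: lS.
have LE x : u x * laplacian_commutator A (heat al f) x = \sum_(c : 'I_d * 'I_d) \sum_(k < d)
    (2 * (u x * a1 c k x * weak_partials [:: k; c.1; c.2] (heat al f) x) +
     u x * a2 c k x * weak_partials [:: c.1; c.2] (heat al f) x).
  rewrite /laplacian_commutator (pair_bigA _ (fun i j => 2 * (\sum_(k < d) weak_partial k (fun y => A y i j) x *
     weak_partials [:: k; i; j] (heat al f) x) + (\sum_(k < d) weak_partials [:: k; k] (fun y => A y i j) x) *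
     weak_partials [:: i; j] (heat al f) x))/= mulr_sumr; apply: eq_bigr => c _.
  rewrite mulrDr mulr_suml !mulr_sumr -big_split/=; apply: eq_bigr => k _.
  have rearrange (t b1 e1 b2 e2 : R) : t * (2 * (b1 * e1)) + t * (b2 * e2) = 2 * (t * b1 * e1) + t * b2 * e2.
    by ring.
  exact: rearrange.
transitivity (\int[lam]_x F x).
  apply: I_ae.
  - rewrite (_ : (fun x => _) = (fun x => \sum_(c : 'I_d * 'I_d) \sum_(k < d)
    (2 * (u x * a1 c k x * weak_partials [:: k; c.1; c.2] (heat al f) x) +
     u x * a2 c k x * weak_partials [:: c.1; c.2] (heat al f) x))); last by apply/funext => x; exact: LE.
    apply: measurable_sum => c; apply: measurable_sum => k.
    have m3 := (heat_partial3 al0 k c.1 c.2 uf).1; have m2 := (heat_partial2 al0 c.1 c.2 uf).1.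
    apply: measurable_funD; last exact: (measurable_funM (measurable_funM mu (Lx_meas (l2 c k))) m2).
    apply: measurable_funM; first exact: measurable_cst.
    exact: (measurable_funM (measurable_funM mu (Lx_meas (l1 c k))) m3).
  - exact: L1_measurable lF.
  - have ae2 : \forall x \ae lam, forall c : 'I_d * 'I_d,
        convol (p2 al c.1 c.2) f x = weak_partials [:: c.1; c.2] (heat al f) x.
      by apply: filter_forall => c; exact: (heat_partial2 al0 c.1 c.2 uf).2.
    have ae3 : \forall x \ae lam, forall c : 'I_d * ('I_d * 'I_d),
        convol (p3 al c.1 c.2.1 c.2.2) f x = weak_partials [:: c.1; c.2.1; c.2.2] (heat al f) x.
      by apply: filter_forall => c; exact: (heat_partial3 al0 c.1 c.2.1 c.2.2 uf).2.
    apply: filterS2 ae2 ae3 => x H2 H3.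
    rewrite LE; apply: eq_bigr => c _; apply: eq_bigr => k _.
    by rewrite -H2 -(H3 (k, c)).
rewrite /F I_sum; last by move=> c; apply: L1_sum => k; exact: lS.
apply: eq_bigr => c _; rewrite I_sum; last by move=> k; exact: lS.
apply: eq_bigr => k _.
by rewrite (ID (L1Z 2 (C1 c k).1) (C2 c k).1) (IZ 2 (C1 c k).1) (C1 c k).2 (C2 c k).2.
Qed.

Lemma commutator_estimate u A f : Lx r%:E u ->
  (forall i j, W2x q (fun x => A x i j)) -> W2x s%:E f ->
  `|pairing u (commutator (heat al) (contract_hessian A) f)
    - al * pairing u (laplacian_commutator A (heat al f))| <=
  @cG R d * (4 + d%:R) * (nrm r%:E u * nrm s%:E f *
    \sum_(c : 'I_d * 'I_d) \sum_(k < d) \sum_(l < d) nrm q (weak_partials [:: k; l] (fun x => A x c.1 c.2))).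
Proof.
move=> lu wA wf.
rewrite (pairing_commutator lu (fun i j => W2x_Lx (wA i j)) wf).
rewrite (pairing_laplacian_commutator lu wA (W2x_Lx wf)).
rewrite mulr_sumr -sumrB !mulr_sumr.
apply: (le_trans (ler_norm_sum _ _ _)); apply: ler_sum => c _.
have wa := wA c.1 c.2.
exact: (commutator_remainder hq hr hs hqrs al0 c.1 c.2 lu (W2x_Lx wa)
  (fun k => W2x_Lx1 k wa) (fun k l => W2x_Lx2 k l wa) (fun k => W2x_weak1 k wa) (fun k l => W2x_weak2 k l wa)
  (W2x_Lx wf) (fun k => W2x_Lx1 k wf) (fun k l => W2x_Lx2 k l wf) (fun k => W2x_weak1 k wf) (fun k l => W2x_weak2 k l wf)).
Qed.

End first_estimate_pointwise.

(** * Double integrals against two kernels *)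

Section double_integrals.
Context {R : realType} {d : nat}.
Local Notation lam := (@lebesgue_rV R d).
Local Notation V := 'rV[R]_d.
Implicit Types (K L P : V -> R) (F G : V * V -> R).

Definition iint K L F := \int[lam]_y (K y * \int[lam]_z (L z * F (y, z))).

Lemma iint_row L F y : L1 lam L -> BM F -> L1 lam (fun z => L z * F (y, z)).
Proof.
move=> lL [mF [C HC]]; apply: (L1_BM lL); split.
  by apply: (measurableT_comp mF); exact: measurable_pair1.
by exists C.
Qed.

Lemma iint_inner L F : L1 lam L -> BM F -> BM (fun y => \int[lam]_z (L z * F (y, z))).
Proof.
move=> lL bF; have [mF [C HC]] := bF; split.
  apply: (@measurable_param _ _ V V R lam (fun c : V * V => L c.2 * F c)).
  by apply: measurable_funM => //; exact: (measurableT_comp (L1_measurable lL)).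
exists (\int[lam]_z (C * `|L z|)) => y.
apply: (I_norm_le (iint_row y lL bF) (L1Z C (L1_norm lL))) => z.
by rewrite normrM mulrC ler_wpM2r.
Qed.

Lemma iint_outer K L F : L1 lam K -> L1 lam L -> BM F ->
  L1 lam (fun y => K y * \int[lam]_z (L z * F (y, z))).
Proof. by move=> lK lL bF; exact: L1_BM lK (iint_inner lL bF). Qed.

Lemma iintD K L F G : L1 lam K -> L1 lam L -> BM F -> BM G ->
  iint K L (fun c => F c + G c) = iint K L F + iint K L G.
Proof.
move=> lK lL bF bG; rewrite /iint -(ID (iint_outer lK lL bF) (iint_outer lK lL bG)).
apply: I_ext => y; rewrite -mulrDr; apply: (congr1 (fun t => K y * t)).
rewrite -(ID (iint_row y lL bF) (iint_row y lL bG)); apply: I_ext => z.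
by rewrite mulrDr.
Qed.

Lemma iintN K L F : L1 lam K -> L1 lam L -> BM F -> iint K L (fun c => - F c) = - iint K L F.
Proof.
move=> lK lL bF; rewrite /iint -(IN (iint_outer lK lL bF)).
apply: I_ext => y; rewrite -mulrN; apply: (congr1 (fun t => K y * t)).
rewrite -(IN (iint_row y lL bF)); apply: I_ext => z.
by rewrite mulrN.
Qed.

Lemma iintB K L F G : L1 lam K -> L1 lam L -> BM F -> BM G ->
  iint K L (fun c => F c - G c) = iint K L F - iint K L G.
Proof. by move=> lK lL bF bG; rewrite (iintD lK lL bF (BM_N bG)) (iintN lK lL bG). Qed.

Lemma iint_reflect1 K L F : L1 lam K -> L1 lam L -> BM F -> (forall y, K (- y) = K y) ->
  iint K L (fun c => F (- c.1, c.2)) = iint K L F.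
Proof.
move=> lK lL bF eK; rewrite /iint -[RHS](I_reflect 0 (L1_measurable (iint_outer lK lL bF))).
by apply: I_ext => y; rewrite sub0r eK.
Qed.

Lemma iint_reflect2 K L F : L1 lam K -> L1 lam L -> BM F -> (forall y, L (- y) = L y) ->
  iint K L (fun c => F (c.1, - c.2)) = iint K L F.
Proof.
move=> lK lL bF eL; apply: I_ext => y; apply: (congr1 (fun t => K y * t)).
rewrite -[RHS](I_reflect 0 (L1_measurable (iint_row y lL bF))).
by apply: I_ext => z; rewrite sub0r eL.
Qed.

Lemma BM_comp F (h : V * V -> V * V) : measurable_fun [set: V * V] h -> BM F -> BM (fun c => F (h c)).
Proof. by move=> mh [mF [C HC]]; split; [exact: measurableT_comp|exists C => c]. Qed.

Lemma iint_reflect K L F : L1 lam K -> L1 lam L -> BM F ->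
  (forall y, K (- y) = K y) -> (forall y, L (- y) = L y) ->
  iint K L (fun c => F (- c.1, - c.2)) = iint K L F.
Proof.
move=> lK lL bF eK eL.
have m1 : measurable_fun [set: V * V] (fun c : V * V => (- c.1, c.2)).
  by apply: measurable_fun_pair => //; apply: measurable_opprV.
have := iint_reflect2 lK lL (BM_comp m1 bF) eL; rewrite /= => ->.
exact: iint_reflect1.
Qed.

Lemma iint_swap K L F : L1 lam K -> L1 lam L -> BM F ->
  iint K L F = \int[lam]_z (L z * \int[lam]_y (K y * F (y, z))).
Proof.
move=> lK lL bF; have [mF [C HC]] := bF.
have mK := L1_measurable lK; have mL := L1_measurable lL.
pose G (c : V * V) := K c.1 * (L c.2 * F c).
have mG : measurable_fun [set: V * V] G.
  apply: measurable_funM; first exact: (measurableT_comp mK).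
  by apply: measurable_funM => //; exact: (measurableT_comp mL).
have fin : (\int[lam]_z \int[lam]_y `|G (y, z)|%:E < +oo)%E.
  have lKC : L1 lam (fun z => (C * \int[lam]_y `|K y|) * `|L z|) := L1Z _ (L1_norm lL).
  apply: le_lt_trans (_ : (\int[lam]_z ((C * \int[lam]_y `|K y|) * `|L z|)%:E < +oo)%E); last first.
    by rewrite -(I_EFin lKC) ltry.
  have inner z : (\int[lam]_y `|G (y, z)|%:E <= ((C * \int[lam]_y `|K y|) * `|L z|)%:E)%E.
    have lz : L1 lam (fun y => G (y, z)).
      apply: (@L1_le _ _ _ _ _ (fun y => (C * `|L z|) * `|K y|)).
      - by apply: (measurableT_comp mG); exact: measurable_pair2.
      - exact: L1Z (L1_norm lK).
      - move=> y; rewrite /G !normrM mulrC; apply: ler_wpM2r => //.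
        by rewrite mulrC ler_wpM2r.
    rewrite -(I_abs_EFin lz) lee_fin.
    have -> : (C * \int[lam]_y `|K y|) * `|L z| = \int[lam]_y ((C * `|L z|) * `|K y|).
      by rewrite (IZ _ (L1_norm lK)) mulrAC.
    apply: (I_le (L1_norm lz) (L1Z _ (L1_norm lK))) => y.
    by rewrite /G !normrM mulrC; apply: ler_wpM2r => //; rewrite mulrC ler_wpM2r.
  apply: ge0_le_integral => //.
  - move=> z _; exact: integral_ge0.
  - apply: (measurable_fun_fubini_tonelli_G (m1 := lam) (fun c : V * V => `|G c|%:E)) => //.
    by apply/measurable_EFinP; exact: measurableT_comp.
  - by apply/measurable_EFinP; exact: L1_measurable lKC.
have [_ _ E _] := Fubini_R mG fin.
rewrite /iint; transitivity (\int[lam]_y \int[lam]_z G (y, z)).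
  apply: I_ext => y; rewrite -(IZ _ (iint_row y lL bF)); exact: I_ext.
rewrite E; apply: I_ext => z.
have lz : L1 lam (fun y => K y * F (y, z)).
  apply: (L1_BM lK); split; last by exists C => y.
  by apply: (measurableT_comp mF); exact: measurable_pair2.
by rewrite -(IZ _ lz); apply: I_ext => y; rewrite /G mulrCA.
Qed.

Lemma iint_bound K L F P (c : R) : L1 lam K -> L1 lam L -> BM F -> L1 lam P ->
  \int[lam]_z P z = 1 ->
  (forall y z, `|K y * L z * F (y, z)| <= c * P y * P z) -> `|iint K L F| <= c.
Proof.
move=> lK lL bF lP P1 H; have lo := iint_outer lK lL bF.
have -> : c = \int[lam]_y (c * P y) by rewrite (IZ _ lP) P1 mulr1.
apply: (I_norm_le lo (L1Z c lP)) => y.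
have -> : c * P y = \int[lam]_z (c * P y * P z) by rewrite (IZ _ lP) P1 mulr1.
rewrite -(IZ _ (iint_row y lL bF)).
apply: (I_norm_le (L1Z _ (iint_row y lL bF)) (L1Z _ lP)) => z.
by rewrite mulrA.
Qed.

End double_integrals.

(** * The second estimate at a fixed time *)

Section second_estimate.
Context {R : realType} {d : nat}.
Local Notation lam := (@lebesgue_rV R d).
Local Notation V := 'rV[R]_d.
Local Notation p := (@heat_kernel R d).
Variables (q : \bar R) (r s : R).
Hypotheses (hq : (1 < q)%E) (hr : 1 < r) (hs : 1 < s).
Hypothesis hqrs : (q^-1 + (r%:E)^-1 + (s%:E)^-1 = 1)%E.
Implicit Types (u v a : V -> R) (A : V -> 'M[R]_d) (i j k l : 'I_d).
Let r0 : (0 <= r%:E)%E. Proof. by rewrite lee_fin (le_trans _ (ltW hr)). Qed.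
Let s0 : (0 <= s%:E)%E. Proof. by rewrite lee_fin (le_trans _ (ltW hs)). Qed.
Let s1 : (1 <= s%:E)%E. Proof. by rewrite lee_fin ltW. Qed.

Lemma Phi_BM2 u a v (m1 m2 : V * V -> V) : Lx r%:E u -> Lx q a -> Lx s%:E v ->
  measurable_fun [set: V * V] m1 -> measurable_fun [set: V * V] m2 ->
  BM (fun c => Phi u a v (m1 c) (m2 c)).
Proof.
move=> lu la lv mm1 mm2; split; first exact: (measurable_Phi lu la lv mm1 mm2).
by exists (nrm r%:E u * nrm s%:E v * nrm q a) => z; exact: (Phi_bound hq hr hs hqrs).
Qed.

(** Translating by w2 exchanges u and its translate. *)
Lemma Phi_sym u a w1 w2 : Lx r%:E u -> Lx s%:E u -> Lx q a ->
  Phi u a u w1 w2 = Phi u a u (w1 - w2) (- w2).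
Proof.
move=> lr ls la; rewrite (Phi_shift hq hr hs hqrs w1 w2 w2 lr la ls).
apply: I_ext => x.
have -> : x - (w1 - w2) = x + w2 - w1 by apply/rowP => k; rewrite !mxE; ring.
by rewrite addrK opprK [u x * _]mulrC.
Qed.

(** The contribution of the coefficient a = a_ij to the pairing of u with the
    commutator applied to the heat evolution of u. *)
Definition commutator_term (al : R) u a i j :=
  iint (p al) (p2 al i j) (fun e => Phi u a u e.1 (e.1 + e.2) - Phi u a u 0 (e.1 + e.2)).

Section fixed_time.
Variables (al : R) (al0 : 0 < al).

Let lp : L1 lam (p al). Proof. exact: L1_heat_kernel. Qed.
Let lp2 i j : L1 lam (p2 al i j). Proof. exact: (kder_L1 (kder_p1 al0 i j)). Qed.

Let mfst : measurable_fun [set: V * V] (fun c : V * V => c.1). Proof. exact: measurable_fst. Qed.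
Let msnd : measurable_fun [set: V * V] (fun c : V * V => c.2). Proof. exact: measurable_snd. Qed.
Let madd : measurable_fun [set: V * V] (fun c : V * V => c.1 + c.2). Proof. exact: measurable_addrV. Qed.
Let mcst : measurable_fun [set: V * V] (fun c : V * V => 0 : V). Proof. exact: measurable_cst. Qed.

(** The term u P (a d_ij P u), before the integration over the translation y
    coming from the outer semigroup; the bound uniform in y is what that
    integration requires. *)
Lemma commutator_term_heat_outside u a i j y : Lx r%:E u -> Lx s%:E u -> Lx q a ->
  [/\ L1 lam (fun x => u x * (a (x - y) * convol (p2 al i j) u (x - y))),
      (\int[lam]_x `|u x * (a (x - y) * convol (p2 al i j) u (x - y))| <=
        \int[lam]_z (`|p2 al i j z| * (nrm r%:E u * nrm s%:E u * nrm q a))) &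
      \int[lam]_x (u x * (a (x - y) * convol (p2 al i j) u (x - y))) =
      \int[lam]_z (p2 al i j z * Phi u a u y (y + z))].
Proof.
move=> lr ls la; have mu := Lx_meas lr; have ma := Lx_meas la.
pose w x := u (x + y) * a x.
have mw : measurable_fun [set: V] w by apply: measurable_funM => //; exact: measurable_shiftD.
have E x z : w x * u (x - z) = u (x + y) * u (x + y - (y + z)) * a (x + y - y).
  rewrite /w addrK (_ : x + y - (y + z) = x - z); first by ring.
  by apply/rowP => k; rewrite !mxE; ring.
have HC z : (\int[lam]_x `|w x * u (x - z)|%:E <= (nrm r%:E u * nrm s%:E u * nrm q a)%:E)%E.
  apply: le_trans (Phi_abs_EFin hq hr hs hqrs y (y + z) lr la ls).
  rewrite -(integral_shift y (f := fun x => `|u x * u (x - (y + z)) * a (x - y)|%:E)).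
    by rewrite le_eqVlt; apply/predU1l; apply: eq_integral => x _; rewrite E.
  by apply/measurable_EFinP; apply: measurableT_comp => //; exact: L1_measurable (Phi_L1 hq hr hs hqrs _ _ lr la ls).
have [l1 _ E1] := convol_swap (lp2 i j) mw mu HC.
have habs := convol_abs (lp2 i j) mw mu HC.
have S x : u x * (a (x - y) * convol (p2 al i j) u (x - y)) = w (x - y) * convol (p2 al i j) u (x - y).
  by rewrite /w subrK mulrA.
have lS : L1 lam (fun x => u x * (a (x - y) * convol (p2 al i j) u (x - y))).
  by apply: (L1_ext _ (L1_shift y l1)) => x; rewrite S.
split; first exact: lS.
- have l1n := L1_norm l1.
  rewrite (_ : \int[lam]_x `|u x * (a (x - y) * convol (p2 al i j) u (x - y))| =
      \int[lam]_x `|w (x - y) * convol (p2 al i j) u (x - y)|); last by apply: I_ext => x; rewrite S.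
  by rewrite (I_shift y (L1_measurable l1n)) -lee_fin (I_abs_EFin l1).
- rewrite (_ : \int[lam]_x (u x * (a (x - y) * convol (p2 al i j) u (x - y))) =
      \int[lam]_x (w (x - y) * convol (p2 al i j) u (x - y))); last by apply: I_ext => x; rewrite S.
  rewrite (I_shift y (L1_measurable l1)) E1; apply: I_ext => z; apply: (congr1 (fun t => p2 al i j z * t)).
  rewrite (Phi_shift hq hr hs hqrs y (y + z) y lr la ls).
  by apply: I_ext => x; rewrite E.
Qed.

(** The term u a d_ij P P u; the two kernels appear in the order opposite to
    that of [iint], whence a second use of Fubini's theorem. *)
Lemma commutator_term_heat_inside u a i j : Lx r%:E u -> Lx s%:E u -> Lx q a ->
  L1 lam (fun x => u x * a x * convol (p2 al i j) (convol (p al) u) x) /\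
  \int[lam]_x (u x * a x * convol (p2 al i j) (convol (p al) u) x) =
  iint (p al) (p2 al i j) (fun c => Phi u a u 0 (c.1 + c.2)).
Proof.
move=> lr ls la; have mu := Lx_meas lr; have ma := Lx_meas la.
have mg : measurable_fun [set: V] (convol (p al) u) by apply: measurable_convol => //; exact: measurable_heat_kernel.
have mw : measurable_fun [set: V] (fun x => u x * a x) by exact: measurable_funM.
pose w y x := u (x + y) * a (x + y).
have mwy y : measurable_fun [set: V] (w y) by apply: measurable_funM; exact: measurable_shiftD.
have E y x z : w y x * u (x - z) = u (x + y) * u (x + y - (y + z)) * a (x + y - 0).
  rewrite /w subr0 (_ : x + y - (y + z) = x - z); first by ring.
  by apply/rowP => k; rewrite !mxE; ring.
have HC y z : (\int[lam]_x `|w y x * u (x - z)|%:E <= (nrm r%:E u * nrm s%:E u * nrm q a)%:E)%E.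
  apply: le_trans (Phi_abs_EFin hq hr hs hqrs 0 (y + z) lr la ls).
  rewrite -(integral_shift y (f := fun x => `|u x * u (x - (y + z)) * a (x - 0)|%:E)).
    by rewrite le_eqVlt; apply/predU1l; apply: eq_integral => x _; rewrite E.
  by apply/measurable_EFinP; apply: measurableT_comp => //; exact: L1_measurable (Phi_L1 hq hr hs hqrs _ _ lr la ls).
have sw y := convol_swap lp (mwy y) mu (HC y).
have HC2 y : (\int[lam]_x `|u x * a x * convol (p al) u (x - y)|%:E <=
    (\int[lam]_z (`|p al z| * (nrm r%:E u * nrm s%:E u * nrm q a)))%:E)%E.
  apply: le_trans (convol_abs lp (mwy y) mu (HC y)).
  rewrite -(integral_shift y (f := fun x => `|u x * a x * convol (p al) u (x - y)|%:E)).
    by rewrite le_eqVlt; apply/predU1l; apply: eq_integral => x _; rewrite addrK.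
  apply/measurable_EFinP; apply: measurableT_comp => //.
  exact: (measurable_funM mw (measurable_shift y mg)).
have [l1 _ E1] := convol_swap (lp2 i j) mw mg HC2.
split; first exact: l1.
rewrite E1 (iint_swap lp (lp2 i j) (Phi_BM2 lr la ls mcst madd)).
apply: I_ext => y; apply: (congr1 (fun t => p2 al i j y * t)).
have [ly _ Ey] := sw y.
transitivity (\int[lam]_x (w y x * convol (p al) u x)).
  rewrite -(I_shiftD y (measurable_funM mw (measurable_shift y mg))).
  by apply: I_ext => x /=; rewrite addrK.
rewrite Ey; apply: I_ext => z; apply: (congr1 (fun t => p al z * t)); rewrite /= [z + y]addrC.
rewrite (Phi_shift hq hr hs hqrs 0 (y + z) y lr la ls).
by apply: I_ext => x; rewrite E.
Qed.

Lemma pairing_commutator_heat u A : Lx r%:E u -> Lx s%:E u ->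
  (forall i j, Lx q (fun x => A x i j)) ->
  pairing u (commutator (heat al) (contract_hessian A) (heat al u)) =
  \sum_(c : 'I_d * 'I_d) commutator_term al u (fun x => A x c.1 c.2) c.1 c.2.
Proof.
move=> lr ls lA; have mu := Lx_meas lr; have uu := ulocal_Lx (ltW hs) ls.
have uu1 := ulocal_convol lp uu.
have mp := measurable_heat_kernel (d := d) al.
have h1 := heat_convol al0 mu.
pose a (c : 'I_d * 'I_d) x := A x c.1 c.2.
have la c : Lx q (a c) := lA c.1 c.2.
pose G := contract_hessian A (heat al u).
have mG : measurable_fun [set: V] G.
  apply: measurable_contract_hessian => i j; first exact: Lx_meas (lA i j).
  exact: (heat_partial2 al0 i j uu).1.
have mH : measurable_fun [set: V] (contract_hessian A (heat al (heat al u))).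
  apply: measurable_contract_hessian => i j; first exact: Lx_meas (lA i j).
  by rewrite h1; exact: (heat_partial2 al0 i j uu1).1.
have aeG : \forall x \ae lam, G x = \sum_c a c x * convol (p2 al c.1 c.2) u x.
  have ae2 : \forall x \ae lam, forall c : 'I_d * 'I_d,
      convol (p2 al c.1 c.2) u x = weak_partials [:: c.1; c.2] (heat al u) x.
    by apply: filter_forall => c; exact: (heat_partial2 al0 c.1 c.2 uu).2.
  by apply: filterS ae2 => x Hx; rewrite /G contract_hessianE; apply: eq_bigr => c _; rewrite -Hx.
have aeH : \forall x \ae lam, contract_hessian A (heat al (heat al u)) x =
    \sum_c a c x * convol (p2 al c.1 c.2) (convol (p al) u) x.
  have ae2 : \forall x \ae lam, forall c : 'I_d * 'I_d,
      convol (p2 al c.1 c.2) (convol (p al) u) x = weak_partials [:: c.1; c.2] (heat al (heat al u)) x.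
    by apply: filter_forall => c; rewrite h1; exact: (heat_partial2 al0 c.1 c.2 uu1).2.
  by apply: filterS ae2 => x Hx; rewrite contract_hessianE; apply: eq_bigr => c _; rewrite -Hx.
have T1 c y := commutator_term_heat_outside c.1 c.2 y lr ls (la c).
have T2 c := commutator_term_heat_inside c.1 c.2 lr ls (la c).
pose S y x := \sum_c u x * (a c (x - y) * convol (p2 al c.1 c.2) u (x - y)).
have lS y : L1 lam (S y) by apply: L1_sum => c; case: (T1 c y).
have aeS y : \forall x \ae lam, u x * G (x - y) = S y x.
  by apply: filterS (ae_shift y aeG) => x ->; rewrite mulr_sumr.
have muG y : measurable_fun [set: V] (fun x => u x * G (x - y)).
  exact: (measurable_funM mu (measurable_shift y mG)).
pose C := \sum_c \int[lam]_z (`|p2 al c.1 c.2 z| * (nrm r%:E u * nrm s%:E u * nrm q (a c))).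
have HC y : (\int[lam]_x `|u x * G (x - y)|%:E <= C%:E)%E.
  rewrite (_ : (\int[lam]_x `|u x * G (x - y)|%:E)%E = (\int[lam]_x `|S y x|%:E)%E); last first.
    apply: ae_eq_integral => //.
    - by apply/measurable_EFinP; apply: measurableT_comp => //; exact: muG.
    - by apply/measurable_EFinP; apply: measurableT_comp => //; exact: L1_measurable (lS y).
    - by apply: filterS (aeS y) => x -> _.
  rewrite -(I_abs_EFin (lS y)) lee_fin.
  have ln c : L1 lam (fun x => `|u x * (a c (x - y) * convol (p2 al c.1 c.2) u (x - y))|).
    by apply: L1_norm; case: (T1 c y).
  apply: (le_trans (I_le (L1_norm (lS y)) (L1_sum _ ln) (fun x => ler_norm_sum _ _ _))).
  by rewrite (I_sum _ ln); apply: ler_sum => c _; case: (T1 c y).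
have [l1 _ E1] := convol_swap lp mu mG HC.
have lH : L1 lam (fun x => \sum_c u x * a c x * convol (p2 al c.1 c.2) (convol (p al) u) x).
  by apply: L1_sum => c; exact: (T2 c).1.
have bm1 c : BM (fun e : V * V => Phi u (a c) u e.1 (e.1 + e.2)) := Phi_BM2 lr (la c) ls mfst madd.
have bm2 c : BM (fun e : V * V => Phi u (a c) u 0 (e.1 + e.2)) := Phi_BM2 lr (la c) ls mcst madd.
transitivity (\int[lam]_x (u x * convol (p al) G x -
    \sum_c u x * a c x * convol (p2 al c.1 c.2) (convol (p al) u) x)).
  apply: I_ae.
  - have mT : measurable_fun [set: V] (heat al G).
      by rewrite (heat_convol al0 mG); exact: (measurable_convol mp mG).
    exact: (measurable_funM mu (measurable_funB mT mH)).
  - exact: L1_measurable (L1B l1 lH).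
  - apply: filterS aeH => x Hx; rewrite /commutator -/G (heat_convol al0 mG) mulrBr Hx mulr_sumr.
    by apply: (congr1 (fun t => _ - t)); apply: eq_bigr => c _; rewrite mulrA.
rewrite (IB l1 lH) E1 (I_sum _ (fun c => (T2 c).1)).
rewrite (_ : \int[lam]_y (p al y * \int[lam]_x (u x * G (x - y))) =
   \sum_c iint (p al) (p2 al c.1 c.2) (fun e => Phi u (a c) u e.1 (e.1 + e.2))); last first.
  rewrite -(I_sum _ (fun c => iint_outer lp (lp2 c.1 c.2) (bm1 c))).
  apply: I_ext => y; rewrite -mulr_sumr; apply: (congr1 (fun t => p al y * t)).
  rewrite (I_ae (muG y) (L1_measurable (lS y)) (aeS y)) (I_sum _ (fun c => let: And3 x _ _ := T1 c y in x)).
  by apply: eq_bigr => c _; case: (T1 c y).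
rewrite -sumrB; apply: eq_bigr => c _.
by rewrite (T2 c).2 /commutator_term (iintB lp (lp2 c.1 c.2) (bm1 c) (bm2 c)).
Qed.

(** The second difference of a in the directions e.1 and e.2, paired with u
    and a translate of u. *)
Definition second_difference u a (e : V * V) : R :=
  Phi u a u 0 (e.1 + e.2) - Phi u a u e.1 (e.1 + e.2)
  - Phi u a u e.2 (e.1 + e.2) + Phi u a u (e.1 + e.2) (e.1 + e.2).

Let mopp1 : measurable_fun [set: V * V] (fun c : V * V => (- c.1, c.2)).
Proof. by apply: measurable_fun_pair => //; apply: measurable_opprV. Qed.
Let mopp : measurable_fun [set: V * V] (fun c : V * V => (- c.1, - c.2)).
Proof. by apply: measurable_fun_pair => //; apply: measurable_opprV. Qed.

Lemma second_difference_BM u a : Lx r%:E u -> Lx s%:E u -> Lx q a -> BM (second_difference u a).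
Proof.
move=> lr ls la; have b m1 m2 := @Phi_BM2 u a u m1 m2 lr la ls.
exact: (BM_D (BM_B (BM_B (b _ _ mcst madd) (b _ _ mfst madd)) (b _ _ msnd madd)) (b _ _ madd madd)).
Qed.

(** Exchanging the two copies of u and reflecting both variables, under which
    the kernels are even, turns the first differences of a into second
    differences; these may further be averaged under reflection of the first
    variable. *)
Lemma commutator_symmetrised u a i j : Lx r%:E u -> Lx s%:E u -> Lx q a ->
  commutator_term al u a i j =
  - 4^-1 * iint (p al) (p2 al i j) (fun e => second_difference u a e + second_difference u a (- e.1, e.2)).
Proof.
move=> lr ls la; have lpp := lp2 i j.
have b m1 m2 := @Phi_BM2 u a u m1 m2 lr la ls.
pose F0 (e : V * V) := Phi u a u 0 (e.1 + e.2).
pose F1 (e : V * V) := Phi u a u e.1 (e.1 + e.2).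
have b0 : BM F0 := b _ _ mcst madd.
have b1 : BM F1 := b _ _ mfst madd.
have ep := heat_kernel_even (R := R) (d := d) al.
have ep2 := p2_even (R := R) (d := d) al i j.
have bD := second_difference_BM lr ls la.
have D0 : iint (p al) (p2 al i j) (second_difference u a) =
    2 * (iint (p al) (p2 al i j) F0 - iint (p al) (p2 al i j) F1).
  pose F2 (e : V * V) := F1 (- e.1, - e.2).
  pose F3 (e : V * V) := F0 (- e.1, - e.2).
  have b2 : BM F2 := BM_comp mopp b1.
  have b3 : BM F3 := BM_comp mopp b0.
  have -> : second_difference u a = (fun e => F0 e - F1 e - F2 e + F3 e).
    apply/funext => e; rewrite /second_difference /F2 /F3 /F0 /F1 /=.
    rewrite [Phi u a u e.2 _](Phi_sym _ _ lr ls la) [Phi u a u (e.1 + e.2) _](Phi_sym _ _ lr ls la).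
    have -> : e.2 - (e.1 + e.2) = - e.1 by apply/rowP => k; rewrite !mxE; ring.
    by rewrite subrr opprD.
  rewrite (iintD lp lpp (BM_B (BM_B b0 b1) b2) b3) (iintB lp lpp (BM_B b0 b1) b2) (iintB lp lpp b0 b1).
  have E2 : iint (p al) (p2 al i j) F2 = iint (p al) (p2 al i j) F1 := iint_reflect lp lpp b1 ep ep2.
  have E3 : iint (p al) (p2 al i j) F3 = iint (p al) (p2 al i j) F0 := iint_reflect lp lpp b0 ep ep2.
  rewrite E2 E3; move: (iint _ _ F0) (iint _ _ F1) => x y; ring.
rewrite /commutator_term (iintB lp lpp b1 b0) -/F0 -/F1 (iintD lp lpp bD (BM_comp mopp1 bD)).
have -> : iint (p al) (p2 al i j) (fun e => second_difference u a (- e.1, e.2)) = iint (p al) (p2 al i j) (second_difference u a).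
  exact: (iint_reflect1 lp lpp bD ep).
rewrite D0; move: (iint _ _ F0) (iint _ _ F1) => x y; by field.
Qed.

(** The second differences in the directions (y, z) and (- y, z) are those of
    the same function of a, up to a sign and a translation by y, paired with u
    and u (. - y - z) in the first case and with u (. - y) and u (. - z) in
    the second. Their sum is thus paired with the difference of these
    products, which is small when the translation by y moves u little. *)
Lemma second_difference_symmetrised_bound u a (Da : 'I_d -> V -> R) (DDa : 'I_d -> 'I_d -> V -> R) (M : R) (e : V * V) :
  Lx r%:E u -> Lx s%:E u ->
  Lx q a -> (forall k, Lx q (Da k)) -> (forall k l, Lx q (DDa k l)) ->
  (forall k, is_weak_partial k a (Da k)) -> (forall k l, is_weak_partial k (Da l) (DDa k l)) ->
  (forall k l, nrm q (DDa k l) <= M) ->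
  `|second_difference u a e + second_difference u a (- e.1, e.2)| <=
  M * (omega r u e.1 * nrm s%:E u + nrm r%:E u * omega s u e.1) * (l1n e.1 * l1n e.2).
Proof.
case: e => y z lr ls la lDa lDDa wa wDa HM; rewrite /=.
pose u1 x := u (x - y); pose v1 x := u (x - (y + z)) - u (x - z).
have lr1 : Lx r%:E u1 := Lx_shift y r0 lr.
have ld : Lx r%:E (fun x => u x - u1 x) := Lx_diff (ltW hr) y lr.
have lv : Lx s%:E v1 := LxB s1 (Lx_shift (y + z) s0 ls) (Lx_shift z s0 ls).
have nv : nrm s%:E v1 = omega s u y.
  rewrite /omega -(nrm_shift z s0 (Lx_diff (ltW hs) y ls)) -(nrmN s0).
    congr (nrm _ _); apply/funext => x; rewrite /v1 opprB.
    by have -> : x - z - y = x - (y + z) by apply/rowP => k; rewrite !mxE; ring.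
  exact: lv.
pose H1 w := Phi (fun x => u x - u1 x) a u w (y + z).
pose H2 w := Phi u1 a v1 w 0.
have B1 := @second_difference_bound R d H1 (fun k w => Phi (fun x => u x - u1 x) (Da k) u w (y + z))
  (fun k l w => Phi (fun x => u x - u1 x) (DDa k l) u w (y + z)) y z (omega r u y * nrm s%:E u * M)
  (fun k => Phi_UD1 hq hr hs hqrs (y + z) ld la (lDa k) ls (wa k))
  (fun k l => Phi_UD1 hq hr hs hqrs (y + z) ld (lDa k) (lDDa l k) ls (wDa l k)).
have B2 := @second_difference_bound R d H2 (fun k w => Phi u1 (Da k) v1 w 0)
  (fun k l w => Phi u1 (DDa k l) v1 w 0) y z (nrm r%:E u * omega s u y * M)
  (fun k => Phi_UD1 hq hr hs hqrs 0 lr1 la (lDa k) lv (wa k))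
  (fun k l => Phi_UD1 hq hr hs hqrs 0 lr1 (lDa k) (lDDa l k) lv (wDa l k)).
have {}B1 : `|H1 0 - H1 y - H1 z + H1 (y + z)| <= omega r u y * nrm s%:E u * M * l1n y * l1n z.
  apply: B1 => k l w; apply: (le_trans (Phi_bound hq hr hs hqrs w (y + z) ld (lDDa l k) ls)).
  by apply: ler_wpM2l (HM l k); rewrite mulr_ge0 ?nrm_ge0.
have {}B2 : `|H2 0 - H2 y - H2 z + H2 (y + z)| <= nrm r%:E u * omega s u y * M * l1n y * l1n z.
  apply: B2 => k l w; apply: (le_trans (Phi_bound hq hr hs hqrs w 0 lr1 (lDDa l k) lv)).
  rewrite nv (nrm_shift y r0 lr).
  by apply: ler_wpM2l (HM l k); rewrite mulr_ge0 ?nrm_ge0// omega_ge0.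
have H1E w : H1 w = Phi u a u w (y + z) - Phi u1 a u w (y + z) := PhiDl hq hr hs hqrs w (y + z) lr lr1 la ls.
have H2E w : H2 w = Phi u1 a u w (y + z) - Phi u1 a u w z.
  rewrite /H2 /Phi -(IB (Phi_L1 hq hr hs hqrs w (y + z) lr1 la ls) (Phi_L1 hq hr hs hqrs w z lr1 la ls)).
  by apply: I_ext => x; rewrite /v1 subr0; ring.
have sh w1 w2 : Phi u a u w1 w2 = Phi u1 a u (w1 + y) (w2 + y).
  rewrite (Phi_shift hq hr hs hqrs w1 w2 (- y) lr la ls); apply: I_ext => x.
  have -> : x - (w2 + y) = x - y - w2 by apply/rowP => k; rewrite !mxE; ring.
  by have -> : x - (w1 + y) = x - y - w1 by apply/rowP => k; rewrite !mxE; ring.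
have -> : second_difference u a (y, z) + second_difference u a (- y, z) =
    (H1 0 - H1 y - H1 z + H1 (y + z)) + (H2 0 - H2 y - H2 z + H2 (y + z)).
  rewrite /second_difference /= ![Phi u a u _ (- y + z)]sh !H1E !H2E.
  have -> : - y + z + y = z by rewrite addrAC addNr add0r.
  rewrite add0r addNr [z + y]addrC.
  have rearrange (f0 fy fz f g0 gy gz g k0 ky kz k : R) : f0 - fy - fz + f + (ky - k0 - k + kz) =
    f0 - g0 - (fy - gy) - (fz - gz) + (f - g) + (g0 - k0 - (gy - ky) - (gz - kz) + (g - k)) by ring.
  exact: rearrange.
apply: (le_trans (ler_normD _ _)); apply: (le_trans (lerD B1 B2)).
by rewrite le_eqVlt; apply/predU1l; ring.
Qed.

(** The hypothesis on the moduli of continuity separates a small constant from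
    a quadratic term; the latter gains a factor al, and |y| |z| <= (|y|^2 +
    |z|^2) / 2 compensates for the factor 1 / al in the second derivatives of
    the kernel. *)
Lemma commutator_small u a (Da : 'I_d -> V -> R) (DDa : 'I_d -> 'I_d -> V -> R) (M e0 e1 : R) i j :
  Lx r%:E u -> Lx s%:E u ->
  Lx q a -> (forall k, Lx q (Da k)) -> (forall k l, Lx q (DDa k l)) ->
  (forall k, is_weak_partial k a (Da k)) -> (forall k l, is_weak_partial k (Da l) (DDa k l)) ->
  0 <= M -> (forall k l, nrm q (DDa k l) <= M) -> 0 <= e0 -> 0 <= e1 ->
  (forall y, omega r u y * nrm s%:E u + nrm r%:E u * omega s u y <= e0 + e1 * l1n y ^+ 2) ->
  `|commutator_term al u a i j| <= @cG R d ^+ 2 * (e0 + e1 * al) * M.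
Proof.
move=> lr ls la lDa lDDa wa wDa M0 HM e00 e10 Hom.
rewrite (commutator_symmetrised i j lr ls la) normrM.
have -> : `|- 4^-1 : R| = 4^-1 by rewrite normrN ger0_norm.
have al2 : 0 < 2 * al by rewrite mulr_gt0.
have bD := second_difference_BM lr ls la.
have c0 := @cG_ge0 R d.
have bnd : `|iint (p al) (p2 al i j) (fun e => second_difference u a e + second_difference u a (- e.1, e.2))| <=
    @cG R d ^+ 2 * (e0 + e1 * al) * M.
  apply: (iint_bound lp (lp2 i j) (BM_D bD (BM_comp mopp1 bD)) (L1_heat_kernel (d := d) al2) (I_heat_kernel al2)) => y z.
  have P0y : 0 <= p (2 * al) y := heat_kernel_ge0 _ _.
  have P0z : 0 <= p (2 * al) z := heat_kernel_ge0 _ _.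
  have p0y : 0 <= p al y := heat_kernel_ge0 _ _.
  have h0 := p0_le al0 y; have h2 := p0_le2 al0 y; have h4 := p0_le4 al0 y.
  have k0 := p2_le al0 i j z (isT : (0 <= 2)%N).
  have k2 := p2_le al0 i j z (isT : (1 <= 2)%N).
  have hm := second_difference_symmetrised_bound (y, z) lr ls la lDa lDDa wa wDa HM.
  have N0y := l1n_ge0 y; have N0z := l1n_ge0 z; have ho := Hom y.
  rewrite !expr0 !mulr1 in k0; rewrite !expr1 in k2.
  rewrite normrM normrM (ger0_norm p0y).
  move: (second_difference u a (y, z) + _) hm => X hm; rewrite /= in hm.
  move: (omega r u y * _ + _) ho hm => om ho hm.
  move: (p2 al i j z) k0 k2 => t; move: `|t| (normr_ge0 t) => {}t t0 k0 k2.
  move: (p al y) (p (2 * al) y) (p (2 * al) z) (l1n y) (l1n z) (@cG R d) P0y P0z p0y c0 h0 h2 h4 k0 k2 N0y N0z ho hm.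
  move=> x Py Pz Ny Nz c P0y P0z x0 c0 h0 h2 h4 k0 k2 N0y N0z ho hm.
  (* the bound on the second derivatives of the kernel that is singular in
     al *)
  have k0' : t <= c * Pz / al by rewrite ler_pdivlMr// mulrC.
  have k2' : t * Nz ^+ 2 <= c * Pz.
    by rewrite -(ler_pM2l al0) mulrA (le_trans k2)// le_eqVlt; apply/predU1l; ring.
  have NN : Ny * Nz <= (Ny ^+ 2 + Nz ^+ 2) / 2 by have := sqr_ge0 (Ny - Nz); nra.
  have X1 : `|X| <= M * (e0 + e1 * Ny ^+ 2) * ((Ny ^+ 2 + Nz ^+ 2) / 2).
    apply: (le_trans hm); apply: (@le_trans _ _ (M * (e0 + e1 * Ny ^+ 2) * (Ny * Nz))).
      by apply: ler_wpM2r; [exact: mulr_ge0|exact: ler_wpM2l].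
    by apply: ler_wpM2l => //; rewrite mulr_ge0// addr_ge0// mulr_ge0// sqr_ge0.
  have xt0 : 0 <= x * t by exact: mulr_ge0.
  apply: (@le_trans _ _ (x * t * (M * (e0 + e1 * Ny ^+ 2) * ((Ny ^+ 2 + Nz ^+ 2) / 2)))).
    exact: ler_wpM2l.
  have -> : x * t * (M * (e0 + e1 * Ny ^+ 2) * ((Ny ^+ 2 + Nz ^+ 2) / 2)) =
    M / 2 * (e0 * ((Ny ^+ 2 * x) * t + x * (t * Nz ^+ 2)) +
             e1 * ((Ny ^+ 4 * x) * t + (Ny ^+ 2 * x) * (t * Nz ^+ 2))) by field.
  have -> : c ^+ 2 * (e0 + e1 * al) * M * Py * Pz =
    M / 2 * (e0 * ((c * al * Py) * (c * Pz / al) + (c * Py) * (c * Pz)) +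
             e1 * ((c * al ^+ 2 * Py) * (c * Pz / al) + (c * al * Py) * (c * Pz))).
    by field; rewrite gt_eqF.
  have N2 n (N : R) : 0 <= N -> 0 <= N ^+ n by exact: exprn_ge0.
  apply: ler_wpM2l; first by rewrite divr_ge0.
  apply: lerD; apply: ler_wpM2l => //; apply: lerD; apply: ler_pM => //; rewrite ?mulr_ge0// ?N2//.
apply: le_trans bnd; rewrite ler_piMl// invf_le1//.
by rewrite ler1n.
Qed.

End fixed_time.

Lemma omega_le2 (t : R) u y : 1 <= t -> Lx t%:E u -> omega t u y <= 2 * nrm t%:E u.
Proof.
move=> t1 lu; have t0 : (0 <= t%:E)%E by rewrite lee_fin (le_trans _ t1).
apply: (le_trans (nrmB _ lu (Lx_shift y t0 lu))); first by rewrite lee_fin.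
by rewrite (nrm_shift y t0 lu) mulr2n mulrDl mul1r.
Qed.

Let sumM a := \sum_(k < d) \sum_(l < d) nrm q (weak_partials [:: k; l] a).

Lemma sumM_ge0 a : 0 <= sumM a.
Proof. by apply: sumr_ge0 => k _; apply: sumr_ge0 => l _; exact: nrm_ge0. Qed.

Lemma commutator_term_le u a i j (e0 e1 al : R) : 0 < al ->
  Lx r%:E u -> Lx s%:E u -> W2x q a -> 0 <= e0 -> 0 <= e1 ->
  (forall y, omega r u y * nrm s%:E u + nrm r%:E u * omega s u y <= e0 + e1 * l1n y ^+ 2) ->
  `|commutator_term al u a i j| <= @cG R d ^+ 2 * (e0 + e1 * al) * sumM a.
Proof.
move=> al0 lr ls wa e00 e10 Hom.
apply: (commutator_small al0 i j lr ls (W2x_Lx wa)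
  (fun k => W2x_Lx1 k wa) (fun k l => W2x_Lx2 k l wa) (fun k => W2x_weak1 k wa) (fun k l => W2x_weak2 k l wa)) => //.
  exact: sumM_ge0.
by move=> k l; apply: le_sum2 => k' l'; exact: nrm_ge0.
Qed.

(** The moduli of continuity are at most twice the norms; the bound is uniform
    in al, and is the domination needed for the limit under the time
    integral. *)
Lemma commutator_term_bound u a i j (al : R) : 0 < al ->
  Lx r%:E u -> Lx s%:E u -> W2x q a ->
  `|commutator_term al u a i j| <=
  4 * @cG R d ^+ 2 * (nrm r%:E u * nrm s%:E u) * sumM a.
Proof.
move=> al0 lr ls wa.
have U0 : 0 <= nrm r%:E u * nrm s%:E u by rewrite mulr_ge0 ?nrm_ge0.
have -> : 4 * @cG R d ^+ 2 * (nrm r%:E u * nrm s%:E u) * sumM a =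
  @cG R d ^+ 2 * (4 * (nrm r%:E u * nrm s%:E u) + 0 * al) * sumM a.
  by move: (sumM a) => S; ring.
apply: (commutator_term_le i j al0 lr ls wa) => //; first by rewrite mulr_ge0.
move=> y; rewrite mul0r addr0.
have h1 := omega_le2 y (ltW hr) lr; have h2 := omega_le2 y (ltW hs) ls.
have -> : 4 * (nrm r%:E u * nrm s%:E u) = 2 * nrm r%:E u * nrm s%:E u + nrm r%:E u * (2 * nrm s%:E u) by ring.
by apply: lerD; [apply: ler_wpM2r|apply: ler_wpM2l] => //; exact: nrm_ge0.
Qed.

(** The averages of the second differences tend to 0: those along short
    vectors are small because translations are continuous in L^r and L^s,
    those along long vectors because the kernel has a small second moment. *)
Lemma commutator_term_vanishes u a i j (e : R) : 0 < e ->
  Lx r%:E u -> Lx s%:E u -> W2x q a ->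
  exists2 delta : R, 0 < delta & forall al : R, 0 < al -> al < delta ->
    `|commutator_term al u a i j| <= e.
Proof.
move=> e0 lr ls wa; pose U := nrm r%:E u; pose W := nrm s%:E u; pose c := @cG R d.
have U0 : 0 <= U := nrm_ge0 _ _; have W0 : 0 <= W := nrm_ge0 _ _; have c0 : 0 <= c := @cG_ge0 R d.
have S0 := sumM_ge0 a.
pose B := c ^+ 2 * sumM a; have B0 : 0 <= B by rewrite mulr_ge0// sqr_ge0.
pose eps := e / (2 * (B + 1)).
have eps0 : 0 < eps by rewrite divr_gt0// mulr_gt0// ltr_wpDl.
pose eps' := eps / (U + W + 1).
have eps'0 : 0 < eps' by rewrite divr_gt0// ltr_wpDl// addr_ge0.
have [d1 d10 H1] := vanish_omega (ltW hr) lr eps'0.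
have [d2 d20 H2] := vanish_omega (ltW hs) ls eps'0.
pose d0 := Num.min d1 d2; have d00 : 0 < d0 by rewrite lt_min d10.
(* chosen so that K |y|^2 exceeds the trivial bound 4 U W on long vectors *)
pose K := 4 * (U * W) / d0 ^+ 2.
have K0 : 0 <= K by rewrite divr_ge0 ?sqr_ge0// mulr_ge0// mulr_ge0.
have Hom y : omega r u y * W + U * omega s u y <= eps + K * l1n y ^+ 2.
  have [by_|nby] := pselect (box d0 y).
    have h1 := H1 y; have h2 := H2 y.
    have b1 : box d1 y by apply: box_le by_; rewrite ge_min lexx.
    have b2 : box d2 y by apply: box_le by_; rewrite ge_min lexx orbT.
    apply: ler_wpDr; first by rewrite mulr_ge0// sqr_ge0.
    apply: (@le_trans _ _ (eps' * W + U * eps')).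
      by apply: lerD; [apply: ler_wpM2r => //; exact: h1|apply: ler_wpM2l => //; exact: h2].
    have -> : eps' * W + U * eps' = eps * ((U + W) / (U + W + 1)) by rewrite /eps'; ring.
    by rewrite ler_piMr ?(ltW eps0)// ler_pdivrMr ?mul1r ?lerDl// ltr_wpDl// addr_ge0.
  apply: ler_wpDl; first exact: ltW.
  have yd : d0 <= l1n y.
    move/existsNP: nby => [k /negP]; rewrite -ltNge => /ltW h.
    exact: le_trans h (coord_l1n y k).
  have h1 := omega_le2 y (ltW hr) lr; have h2 := omega_le2 y (ltW hs) ls.
  apply: (@le_trans _ _ (4 * (U * W))).
    have -> : 4 * (U * W) = 2 * U * W + U * (2 * W) by ring.
    by apply: lerD; [apply: ler_wpM2r|apply: ler_wpM2l].
  rewrite /K mulrAC ler_pdivlMr ?exprn_gt0//; apply: ler_wpM2l; first by rewrite !mulr_ge0.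
  by apply: lerXn2r => //; rewrite nnegrE ltW// (lt_le_trans d00).
exists (eps / (K + 1)); first by rewrite divr_gt0// ltr_wpDl.
move=> al al0 ald.
apply: (le_trans (commutator_term_le i j al0 lr ls wa (ltW eps0) K0 Hom)).
have Kal : K * al <= eps.
  apply: (@le_trans _ _ (K * (eps / (K + 1)))); first by rewrite ler_wpM2l// ltW.
  by rewrite mulrCA ler_piMr ?(ltW eps0)// ler_pdivrMr ?mul1r ?lerDl// ltr_wpDl.
apply: (@le_trans _ _ (B * (2 * eps))).
  rewrite /B -/c mulrAC; apply: ler_wpM2l; first by rewrite mulr_ge0// sqr_ge0.
  by rewrite mulr2n mulrDl mul1r lerD2l.
have -> : B * (2 * eps) = e * (B / (B + 1)).
  by rewrite /eps; field; rewrite gt_eqF// ltr_wpDl.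
by rewrite ler_piMr ?(ltW e0)// ler_pdivrMr ?mul1r ?lerDl// ltr_wpDl.
Qed.

End second_estimate.

(** * Integration in time *)

Section lower_integrals.
Context {d0} {T : measurableType d0} {R : realType}.
Variables (mu nu : {measure set T -> \bar R}) (D : set T).
Hypotheses (mD : measurable D) (nuE : forall A, nu A = mu (A `&` D)).
Local Open Scope ereal_scope.

(** The integral of a function with values in [0, +oo] is a supremum over the
    simple functions below it, hence it is monotone without any measurability
    assumption; an inequality almost everywhere is enough since a simple
    function may be cut off on a null set. The measure [nu] is the restriction
    of [mu] to D. *)
Lemma ae_le_lower_integral (f g : T -> \bar R) (k : R) : (0 <= k)%R ->
  (forall t, 0 <= f t) -> (forall t, 0 <= g t) ->
  (\forall t \ae nu, f t <= k%:E * g t) ->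
  \int[mu]_(t in D) f t <= k%:E * \int[nu]_t g t.
Proof.
move=> k0 f0 g0 [N [mN N0 fgN]].
rewrite ge0_integralE// ge0_integralTE//.
apply: ge_ereal_sup => _ [h hf <-].
have mA : measurable (D `\` N) by exact: measurableD.
(* h cut off outside D and on the exceptional null set *)
pose h' := proj_nnsfun h mA.
have h'E t : h' t = (h t * \1_(D `\` N) t)%R by [].
have hD t : ~ D t -> h t = 0%R.
  move=> nD; apply/eqP; rewrite eq_le -lee_fin (le_trans (hf t))//=.
  by rewrite patchE memNset.
have hh' : sintegral mu h = sintegral nu h'.
  transitivity (sintegral mu h').
    rewrite -!integralT_nnsfun; apply: ae_eq_integral => //.
    - by apply/measurable_EFinP; exact: measurable_funPT.
    - by apply/measurable_EFinP; exact: measurable_funPT.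
    - exists (N `&` D); split.
      + exact: measurableI.
      + by rewrite -nuE.
      + move=> t; apply: contra_notP => nND _; congr EFin; rewrite h'E indicE.
        have [Dt|nDt] := pselect (D t); last by rewrite hD// mul0r.
        by rewrite mem_set ?mulr1//; split=> // Nt; apply: nND.
  rewrite !sintegralEnnsfun; apply: eq_fsbigr => r; rewrite inE/= => r0; congr (_ * _).
  rewrite nuE; congr (mu _); apply/seteqP; split; last by move=> t [].
  move=> t ht; split=> //; apply: contrapT => nDt; move: ht; rewrite /= (hD _ nDt) mul0r => e.
  by rewrite -e ltxx in r0.
have h'g t : (h' t)%:E <= k%:E * g t.
  rewrite h'E indicE; have [|nA] := boolP (t \in D `\` N); last by rewrite mulr0 mule_ge0// lee_fin.
  rewrite inE => -[Dt Nt]; rewrite mulr1; apply: (le_trans (hf t)); rewrite patchE mem_set//.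
  by apply: contrapT => nfg; apply: Nt; exact: fgN.
rewrite hh'.
(* for k > 0 the simple function h' / k competes in the integral of g *)
have [k00|k00] := eqVneq k 0%R.
  rewrite k00 mul0e (eq_sintegral (cst 0%R)) ?sintegral0// => t.
  apply/eqP; rewrite eq_le; apply/andP; split; last exact: fun_ge0.
  by rewrite -lee_fin (le_trans (h'g t))// k00 mul0e.
have kp : (0 < k)%R by rewrite lt0r k00.
have ki : (0 <= k^-1)%R by rewrite invr_ge0.
have -> : sintegral nu h' = k%:E * sintegral nu (scale_nnsfun h' ki).
  rewrite -sintegralrM; apply: eq_sintegral => t /=.
  by rewrite mulrA divff// mul1r.
rewrite lee_pmul2l//; apply: ereal_sup_ubound; exists (scale_nnsfun h' ki) => //= t.
rewrite (_ : (k^-1 * (h t * \1_(D `\` N) t))%:E = k^-1%:E * (h' t)%:E)// lee_pdivrMl//; exact: h'g.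
Qed.

End lower_integrals.

Section vanishing_in_mean.
Context {d0} {S : measurableType d0} {R : realType} (nu : {measure set S -> \bar R}).
Local Open Scope ereal_scope.

Lemma ae_monotone (P Q : S -> Prop) : (forall t, P t -> Q t) ->
  (\forall t \ae nu, P t) -> \forall t \ae nu, Q t.
Proof. by move=> PQ [N [mN N0 PN]]; exists N; split=> // t nQ; apply: PN => /PQ. Qed.

Lemma ae_conj (P Q : S -> Prop) : (\forall t \ae nu, P t) ->
  (\forall t \ae nu, Q t) -> \forall t \ae nu, P t /\ Q t.
Proof. by have F := ae_filter_ringOfSetsType nu => p q; apply: filterS2 p q => t. Qed.

(** Dominated convergence when the dominating function w is not known to be
    measurable: it is replaced by the supremum of the sequence, which is
    measurable and almost everywhere below a multiple of w. *)
Lemma cvg_integral0_dominated (h : nat -> S -> R) (w : S -> \bar R) (k : R) : (0 <= k)%R ->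
  (forall n, measurable_fun [set: S] (h n)) ->
  (\forall t \ae nu, h n t @[n --> \oo] --> (0 : R)%R) ->
  (forall t, 0 <= w t) -> \int[nu]_t w t < +oo ->
  (\forall t \ae nu, forall n, `|h n t|%:E <= k%:E * w t) ->
  \int[nu]_t `|h n t|%:E @[n --> \oo] --> 0.
Proof.
move=> k0 mh h0 w0 wfin hw.
pose g t := esups (fun n => `|h n t|%:E) 0%N.
have gh n t : `|h n t|%:E <= g t by apply: ereal_sup_ubound; exists n.
have g0 t : 0 <= g t by apply: le_trans (gh 0%N t); rewrite lee_fin.
have mg : measurable_fun [set: S] g.
  apply: (measurable_fun_esups (f := fun n t => `|h n t|%:E)) => n.
  by apply/measurable_EFinP; apply: measurableT_comp.
have gw : \forall t \ae nu, g t <= k%:E * w t.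
  apply: ae_monotone hw => t H; apply: ge_ereal_sup => _ [n _ <-]; exact: H.
have nuE A : nu A = nu (A `&` [set: S]) by rewrite setIT.
have ig : nu.-integrable setT g.
  apply/integrableP; split=> //.
  rewrite (eq_integral g) => [|t _]; last by rewrite gee0_abs.
  apply: (le_lt_trans (ae_le_lower_integral measurableT nuE k0 g0 w0 gw)).
  by rewrite lte_mul_pinfty ?lee_fin ?ltry.
have mhE n : measurable_fun [set: S] (EFin \o h n) by apply/measurable_EFinP.
have c0 : \forall t \ae nu, setT t -> (EFin \o h n) t @[n --> \oo] --> (cst 0 : S -> \bar R) t.
  by apply: ae_monotone h0 => t ht _; apply: cvg_EFin => //; apply: nearW.
have dom : \forall t \ae nu, forall n, setT t -> `|(EFin \o h n) t| <= g t.
  exists set0; split; [exact: measurable0|exact: measure0|].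
  by move=> t H; apply: H => n _; exact: gh.
have [_ + _] := dominated_convergence measurableT mhE (measurable_cst _) c0 ig dom.
apply: cvg_trans; apply: near_eq_cvg; apply: nearW => n.
by apply: eq_integral => t _ /=; rewrite oppr0 addr0.
Qed.

End vanishing_in_mean.

Section right_limits.
Context {R : realType}.
Local Open Scope ereal_scope.

Lemma cvg0_at_right (F : R -> \bar R) : (forall x, 0 <= F x) ->
  (forall v : R^nat, (forall n, (0 < v n)%R) -> v n @[n --> \oo] --> (0 : R)%R ->
     F (v n) @[n --> \oo] --> 0) ->
  F x @[x --> (0 : R)^'+] --> 0.
Proof.
move=> F0 HF.
have key (e : R) : (0 < e)%R -> exists2 delta : R, (0 < delta)%R &
    forall x, (0 < x)%R -> (x < delta)%R -> F x <= e%:E.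
  move=> e0; apply: contrapT => nex.
  have /choice[v Hv] : forall n, exists x : R, [/\ (0 < x)%R, (x < n.+1%:R^-1)%R & e%:E < F x].
    move=> n; apply: contrapT => nx; apply: nex; exists (n.+1%:R^-1)%R; first by rewrite invr_gt0.
    move=> x x0 xn; rewrite leNgt; apply/negP => ex; apply: nx; by exists x.
  have v0 n : (0 < v n)%R by case: (Hv n).
  have cv : v n @[n --> \oo] --> (0 : R)%R.
    have sq : \forall n \near \oo, ((cst 0 : R^nat) n <= v n <= harmonic n)%R.
      by apply: nearW => n; case: (Hv n) => h1 h2 _; rewrite /= !ltW.
    exact: (squeeze_cvgr sq (cvg_cst _) cvg_harmonic).
  have := HF v v0 cv; move=> /fine_cvgP[fin /cvgrPdist_lt /(_ _ e0)] H.
  have : \forall n \near \oo, False.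
    apply: filterS2 fin H => n fn; rewrite sub0r normrN => H.
    case: (Hv n) => _ _; rewrite -[F (v n)]fineK// lte_fin => h.
    by move: H; rewrite ltNge (le_trans (ltW h))// ler_norm.
  by case=> n _ /(_ n (leqnn n)).
apply/fine_cvgP; split.
  have [dl d0 H] := key 1%R ltr01.
  near=> x; rewrite ge0_fin_numE//.
  apply: (@le_lt_trans _ _ 1%:E); last exact: ltry.
  by apply: H; near: x; [exact: nbhs_right_gt|exact: nbhs_right_lt].
apply/cvgrPdist_le => e e0; have [dl d0 H] := key e e0.
near=> x; rewrite sub0r normrN /= ger0_norm ?fine_ge0//.
have Hx : F x <= e%:E by apply: H; near: x; [exact: nbhs_right_gt|exact: nbhs_right_lt].
have Fx : F x \is a fin_num by rewrite ge0_fin_numE// (le_lt_trans Hx)// ltry.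
by rewrite -lee_fin fineK.
Unshelve. all: by end_near. Qed.

End right_limits.

Section time_part.
Context {R : realType} {d : nat}.
Local Notation lam := (@lebesgue_rV R d).
Local Notation V := 'rV[R]_d.
Variable T : R.
Local Notation nu := (@lebesgue_0T R T).
Local Notation D := (`]0, T[%classic : set (measurableTypeR R)).

Lemma lebesgue_0TE A : nu A = (@lebesgue_measure R) (A `&` D).
Proof. by []. Qed.

Let mD : measurable D. Proof. exact: measurable_itv. Qed.

Let aeF : Filter (nbhs (almost_everywhere nu)). Proof. exact: ae_filter_ringOfSetsType. Qed.

Lemma ae_0T_in : \forall t \ae nu, D t.
Proof.
exists (~` D); split; [exact: measurableC| |by move=> t].
by rewrite /lebesgue_0T /= /mrestr setICl measure0.
Qed.

Lemma Lpt_oo_bound (normE : (V -> R) -> \bar R) (f : R -> V -> R) :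
  (forall g, 0 <= normE g)%E -> (Lpt_norm T +oo normE f < +oo)%E ->
  exists2 U : R, 0 <= U & (U%:E = Lpt_norm T +oo normE f)%E /\
    \forall t \ae nu, (normE (f t) <= U%:E)%E.
Proof.
move=> E0 fin.
have L0 : (0 <= Lpt_norm T +oo normE f)%E by exact: Lnorm_ge0.
exists (fine (Lpt_norm T +oo normE f)); first exact: fine_ge0.
have fn : Lpt_norm T +oo normE f \is a fin_num by rewrite ge0_fin_numE.
split; first by rewrite fineK.
rewrite fineK// /Lpt_norm; rewrite unlock /=.
case: ifPn => [_|nu0].
  apply: filterS (ess_sup_ge nu (abse \o (fun t => normE (f t)))) => t /=.
  by rewrite gee0_abs.
exists setT; split => //.
by apply/eqP; rewrite eq_le measure_ge0 andbT leNgt.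
Qed.

Lemma Lpt_1 (normE : (V -> R) -> \bar R) (f : R -> V -> R) : (forall g, 0 <= normE g)%E ->
  Lpt_norm T 1%E normE f = (\int[nu]_t normE (f t))%E.
Proof.
move=> E0; rewrite /Lpt_norm Lnorm1; apply: eq_integral => t _.
by rewrite gee0_abs.
Qed.

(** Extension by 0 outside (0, T), since functions of time are only assumed
    measurable there. *)
Definition ext0 (f : R -> V -> R) (t : R) (x : V) : R := if t \in D then f t x else 0.

Lemma ext0E f t : D t -> ext0 f t = f t.
Proof. by move=> Dt; apply/funext => x; rewrite /ext0 mem_set. Qed.

Lemma measurable_ext0 f : borel_0T T f ->
  measurable_fun [set: measurableTypeR R * V] (fun z => ext0 f z.1 z.2).
Proof.
move=> bf; have mDV : measurable (D `*` [set: V]) by exact: measurableX.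
have /(measurable_restrictT _ mDV) := bf; congr measurable_fun.
apply/funext => z; rewrite patchE /ext0.
by rewrite in_setX [z.2 \in _]mem_set// andbT.
Qed.

Lemma Lpt_oo_le (normE : (V -> R) -> \bar R) (f : R -> V -> R) (W : R) : 0 <= W ->
  (forall g, 0 <= normE g)%E -> (\forall t \ae nu, (normE (f t) <= W%:E)%E) ->
  (Lpt_norm T +oo normE f <= W%:E)%E.
Proof.
move=> W0 E0 H; rewrite /Lpt_norm unlock /=; case: ifPn => [_|_]; last by rewrite lee_fin.
by apply/ess_supP; apply: ae_monotone H => t /=; rewrite gee0_abs.
Qed.

Section estimates.
Variables (q : \bar R) (r s : R).
Hypotheses (hd : (0 < d)%N) (hq : (1 < q)%E) (hr : 1 < r) (hs : 1 < s).
Hypothesis hqrs : (q^-1 + (r%:E)^-1 + (s%:E)^-1 = 1)%E.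

Let Lx_norm_ge0 (t : \bar R) (g : V -> R) : (0 <= Lx_norm t g)%E.
Proof. exact: Lnorm_ge0. Qed.

Lemma W2x_norm_ge0 (t : \bar R) (g : V -> R) : (0 <= W2x_norm t g)%E.
Proof.
rewrite /W2x_norm adde_ge0//; last by apply: sume_ge0 => k _; exact: sume_ge0.
by rewrite adde_ge0//; exact: sume_ge0.
Qed.

Lemma measurable_hessian_norm (A : V -> 'M[R]_d) : (forall i j, W2x q (fun x => A x i j)) ->
  measurable_fun [set: V] (hessian_norm A).
Proof.
move=> wA; apply: measurableT_comp; first exact: (continuous_measurable_fun (@sqrt_continuous R)).
do 4![apply: measurable_sum => ?]; apply: measurable_funX.
exact: Lx_meas (W2x_Lx2 _ _ (wA _ _)).
Qed.

Lemma Lx_norm_hessian (A : V -> 'M[R]_d) i j k l : (forall i j, W2x q (fun x => A x i j)) ->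
  (Lx_norm q (weak_partials [:: k; l] (fun x => A x i j)) <= Lx_norm q (hessian_norm A))%E.
Proof.
move=> wA; apply: Lx_norm_le.
- by rewrite (le_trans _ (ltW hq)).
- exact: Lx_meas (W2x_Lx2 _ _ (wA _ _)).
- exact: measurable_hessian_norm.
move=> x; rewrite /hessian_norm [leRHS]ger0_norm ?sqrtr_ge0// -sqrtr_sqr ler_sqrt; last first.
  by do 4![apply: sumr_ge0 => ? _]; exact: sqr_ge0.
have s2 (F : 'I_d -> R) m : (forall m, 0 <= F m) -> F m <= \sum_(m < d) F m.
  by move=> F0; rewrite (bigD1 m)//= lerDl sumr_ge0.
have p0 i0 j0 k0 l0 : 0 <= (weak_partials [:: k0; l0] (fun y => A y i0 j0) x) ^+ 2 by exact: sqr_ge0.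
apply: le_trans (s2 _ i _) => [|m]; last by do 3![apply: sumr_ge0 => ? _].
apply: le_trans (s2 _ j _) => [|m]; last by do 2![apply: sumr_ge0 => ? _].
apply: le_trans (s2 _ k _) => [|m]; last by apply: sumr_ge0 => ? _.
exact: (s2 (fun l0 => weak_partials [:: k; l0] (fun y => A y i j) x ^+ 2) l).
Qed.

(** The four sums over coordinates, for a_ij and its second derivatives, give
    the factor d^4. *)
Definition commutator_constant : R := @cG R d * (4 + d%:R) * (d * d * d * d)%:R.

Lemma commutator_constant_ge0 : 0 <= commutator_constant.
Proof. by rewrite !mulr_ge0 ?cG_ge0// addr_ge0. Qed.

(** The norm of the Hessian of a is measured by its Euclidean norm, which
    dominates each entry; it is kept as an extended real because it may be
    infinite at some times. *)
Lemma commutator_hessian (al : R) (u f : V -> R) (A : V -> 'M[R]_d) : 0 < al ->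
  Lx r%:E u -> (forall i j, W2x q (fun x => A x i j)) -> W2x s%:E f ->
  ((`|pairing u (commutator (heat al) (contract_hessian A) f)
    - al * pairing u (laplacian_commutator A (heat al f))|)%:E <=
  (commutator_constant * (nrm r%:E u * nrm s%:E f))%:E * Lx_norm q (hessian_norm A))%E.
Proof.
move=> al0 lu wA wf; have H := commutator_estimate hq hr hs hqrs al0 lu wA wf.
set N := nrm r%:E u * nrm s%:E f in H *; have N0 : 0 <= N by rewrite mulr_ge0 ?nrm_ge0.
have c0 : 0 <= @cG R d * (4 + d%:R) by rewrite mulr_ge0 ?cG_ge0// addr_ge0.
have d4 : (0 : R) < (d * d * d * d)%:R by rewrite ltr0n !muln_gt0 hd.
have := Lx_norm_ge0 q (hessian_norm A).
case E : (Lx_norm q (hessian_norm A)) => [h| |]// h0.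
  rewrite -EFinM lee_fin; apply: (le_trans H).
  have -> : commutator_constant * N * h = @cG R d * (4 + d%:R) * (N * ((d * d * d * d)%:R * h)).
    by rewrite /commutator_constant; move: (d * d * d * d)%:R => D4; ring.
  apply: ler_wpM2l => //; apply: ler_wpM2l => //.
  have le1 c k l : nrm q (weak_partials [:: k; l] (fun x => A x c.1 c.2)) <= h.
    by rewrite -lee_fin -E (nrm_EFin (W2x_Lx2 _ _ (wA _ _))); exact: Lx_norm_hessian.
  apply: (@le_trans _ _ (\sum_(c : 'I_d * 'I_d) \sum_(k < d) \sum_(l < d) h)).
    by apply: ler_sum => c _; apply: ler_sum => k _; apply: ler_sum => l _; exact: le1.
  by rewrite !sumr_const card_prod !card_ord -!mulrnA mulr_natl !mulnA lexx.
(* when the norm of the Hessian is infinite, the right-hand side is +oo unless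
   its other factor vanishes; both sides are then 0 *)
have [C0|C0] := eqVneq (commutator_constant * N) 0.
  have cN : @cG R d * (4 + d%:R) * N = 0.
    move/eqP: C0; rewrite /commutator_constant mulrAC mulf_eq0 => /orP[/eqP->//|/eqP h].
    by rewrite h ltxx in d4.
  rewrite C0 mul0e lee_fin; apply: (le_trans H).
  by rewrite mulrA cN mul0r.
rewrite gt0_muley ?leey// lte_fin lt0r C0 /=.
by rewrite (mulr_ge0 commutator_constant_ge0 N0).
Qed.

Lemma integral_commutator_le (a : R -> V -> 'M[R]_d) (u f : R -> V -> R) (al : R) : 0 < al ->
  (forall i j : 'I_d, Lpt T 1%E (W2x q) (W2x_norm q) (fun t x => a t x i j)) ->
  Lpt T +oo%E (Lx r%:E) (Lx_norm r%:E) u ->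
  Lpt T +oo%E (W2x s%:E) (W2x_norm s%:E) f ->
  (\int[@lebesgue_measure R]_(t in `]0%R, T[)
     `|pairing (u t) (commutator (heat al) (contract_hessian (a t)) (f t))
       - al * pairing (u t) (laplacian_commutator (a t) (heat al (f t)))|%:E
   <= commutator_constant%:E
      * Lpt_norm T 1 (fun g => Lx_norm q g) (fun t => hessian_norm (a t))
      * Lpt_norm T +oo (Lx_norm r%:E) u
      * Lpt_norm T +oo (Lx_norm s%:E) f)%E.
Proof.
move=> al0 ha [_ hu1 hu2] [_ hf1 hf2].
have [U U0 [UE Ub]] := Lpt_oo_bound (Lx_norm_ge0 r%:E) hu2.
have [W W0 [_ Wb]] := Lpt_oo_bound (W2x_norm_ge0 s%:E) hf2.
have Wb' : \forall t \ae nu, (Lx_norm s%:E (f t) <= W%:E)%E.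
  apply: ae_monotone Wb => t; apply: le_trans; rewrite /W2x_norm -addeA leeDl// adde_ge0//.
    exact: sume_ge0.
  by apply: sume_ge0 => k _; exact: sume_ge0.
have Ffin := le_lt_trans (Lpt_oo_le W0 (Lx_norm_ge0 s%:E) Wb') (ltry _).
have [F F0 [FE Fb]] := Lpt_oo_bound (Lx_norm_ge0 s%:E) Ffin.
have c0 := commutator_constant_ge0.
rewrite -UE -FE (Lpt_1 _ (Lx_norm_ge0 q)).
have -> : (commutator_constant%:E * (\int[nu]_t Lx_norm q (hessian_norm (a t))) * U%:E * F%:E =
    (commutator_constant * (U * F))%:E * \int[nu]_t Lx_norm q (hessian_norm (a t)))%E.
  by rewrite -muleA -EFinM [in LHS]muleAC -EFinM.
apply: (ae_le_lower_integral mD lebesgue_0TE) => //.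
  by rewrite (mulr_ge0 c0) ?mulr_ge0.
have ha' : \forall t \ae nu, forall c : 'I_d * 'I_d, W2x q (fun x => a t x c.1 c.2).
  by apply: filter_forall => c; case: (ha c.1 c.2).
have ae1 : \forall t \ae nu, (Lx_norm r%:E (u t) <= U%:E)%E /\ Lx r%:E (u t).
  exact: (ae_conj Ub hu1).
have ae2 : \forall t \ae nu, (Lx_norm s%:E (f t) <= F%:E)%E /\ W2x s%:E (f t).
  exact: (ae_conj Fb hf1).
apply: ae_monotone (ae_conj ha' (ae_conj ae1 ae2)) => t [wA [[ub lu] [fb wf]]].
apply: (le_trans (commutator_hessian al0 lu (fun i j => wA (i, j)) wf)).
apply: lee_wpmul2r => //; rewrite lee_fin; apply: ler_wpM2l => //.
apply: ler_pM; rewrite ?nrm_ge0//.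
  by rewrite -lee_fin (nrm_EFin lu).
by rewrite -lee_fin (nrm_EFin (W2x_Lx wf)).
Qed.

Lemma measurable_Phi_time d0 (S : measurableType d0) (u a : R -> V -> R)
    (tau : S -> measurableTypeR R) (m1 m2 : S -> V) :
  measurable_fun [set: measurableTypeR R * V] (fun z => u z.1 z.2) ->
  measurable_fun [set: measurableTypeR R * V] (fun z => a z.1 z.2) ->
  measurable_fun [set: S] tau -> measurable_fun [set: S] m1 -> measurable_fun [set: S] m2 ->
  measurable_fun [set: S] (fun c => Phi (u (tau c)) (a (tau c)) (u (tau c)) (m1 c) (m2 c)).
Proof.
move=> mu ma mtau mm1 mm2.
have mt : measurable_fun [set: S * V] (fun c : S * V => tau c.1) by exact: measurableT_comp.
have ev (g : R -> V -> R) (m : S * V -> V) :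
    measurable_fun [set: measurableTypeR R * V] (fun z => g z.1 z.2) ->
    measurable_fun [set: S * V] m -> measurable_fun [set: S * V] (fun c => g (tau c.1) (m c)).
  move=> mg mm; exact: (measurableT_comp (f := fun z : measurableTypeR R * V => g z.1 z.2) mg (measurable_fun_pair mt mm)).
apply: (@measurable_param _ _ S V R lam
  (fun c : S * V => u (tau c.1) c.2 * u (tau c.1) (c.2 - m2 c.1) * a (tau c.1) (c.2 - m1 c.1))).
apply: measurable_funM.
  apply: measurable_funM; first exact: (ev u (fun c => c.2) mu measurable_snd).
  apply: (ev u (fun c => c.2 - m2 c.1) mu); apply: measurable_subrV => //.
  exact: measurableT_comp.
apply: (ev a (fun c => c.2 - m1 c.1) ma); apply: measurable_subrV => //.
exact: measurableT_comp.
Qed.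

Lemma measurable_commutator_term (u a : R -> V -> R) (al : R) i j :
  measurable_fun [set: measurableTypeR R * V] (fun z => u z.1 z.2) ->
  measurable_fun [set: measurableTypeR R * V] (fun z => a z.1 z.2) ->
  measurable_fun [set: measurableTypeR R] (fun t => commutator_term al (u t) (a t) i j).
Proof.
move=> mu ma.
apply: (@measurable_param _ _ (measurableTypeR R) V R lam (fun c : measurableTypeR R * V =>
  heat_kernel al c.2 * \int[lam]_z (p2 al i j z *
    (Phi (u c.1) (a c.1) (u c.1) c.2 (c.2 + z) - Phi (u c.1) (a c.1) (u c.1) 0 (c.2 + z))))).
apply: measurable_funM; first by apply: measurableT_comp => //; exact: measurable_heat_kernel.
apply: (@measurable_param _ _ (measurableTypeR R * V)%type V R lam (fun e : (measurableTypeR R * V) * V =>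
  p2 al i j e.2 * (Phi (u e.1.1) (a e.1.1) (u e.1.1) e.1.2 (e.1.2 + e.2) -
    Phi (u e.1.1) (a e.1.1) (u e.1.1) 0 (e.1.2 + e.2)))).
apply: measurable_funM; first by apply: measurableT_comp => //; exact: measurable_p2.
have m11 : measurable_fun [set: (measurableTypeR R * V) * V] (fun e : (measurableTypeR R * V) * V => e.1.1).
  exact: measurableT_comp.
have m12 : measurable_fun [set: (measurableTypeR R * V) * V] (fun e : (measurableTypeR R * V) * V => e.1.2).
  exact: measurableT_comp.
have madd : measurable_fun [set: (measurableTypeR R * V) * V] (fun e : (measurableTypeR R * V) * V => e.1.2 + e.2).
  exact: measurable_addrV.
by apply: measurable_funB; apply: measurable_Phi_time.
Qed.

(** Dominated convergence in time, the domination being the norm of a in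
    W^(2,q) times the square of the bound on u. *)
Lemma commutator_term_cvg0 (a u : R -> V -> R) (i j : 'I_d) (v : R^nat) :
  (forall n, 0 < v n) -> v n @[n --> \oo] --> (0 : R) ->
  Lpt T 1%E (W2x q) (W2x_norm q) a ->
  Lpt T +oo%E (Lx r%:E `&` Lx s%:E) (fun g => Lx_norm r%:E g + Lx_norm s%:E g)%E u ->
  (\int[nu]_t `|commutator_term (v n) (ext0 u t) (ext0 a t) i j|%:E @[n --> \oo] --> 0)%E.
Proof.
move=> v0 cv [ba wa ia] [bu lu iu].
have E0 (g : V -> R) : (0 <= Lx_norm r%:E g + Lx_norm s%:E g)%E by rewrite adde_ge0.
have [U U0 [_ Ub]] := Lpt_oo_bound E0 iu.
have ae_all : \forall t \ae nu, D t /\ (Lx_norm r%:E (u t) + Lx_norm s%:E (u t) <= U%:E)%E.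
  exact: (ae_conj ae_0T_in Ub).
have c0 : 0 <= 4 * @cG R d ^+ 2 * (U * U).
  by rewrite (mulr_ge0 _ (mulr_ge0 U0 U0))// mulr_ge0 ?sqr_ge0.
apply: (@cvg_integral0_dominated _ _ R nu
  (fun n t => commutator_term (v n) (ext0 u t) (ext0 a t) i j)
  (fun t => W2x_norm q (a t)) _ c0).
- by move=> n; apply: measurable_commutator_term; exact: measurable_ext0.
- apply: ae_monotone (ae_conj ae_0T_in (ae_conj lu wa)) => t [Dt [[lur lus] wat]].
  rewrite !ext0E//; apply/cvgrPdist_le => e e0.
  have [dl d0 H] := commutator_term_vanishes hq hr hs hqrs i j e0 lur lus wat.
  have : \forall n \near \oo, v n < dl by apply: cvgr_lt cv _ d0.
  apply: filterS => n vn; rewrite sub0r normrN; exact: H.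
- by move=> t; exact: W2x_norm_ge0.
- by move: ia; rewrite (Lpt_1 _ (W2x_norm_ge0 q)).
apply: ae_monotone (ae_conj ae_all (ae_conj lu wa)) => t [[Dt ub] [[lur lus] wat]] n.
rewrite !ext0E//.
have ur : nrm r%:E (u t) <= U.
  by rewrite -lee_fin (nrm_EFin lur) (le_trans _ ub)// leeDl.
have us : nrm s%:E (u t) <= U.
  by rewrite -lee_fin (nrm_EFin lus) (le_trans _ ub)// leeDr.
have -> : W2x_norm q (a t) = (nrm q (a t) + \sum_(k < d) nrm q (weak_partial k (a t))
    + \sum_(k < d) \sum_(l < d) nrm q (weak_partials [:: k; l] (a t)))%:E.
  rewrite /W2x_norm -(nrm_EFin (W2x_Lx wat)) !EFinD -!sumEFin; congr (_ + _ + _)%E.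
    by apply: eq_bigr => k _; rewrite (nrm_EFin (W2x_Lx1 k wat)).
  apply: eq_bigr => k _; rewrite -sumEFin; apply: eq_bigr => l _.
  by rewrite (nrm_EFin (W2x_Lx2 k l wat)).
rewrite -EFinM lee_fin.
apply: (le_trans (commutator_term_bound hq hr hs hqrs i j (v0 n) lur lus wat)).
have S0 : 0 <= \sum_(k < d) \sum_(l < d) nrm q (weak_partials [:: k; l] (a t)).
  by apply: sumr_ge0 => k _; apply: sumr_ge0 => l _; exact: nrm_ge0.
apply: ler_pM => //.
- by rewrite (mulr_ge0 _ (mulr_ge0 (nrm_ge0 _ _) (nrm_ge0 _ _)))// mulr_ge0 ?sqr_ge0.
- apply: ler_wpM2l; first by rewrite mulr_ge0 ?sqr_ge0.
  by apply: ler_pM; rewrite ?nrm_ge0.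
rewrite lerDr addr_ge0 ?nrm_ge0//; apply: sumr_ge0 => k _; exact: nrm_ge0.
Qed.

(** The integral of a nonmeasurable function is not subadditive, so the sum
    over (i, j) is taken after replacing the pairing by a sum of terms that
    are measurable in time. *)
Lemma integral_commutator_cvg0 (a : R -> V -> 'M[R]_d) (u : R -> V -> R) :
  (forall i j : 'I_d, Lpt T 1%E (W2x q) (W2x_norm q) (fun t x => a t x i j)) ->
  Lpt T +oo%E (Lx r%:E `&` Lx s%:E) (fun g => Lx_norm r%:E g + Lx_norm s%:E g)%E u ->
  (\int[@lebesgue_measure R]_(t in `]0%R, T[)
     `|pairing (u t) (commutator (heat alpha) (contract_hessian (a t)) (heat alpha (u t)))|%:E
   @[alpha --> (0 : R)^'+] --> 0)%E.
Proof.
move=> ha hu; have [bu lu _] := hu.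
apply: cvg0_at_right => [al|v v0 cv]; first by apply: integral_ge0 => t _; rewrite lee_fin.
pose tm n (c : 'I_d * 'I_d) t :=
  commutator_term (v n) (ext0 u t) (ext0 (fun t x => a t x c.1 c.2) t) c.1 c.2.
have mtm n c : measurable_fun [set: measurableTypeR R] (fun t => `|tm n c t|%:E).
  apply/measurable_EFinP; apply: measurableT_comp => //.
  by apply: measurable_commutator_term; apply: measurable_ext0 => //; case: (ha c.1 c.2).
have wa : \forall t \ae nu, forall c : 'I_d * 'I_d, W2x q (fun x => a t x c.1 c.2).
  by apply: filter_forall => c; case: (ha c.1 c.2).
have cvs : (\sum_(c : 'I_d * 'I_d) \int[nu]_t `|tm n c t|%:E @[n --> \oo] --> 0)%E.
  have := @cvg_nnesum _ _ eventually_filter R _ (index_enum ('I_d * 'I_d)%type)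
    (fun c n => \int[nu]_t `|tm n c t|%:E)%E (fun=> 0%E) xpredT.
  rewrite big1//; apply => c _; last exact: commutator_term_cvg0 v0 cv (ha c.1 c.2) hu.
  by apply: nearW => n; apply: integral_ge0 => t _; rewrite lee_fin.
apply: (squeeze_cvge _ (cvg_cst 0%E) cvs); apply: nearW => n; apply/andP; split.
  by apply: integral_ge0 => t _; rewrite lee_fin.
rewrite -(ge0_integral_sum nu measurableT (mtm n)); last by move=> c t _; rewrite lee_fin.
rewrite -[leRHS]mul1e; apply: (ae_le_lower_integral mD lebesgue_0TE) => //.
  by move=> t; apply: sume_ge0 => c _; rewrite lee_fin.
apply: ae_monotone (ae_conj ae_0T_in (ae_conj lu wa)) => t [Dt [[lur lus] wat]].
have := pairing_commutator_heat hq hr hs hqrs (v0 n) lur lus (fun i j => W2x_Lx (wat (i, j))).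
move: (pairing _ _) => Q QE; have {QE}-> : Q = \sum_c tm n c t.
  by rewrite QE; apply: eq_bigr => c _; rewrite /tm !ext0E.
by rewrite mul1e sumEFin lee_fin; exact: ler_norm_sum.
Qed.

End estimates.

End time_part.

Theorem lemma3p5 (R : realType) (d : nat) (hd : (0 < d)%N) :
  exists c : R,
  forall (T : R) (hT : 0 <= T)
    (q : \bar R) (r s : R) (hq : (1 < q)%E) (hr : 1 < r) (hs : 1 < s)
    (hqrs : (q^-1 + (r%:E)^-1 + (s%:E)^-1 = 1)%E)
    (a : R -> 'rV[R]_d -> 'M[R]_d)
    (ha_sym : forall t x, 0 < t < T -> sym_nonneg (a t x))
    (ha_borel : forall i j : 'I_d, borel_0T T (fun t x => a t x i j))
    (ha : forall i j : 'I_d,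
       Lpt T 1%E (W2x q) (W2x_norm q) (fun t x => a t x i j)),
  (forall (u f : R -> 'rV[R]_d -> R)
     (hu : Lpt T +oo%E (Lx r%:E) (Lx_norm r%:E) u)
     (hf : Lpt T +oo%E (W2x s%:E) (W2x_norm s%:E) f)
     (alpha : R) (halpha : 0 < alpha < 1),
     (\int[@lebesgue_measure R]_(t in `]0%R, T[)
        `|pairing (u t) (commutator (heat alpha) (contract_hessian (a t)) (f t))
          - alpha * pairing (u t) (laplacian_commutator (a t) (heat alpha (f t)))|%:E
      <= c%:E
         * Lpt_norm T 1 (fun g => Lx_norm q g) (fun t => hessian_norm (a t))
         * Lpt_norm T +oo (Lx_norm r%:E) u
         * Lpt_norm T +oo (Lx_norm s%:E) f)%E)
  /\
  (forall (u : R -> 'rV[R]_d -> R)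
     (hu : Lpt T +oo%E (Lx r%:E `&` Lx s%:E)
             (fun g => Lx_norm r%:E g + Lx_norm s%:E g)%E u),
     (\int[@lebesgue_measure R]_(t in `]0%R, T[)
        `|pairing (u t) (commutator (heat alpha) (contract_hessian (a t))
                           (heat alpha (u t)))|%:E)%E
       @[alpha --> (0 : R)^'+] --> 0%E).
Proof.
exists (@commutator_constant R d) => T hT q r s hq hr hs hqrs a _ _ ha; split.
  move=> u f hu hf al /andP[al0 _].
  by have := @integral_commutator_le R d T q r s hd hq hr hs hqrs a u f al al0 ha; exact.
by move=> u hu; have := @integral_commutator_cvg0 R d T q r s hq hr hs hqrs a u ha hu; exact.
Qed.
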